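(* Let $d \geq 2$. The infinite-volume IDLA forests $\mathcal{F}_\infty$ and $(\mathcal{F}_n)_{n\geq 0}$ satisfy the following properties: 1. Almost surely, the vertex set of $\mathcal{F}_\infty$ is $V(\mathcal{F}_\infty)=\mathbb{Z}^d$. 2. The distributions of $(\mathcal{F}_n)_{n\ge0}$ and of $\mathcal{F}_\infty$ are invariant with respect to the translations $T_k$, $k\in\mathcal{H}$. 3. The distributions of $(\mathcal{F}_n)_{n\ge0}$ and of $\mathcal{F}_\infty$ are $\alpha$-mixing: for all $n\ge0$ and all events $\mathcal{A},\mathcal{B}$ (measurable sets of graphs), $$\lim_{|k|\to\infty}\mathbb{P}\left(\mathcal{F}_n\in\mathcal{A},\ T_k\mathcal{F}_n\in\mathcal{B}\right)=\mathbb{P}(\mathcal{F}_n\in\mathcal{A})\,\mathbb{P}(\mathcal{F}_n\in\mathcal{B})$$ and $$\lim_{|k|\to\infty}\mathbb{P}\left(\mathcal{F}_\infty\in\mathcal{A},\ T_k\mathcal{F}_\infty\in\mathcal{B}\right)=\mathbb{P}(\mathcal{F}_\infty\in\mathcal{A})\,\mathbb{P}(\mathcal{F}_\infty\in\mathcal{B}),$$ where $k$ ranges over $\mathcal{H}$. Consequently, the distributions of $(\mathcal{F}_n)_{n\ge0}$ and of $\mathcal{F}_\infty$ are ergodic with respect to the translations $T_k$, $k\in\mathcal{H}$.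
   Context: Fix an integer $d\ge 2$ and let $\|x\|=\max_i |x_i|$. Let $\mathcal{H}=\{0\}\times\mathbb{Z}^{d-1}$ (the set of sources), $\mathcal{H}_M=\{0\}\times\{-M,\dots,M\}^{d-1}$ and $\mathbb{Z}_K=\mathbb{Z}\times\{-K,\dots,K\}^{d-1}$ for integers $M,K\ge 0$. Random inputs: $(\mathcal{N}_z)_{z\in\mathcal{H}}$ are i.i.d. Poisson point processes on $\mathbb{R}_+$ with intensity $1$; the successive points of $\mathcal{N}_z$ are $\tau_{z,1}<\tau_{z,2}<\cdots$. The $(S_{z,j})_{z\in\mathcal{H},j\ge1}$ are independent simple random walks on $\mathbb{Z}^d$, with $S_{z,j}(0)=z$, independent of the Poisson processes. Finite-volume forest: given integers $n,M\ge0$, list the (a.s. finitely many) pairs $(z,j)$ with $z\in\mathcal{H}_M$ and $\tau_{z,j}\in[0,n]$ by increasing $\tau_{z,j}$ (a.s. distinct). Start with $A=\emptyset$ and the empty graph $(V,E)=(\emptyset,\emptyset)$. For each pair $(z,j)$ in turn, let $k$ be the smallest index with $S_{z,j}(k)\notin A$ and $x=S_{z,j}(k)$. If $k=0$, replace $V$ by $V\cup\{x\}$ and leave $E$ unchanged. If $k\ge1$, let $x'=S_{z,j}(k-1)\in A$ and replace $V$ by $V\cup\{x\}$ and $E$ by $E\cup\{(x',x)\}$. In both cases replace $A$ by $A\cup\{x\}$. The final graph is $\mathcal{F}_n[M]$. All forests are built from the same Poisson processes and walks. For a graph $\mathcal{F}$, $\mathcal{F}\cap\mathbb{Z}_K$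 consists of its vertices in $\mathbb{Z}_K$ and its edges with both endpoints in $\mathbb{Z}_K$. Infinite-volume forests: almost surely, for all $n,K\ge1$ there is a random integer $N_0(n,K)$, which can be chosen increasing in $n$ and in $K$, such that $\mathcal{F}_n[N]\cap\mathbb{Z}_K=\mathcal{F}_n[N_0(n,K)]\cap\mathbb{Z}_K$ for all $N\ge N_0(n,K)$ (this is a result of the paper, making the following definitions meaningful). Then $\mathcal{F}_n:=\bigcup_{K\ge1}\mathcal{F}_n[N_0(n,K)]\cap\mathbb{Z}_K$ (an increasing union of graphs; $\mathcal{F}_0$ is the empty graph), and, since a.s. $\mathcal{F}_n\subset\mathcal{F}_{n+1}$ (vertices and edges), $\mathcal{F}_\infty:=\bigcup_{n\ge1}\mathcal{F}_n$. For $k\in\mathcal{H}$, $T_k(x)=x+k$ on $\mathbb{Z}^d$, and $T_k\mathcal{F}$ is the graph obtained from $\mathcal{F}$ by translating all its vertices and edges by $k$. The space of graphs (vertex sets and edge sets in the lattice $\mathbb{Z}^d$) carries the product $\sigma$-algebra. Ergodicity means that every event invariant under all $T_k$, $k\in\mathcal{H}$, has probability $0$ or $1$. *)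

(* Defs.v *)
From HB Require Import structures.
From mathcomp Require Import all_boot all_order all_algebra.
From mathcomp Require Import finmap.
From mathcomp Require Import all_classical all_reals all_analysis.
From mathcomp Require Import measurable_realfun.

Set Implicit Arguments.
Unset Strict Implicit.
Unset Printing Implicit Defensive.

Import Order.TTheory GRing.Theory Num.Theory.
Import numFieldNormedType.Exports.

Local Open Scope classical_set_scope.
Local Open Scope ring_scope.

Definition lattice (d : nat) : Type := 'rV[int]_d.

HB.instance Definition _ (d : nat) := GRing.Zmodule.on (lattice d).
HB.instance Definition _ (d : nat) := Countable.on (lattice d).
HB.instance Definition _ (d : nat) := isPointed.Build (lattice d) 0.
HB.instance Definition _ (d : nat) := @isMeasurable.Build default_measure_display
  (lattice d) discrete_measurable discrete_measurable0
  discrete_measurableC discrete_measurableU.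

Definition sup_norm (d : nat) (x : lattice d) : nat :=
  (\max_(i < d) `|x ord0 i|)%N.

(* The first coordinate is the one of index 0. *)
Definition in_H (d : nat) (x : lattice d) : bool :=
  [forall i : 'I_d, (val i == 0)%N ==> (x ord0 i == 0)].

Definition in_cylinder (d K : nat) (x : lattice d) : bool :=
  [forall i : 'I_d, (val i != 0)%N ==> (`|x ord0 i| <= K)%N].

Definition source (d : nat) := {z : lattice d | in_H z}.

Definition source_infty (d : nat) : set_system (source d) :=
  filter_from setT (fun N : nat => [set k | (N <= sup_norm (val k))%N]).

Global Instance source_infty_filter (d : nat) : Filter (@source_infty d).
Proof.
apply: filter_from_filter; first by exists 0%N.
move=> i j _ _; exists (maxn i j) => // k /=.
by rewrite geq_max => /andP[].
Qed.

Record graph (d : nat) := Graph {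
  vertices : set (lattice d);
  edges : set (lattice d * lattice d) }.

Definition empty_graph (d : nat) : graph d := Graph set0 set0.

HB.instance Definition _ (d : nat) := gen_eqMixin (graph d).
HB.instance Definition _ (d : nat) := gen_choiceMixin (graph d).
HB.instance Definition _ (d : nat) := isPointed.Build (graph d) (empty_graph d).

(* A graph is identified with the indicator functions of its vertices and of
   its edges, without requiring that edges join neighbours or have their
   endpoints among the vertices; these are the coordinate events of the
   product. *)
Definition graph_coordinates (d : nat) : set_system (graph d) :=
  [set A | (exists x, A = [set G | vertices G x]) \/
           (exists e, A = [set G | edges G e])].

HB.instance Definition _ (d : nat) :=
  @isMeasurable.Build (sigma_display (@graph_coordinates d)) (graph d)
    <<s @graph_coordinates d >>
    (@sigma_algebra0 _ setT (@graph_coordinates d))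
    (@sigma_algebraC _ (@graph_coordinates d))
    (@sigma_algebra_bigcup _ setT (@graph_coordinates d)).

Definition graph_seq_coordinates (d : nat) : set_system (nat -> graph d) :=
  [set A | exists n B, measurable B /\ A = [set G | B (G n)]].

Definition graph_seq (d : nat) := g_sigma_algebraType (@graph_seq_coordinates d).

Definition restrict_graph (d K : nat) (G : graph d) : graph d :=
  Graph [set x | vertices G x /\ in_cylinder K x]
        [set e | [/\ edges G e, in_cylinder K e.1 & in_cylinder K e.2]].

Definition union_graph (d : nat) (I : set nat) (G : nat -> graph d) : graph d :=
  Graph (\bigcup_(i in I) vertices (G i)) (\bigcup_(i in I) edges (G i)).

Definition translate_graph (d : nat) (k : source d) (G : graph d) : graph d :=
  Graph [set x + val k | x in vertices G]
        [set (e.1 + val k, e.2 + val k) | e in edges G].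

Definition translate_graph_seq (d : nat) (k : source d) (G : graph_seq d) :
    graph_seq d :=
  fun n => translate_graph k (G n).

(* Clocks and particles of a source are numbered from 0: [tau z j] is the
   (j+1)-st point of the clock of [z], which releases the walk [S z j]. *)

(* The value is 0 if the walk never leaves [A]. *)
Definition first_exit (d : nat) (A : set (lattice d)) (s : nat -> lattice d) : nat :=
  xget 0%N [set k | ~ A (s k) /\ forall i, (i < k)%N -> A (s i)].

(* The current aggregate always coincides with the current vertex set. *)
Definition settle (d : nat) (G : graph d) (s : nat -> lattice d) : graph d :=
  match first_exit (vertices G) s with
  | 0%N => Graph (vertices G `|` [set s 0%N]) (edges G)
  | k.+1 => Graph (vertices G `|` [set s k.+1]) (edges G `|` [set (s k, s k.+1)])
  end.

(* [fset_set] is empty on the null event where the set is infinite. *)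
Definition arrivals (d : nat) (R : realType) (tau : source d -> nat -> R)
    (n M : nat) : seq (source d * nat) :=
  sort (fun p q => tau p.1 p.2 <= tau q.1 q.2)
    (enum_fset (fset_set [set p : source d * nat |
       in_cylinder M (val p.1) /\ 0 <= tau p.1 p.2 <= n%:R])).

Definition finite_forest (d : nat) (R : realType) (tau : source d -> nat -> R)
    (S : source d -> nat -> nat -> lattice d) (n M : nat) : graph d :=
  foldl (fun G p => settle G (S p.1 p.2)) (empty_graph d) (arrivals tau n M).

Definition stabilizing (d : nat) (R : realType) (tau : source d -> nat -> R)
    (S : source d -> nat -> nat -> lattice d) (N0 : nat -> nat -> nat) : Prop :=
  [/\ forall K, {homo N0 ^~ K : n n' / (n <= n')%N},
      forall n, {homo N0 n : K K' / (K <= K')%N} &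
      forall n K N, (1 <= n)%N -> (1 <= K)%N -> (N0 n K <= N)%N ->
        restrict_graph K (finite_forest tau S n N) =
        restrict_graph K (finite_forest tau S n (N0 n K))].

(* A stabilizing choice of N0, which exists almost surely. The value on the
   exceptional null event is irrelevant. *)
Definition stabilization_rank (d : nat) (R : realType)
    (tau : source d -> nat -> R) (S : source d -> nat -> nat -> lattice d) :
    nat -> nat -> nat :=
  xget (fun _ _ => 0%N) [set N0 | stabilizing tau S N0].

Definition forest (d : nat) (R : realType) (tau : source d -> nat -> R)
    (S : source d -> nat -> nat -> lattice d) (n : nat) : graph d :=
  if n == 0%N then empty_graph d else
  union_graph [set K | (1 <= K)%N] (fun K =>
    restrict_graph K (finite_forest tau S n (stabilization_rank tau S n K))).

Definition forest_infty (d : nat) (R : realType) (tau : source d -> nat -> R)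
    (S : source d -> nat -> nat -> lattice d) : graph d :=
  union_graph [set n | (1 <= n)%N] (forest tau S).

Section Inputs.
Context (disp : measure_display) (Omega : measurableType disp) (R : realType)
  (P : probability Omega R).

Definition independent (I : choiceType) (F : I -> set_system Omega) : Prop :=
  forall (J : {fset I}) (A : I -> set Omega),
    (forall i, i \in J -> F i (A i)) ->
    P (\bigcap_(i in [set` J]) A i) = (\prod_(i <- J) P (A i))%E.

Definition sigma_rv (dT : measure_display) (T : measurableType dT)
    (X : Omega -> T) : set_system Omega :=
  preimage_set_system setT X measurable.

Definition sigma_process (dT : measure_display) (T : measurableType dT)
    (X : nat -> Omega -> T) : set_system Omega :=
  <<s \bigcup_k sigma_rv (X k) >>.

Definition point_count (tau : nat -> Omega -> R) (B : set R) (w : Omega) : \bar R :=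
  counting [set j | B (tau j w)].

(* [tau] enumerates increasingly a Poisson point process of intensity 1 on R_+,
   i.e. with intensity measure B |-> |B `&` [0,+oo[|. The second argument of
   [poisson_prob] is a dummy. *)
Definition poisson_clock (tau : nat -> Omega -> R) : Prop :=
  [/\ {ae P, forall w, forall j, tau j w < tau j.+1 w},
      forall (B : set R), measurable B ->
        (lebesgue_measure (B `&` `[0%R, +oo[) < +oo)%E ->
        forall m : nat, P [set w | point_count tau B w = m%:R%:E] =
          poisson_prob (fine (lebesgue_measure (B `&` `[0%R, +oo[))) 0%N [set m] &
      forall B : nat -> set R, (forall i, measurable (B i)) -> trivIset setT B ->
        independent (fun i => sigma_rv (point_count tau (B i)))].

Definition simple_random_walk (d : nat) (z : lattice d)
    (S : nat -> Omega -> lattice d) : Prop :=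
  let step k w : lattice d := S k.+1 w - S k w in
  [/\ {ae P, forall w, S 0%N w = z},
      forall k (e : lattice d), (\sum_(i < d) `|e ord0 i| = 1)%N ->
        P [set w | step k w = e] = ((2 * d)%:R^-1)%:E &
      independent (fun k => sigma_rv (step k))].

Record idla_input (d : nat) (tau : source d -> nat -> {RV P >-> R})
    (S : source d -> nat -> nat -> {RV P >-> lattice d}) : Prop := IdlaInput {
  input_clock : forall z, poisson_clock (tau z);
  input_walk : forall z j, simple_random_walk (val z) (S z j);
  input_independent : independent
    (fun i : source d + source d * nat =>
       match i with
       | inl z => sigma_process (fun j => tau z j : Omega -> R)
       | inr (z, j) => sigma_process (fun k => S z j k : Omega -> lattice d)
       end) }.

Definition idla_forest (d : nat) (tau : source d -> nat -> {RV P >-> R})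
    (S : source d -> nat -> nat -> {RV P >-> lattice d}) (w : Omega) (n : nat) :
    graph d :=
  forest (fun z j => tau z j w) (fun z j k => S z j k w) n.

Definition idla_forest_infty (d : nat) (tau : source d -> nat -> {RV P >-> R})
    (S : source d -> nat -> nat -> {RV P >-> lattice d}) (w : Omega) : graph d :=
  forest_infty (fun z j => tau z j w) (fun z j k => S z j k w).

Section Laws.
Context (d : nat) (dT : measure_display) (T : measurableType dT)
  (theta : source d -> T -> T) (X : Omega -> T).

Definition law_invariant : Prop :=
  forall k A, measurable A ->
    P [set w | A (theta k (X w))] = P [set w | A (X w)].

Definition law_mixing : Prop :=
  forall A B, measurable A -> measurable B ->
    P [set w | A (X w) /\ B (theta k (X w))] @[k --> @source_infty d] -->
      (P [set w | A (X w)] * P [set w | B (X w)])%E.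

Definition law_ergodic : Prop :=
  forall A, measurable A -> (forall k, theta k @^-1` A = A) ->
    P [set w | A (X w)] = 0%E \/ P [set w | A (X w)] = 1%E.

End Laws.

End Inputs.

(* Main.v *)
(* Settling is monotone: releasing more particles only enlarges the aggregate
   at every time.  Hence the aggregates of finite sets of particles have a limit
   A, which does not depend on the exhausting boxes and is therefore translation
   covariant, and the exit index of each particle can only increase as particles
   are added.  Let lambda be the mean number of particles of a source up to
   time n.  Comparing translated copies of a small box with a large box, whose
   boundary is negligible, shows that A has at most lambda sites per column on
   average.  So A is almost surely finite in each cylinder, and the probability
   that A contains a site at height h tends to 0 with |h|.  The walk of a
   particle is independent of the aggregate of the others, so when it first
   reaches a large height it has escaped with high probability: every particle
   has a limiting position.  By mass transport these positions, which are
   distinct and in A, also have mean number lambda in each column, hence they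
   exhaust A almost surely.  Each vertex of A in a cylinder is then the limiting
   position of a particle which settles there, through the same edge, in all
   large enough boxes: the forests stabilize to an explicit covariant function
   of the input.

   The law of the input is determined by its definition, hence invariant under
   translations, and it is mixing because distant sources are independent; both
   properties pass to the forests, and mixing implies ergodicity.  A site is
   covered once more walks of a single source than the length of a path to it
   have started by following this path. *)

Require Import Defs.
From HB Require Import structures.
From mathcomp Require Import all_boot all_order all_algebra finmap.
From mathcomp Require Import all_classical all_reals all_analysis.
From mathcomp Require Import measurable_realfun.
From mathcomp Require Import zify ring lra.

Set Implicit Arguments.
Unset Strict Implicit.
Unset Printing Implicit Defensive.

Import Order.TTheory GRing.Theory Num.Theory.
Import numFieldNormedType.Exports.

Local Open Scope classical_set_scope.
Local Open Scope ring_scope.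

(** * Finite and limiting aggregates *)

(** Monotonicity makes the limiting aggregate exist at once, but it does not decide who sits where.
    As boxes grow, an occupied site stays occupied while its occupant may change infinitely often,
    and a given particle may be pushed out forever. The two failures are ruled out separately: the
    escape argument gives every particle a final site, and the equality of mean masses then leaves
    no occupied site without a final occupant. That equality can be exploited because the mean
    number of particles per source is finite and can be subtracted.

    The stabilization rank is an arbitrary choice, defined for every outcome including the
    exceptional ones. Covariance is therefore obtained only almost surely, while measurability has
    to be proved everywhere, with the default values taken into account. Translations act on clocks
    and walks rather than on [Omega], so aggregates are studied on the space of inputs, under the
    image of [P]. *)

Lemma graph_eqP d (G H : graph d) :
  G = H <-> (forall y, vertices G y <-> vertices H y) /\
            (forall e, edges G e <-> edges H e).
Proof.
split=> [->//|]; case: G H => [V E] [V' E'] /= [h1 h2].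
by congr Graph; apply/seteqP; split=> y; rewrite ?h1 ?h2.
Qed.

Section FirstExit.
Variable d : nat.
Implicit Types (A : set (lattice d)) (s : nat -> lattice d) (G : graph d).

Lemma first_exit_unique A s k :
  ~ A (s k) -> (forall i, (i < k)%N -> A (s i)) -> first_exit A s = k.
Proof.
move=> sk si; apply: xget_unique => [//|j [sj sij]].
have [jk|kj|//] := ltngtP j k; first by have := sj (si _ jk).
by have := sk (sij _ kj).
Qed.

Lemma first_exitP A s : (exists k, ~ A (s k)) ->
  ~ A (s (first_exit A s)) /\ forall i, (i < first_exit A s)%N -> A (s i).
Proof.
move=> [k0 k0P].
have ex : exists k, `[< ~ A (s k) >] by exists k0; apply/asboolP.
set k := ex_minn ex.
have [/asboolP kP kmin] : `[< ~ A (s k) >] /\ forall j, `[< ~ A (s j) >] -> (k <= j)%N.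
  by rewrite /k; case: ex_minnP.
have kl i : (i < k)%N -> A (s i).
  move=> ik; apply: contrapT => /asboolP/kmin; by rewrite leqNgt ik.
by rewrite (first_exit_unique kP kl).
Qed.

Lemma settle_vertices G s :
  vertices (settle G s) = vertices G `|` [set s (first_exit (vertices G) s)].
Proof. by rewrite /settle; case: first_exit. Qed.

Lemma settle_edges G s e : edges (settle G s) e <->
  edges G e \/ exists k, first_exit (vertices G) s = k.+1 /\ e = (s k, s k.+1).
Proof.
rewrite /settle; case: first_exit => [|k] /=; split; try tauto.
- by move=> [//|[k []]].
- by move=> [|->]; [left|right; exists k].
- by move=> [|[j [[->]]->]]; [left|right].
Qed.

(** The walk leaves the larger set no earlier than the smaller one. If it leaves strictly later, the
    exit site from the smaller set already lies in the larger one; if at the same time, both sets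
    receive the same site. *)
Lemma settle_subset G G' s : (exists k, ~ vertices G' (s k)) ->
  vertices G `<=` vertices G' ->
  vertices (settle G s) `<=` vertices (settle G' s).
Proof.
move=> ex' GG'; have [n' l'] := first_exitP ex'.
have [n l] : ~ vertices G (s (first_exit (vertices G) s)) /\ forall i,
  (i < first_exit (vertices G) s)%N -> vertices G (s i).
  by apply: first_exitP; case: ex' => k hk; exists k => /GG'.
rewrite !settle_vertices => y [/GG'|->]; first by left.
set k := first_exit (vertices G) s in n l *.
set k' := first_exit (vertices G') s in n' l' *.
have [kk'|k'k|->] := ltngtP k k'; [by left; exact: l'| |by right].
by case: n'; apply: GG'; exact: l.
Qed.

End FirstExit.

Section Deterministic.
Variables (d : nat) (R : realType).

Notation particle := (source d * nat)%type.

(** One realization of all clocks and walks. Translations act on this space, whereas an abstract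
    sample space carries no such action. *)
Definition input : Type :=
  ((source d -> nat -> R) * (source d -> nat -> nat -> lattice d))%type.

Implicit Types (x : input) (p q : particle) (Q : seq particle).

Definition tm x p : R := x.1 p.1 p.2.
Definition wk x p : nat -> lattice d := x.2 p.1 p.2.

Definition release x : rel particle := fun p q => tm x p <= tm x q.
Definition grow x (G : graph d) Q : graph d :=
  foldl (fun G p => settle G (wk x p)) G Q.
(** Removing duplicates makes a run depend only on the set of listed particles, so that sequences
    can stand for finite sets. *)
Definition schedule x Q := sort (release x) (undup Q).
Definition run x Q : graph d := grow x (empty_graph d) (schedule x Q).
Definition prior x p Q := [seq q <- Q | tm x q < tm x p].
(** Only the particles of [Q] released before [p] matter, so the index makes sense whether or not
    [p] belongs to [Q]. *)
Definition exit_index x Q p := first_exit (vertices (run x (prior x p Q))) (wk x p).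

Record regular x : Prop := Regular {
  regular_inj : injective (tm x);
  regular_exit : forall p A, finite_set A -> exists k, ~ A (wk x p k) }.

Lemma release_trans x : transitive (release x).
Proof. by move=> q p r; exact: le_trans. Qed.
Lemma release_total x : total (release x).
Proof. by move=> p q; exact: le_total. Qed.

Section Regular.
Variable x : input.
Hypothesis hx : regular x.

Let tm_inj := regular_inj hx.

Lemma release_anti : antisymmetric (release x).
Proof. by move=> p q /le_anti/tm_inj. Qed.

Lemma schedule_eq Q Q' : Q =i Q' -> schedule x Q = schedule x Q'.
Proof.
move=> QQ'; apply/(perm_sortP (@release_total x) (@release_trans x) release_anti).
by apply: uniq_perm; rewrite ?undup_uniq// => p; rewrite !mem_undup QQ'.
Qed.

Lemma run_eq Q Q' : Q =i Q' -> run x Q = run x Q'.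
Proof. by move=> /schedule_eq; rewrite /run => ->. Qed.

Lemma mem_schedule Q : schedule x Q =i Q.
Proof. by move=> p; rewrite mem_sort mem_undup. Qed.

Lemma schedule_uniq Q : uniq (schedule x Q).
Proof. by rewrite sort_uniq undup_uniq. Qed.

Lemma schedule_filter (a : pred particle) Q :
  schedule x (seq.filter a Q) = seq.filter a (schedule x Q).
Proof.
rewrite /schedule -filter_undup filter_sort//; last exact: release_trans.
exact: release_total.
Qed.

Lemma schedule_sorted Q : sorted (fun p q => tm x p < tm x q) (schedule x Q).
Proof.
have := schedule_uniq Q; have : sorted (release x) (schedule x Q).
  by apply: sort_sorted; exact: release_total.
case: (schedule x Q) => // p s; elim: s p => //= q s IH p /andP[pq qs] /and3P[pn qn us].
rewrite IH ?qn// andbT lt_neqAle (pq : tm x p <= tm x q) andbT.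
by apply: contra pn => /eqP/tm_inj->; rewrite inE eqxx.
Qed.

Lemma grow_finite G Q : finite_set (vertices G) -> finite_set (vertices (grow x G Q)).
Proof.
elim: Q G => //= p Q IH G fG; apply: IH.
by rewrite settle_vertices finite_setU; split=> //; exact: finite_set1.
Qed.

Lemma run_finite Q : finite_set (vertices (run x Q)).
Proof. by apply: grow_finite; exact: finite_set0. Qed.

(** Monotonicity propagates along the release order: a particle found only in the longer list
    enlarges the larger aggregate, and a common one is handled by [settle_subset]. *)
Lemma grow_subset G G' Q Q' : finite_set (vertices G') ->
  vertices G `<=` vertices G' -> subseq Q Q' ->
  vertices (grow x G Q) `<=` vertices (grow x G' Q').
Proof.
elim: Q' G G' Q => [|q Q' IH] G G' Q fG' GG'; first by move=> /eqP->.
have fS : finite_set (vertices (settle G' (wk x q))).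
  by rewrite settle_vertices finite_setU; split=> //; exact: finite_set1.
have GS : vertices G' `<=` vertices (settle G' (wk x q)).
  by rewrite settle_vertices; left.
case: Q => [_|p Q /=].
  apply: (IH G (settle G' (wk x q)) [::]) => //.
    exact: subset_trans GS.
  exact: sub0seq.
case: (eqVneq p q) => [->|_] sub.
  apply: IH => //; apply: settle_subset => //; exact: regular_exit.
exact: (IH G _ (p :: Q) fS (subset_trans GG' GS) sub).
Qed.

Lemma run_subset Q Q' : {subset Q <= Q'} -> vertices (run x Q) `<=` vertices (run x Q').
Proof.
move=> QQ'; apply: grow_subset => //.
suff -> : schedule x Q = seq.filter (mem Q) (schedule x Q') by exact: filter_subseq.
rewrite -schedule_filter; apply: schedule_eq => p.
by rewrite mem_filter /=; case: (boolP (p \in Q)) => // /QQ' ->.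
Qed.

Lemma run_prior Q p : p \in Q -> forall q, q \in Q -> tm x q < tm x p ->
  run x (prior x q (prior x p Q)) = run x (prior x q Q).
Proof.
move=> pQ q qQ qp; apply: run_eq => r; rewrite !mem_filter.
by case: ltP => //= rq; rewrite (lt_trans rq qp).
Qed.

Lemma prior_rcons (l : seq particle) a : sorted (fun p q =>
  tm x p < tm x q) (rcons l a) ->
  prior x a (rcons l a) = l /\ forall p, p \in l -> prior x p (rcons l a) = prior x p l.
Proof.
move=> sl.
have la q : q \in l -> tm x q < tm x a.
  move=> ql; have := sl; rewrite -cats1 sorted_pairwise; last by move=> ? ? ?;
    exact: lt_trans.
  by rewrite pairwise_cat => /andP[/allrelP h _]; apply: h => //; rewrite inE.
split=> [|p pl]; rewrite /prior filter_rcons.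
  by rewrite ltxx; apply/all_filterP/allP => q /la.
by rewrite ltNge (ltW (la _ pl)).
Qed.

(** Describes the final aggregate particle by particle instead of by successive states. The
    induction removes the last particle, which no other particle sees. *)
Lemma grow_vertices (l : seq particle) y : sorted (fun p q => tm x p < tm x q) l ->
  vertices (grow x (empty_graph d) l) y <-> exists2 p, p \in l &
    y = wk x p (first_exit (vertices (grow x (empty_graph d) (prior x p l))) (wk x p)).
Proof.
elim/last_ind: l y => [|l a IH] y sl; first by split=> // -[].
have [pa pl] := prior_rcons sl.
have sl' : sorted (fun p q => tm x p < tm x q) l.
  by apply: subseq_sorted sl => [q p r|]; [exact: lt_trans|exact: subseq_rcons].
rewrite {1}/grow foldl_rcons -/(grow x (empty_graph d) l) settle_vertices.
split=> [[/(IH _ sl')[p pil ->]|->]|[p]].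
- by exists p; rewrite ?mem_rcons ?inE ?pil ?orbT// pl.
- by exists a; rewrite ?mem_rcons ?inE ?eqxx// pa.
- rewrite mem_rcons inE => /predU1P[->|pil ->]; first by rewrite pa => ->; right.
  by left; apply/(IH _ sl'); exists p => //; rewrite pl.
Qed.

Lemma grow_edges (l : seq particle) e : sorted (fun p q => tm x p < tm x q) l ->
  edges (grow x (empty_graph d) l) e <-> exists p k, [/\ p \in l,
    first_exit (vertices (grow x (empty_graph d) (prior x p l))) (wk x p) = k.+1 &
    e = (wk x p k, wk x p k.+1)].
Proof.
elim/last_ind: l e => [|l a IH] e sl; first by split=> // -[p [k []]].
have [pa pl] := prior_rcons sl.
have sl' : sorted (fun p q => tm x p < tm x q) l.
  by apply: subseq_sorted sl => [q p r|]; [exact: lt_trans|exact: subseq_rcons].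
rewrite {1}/grow foldl_rcons -/(grow x (empty_graph d) l) settle_edges.
split=> [[/(IH _ sl')[p [k [pil h1 ->]]]|[k [h1 ->]]]|[p [k []]]].
- by exists p, k; rewrite mem_rcons inE pil orbT pl.
- by exists a, k; rewrite mem_rcons inE eqxx pa.
- rewrite mem_rcons inE => /predU1P[->|pil h1 ->].
    by rewrite pa => h ->; right; exists k.
  by left; apply/(IH _ sl'); exists p, k; split=> //; rewrite -pl.
Qed.

Lemma exit_index_schedule Q p : exit_index x Q p =
  first_exit (vertices (grow x (empty_graph d) (prior x p (schedule x Q)))) (wk x p).
Proof. by rewrite /exit_index /run schedule_filter. Qed.

Lemma run_vertices Q y : vertices (run x Q) y <->
  exists2 p, p \in Q & y = wk x p (exit_index x Q p).
Proof.
rewrite /run grow_vertices; last exact: schedule_sorted.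
split=> -[p pQ ->]; exists p; rewrite ?exit_index_schedule//.
  by rewrite -mem_schedule.
by rewrite mem_schedule.
Qed.

Lemma run_edges Q e : edges (run x Q) e <->
  exists p k, [/\ p \in Q, exit_index x Q p = k.+1 & e = (wk x p k, wk x p k.+1)].
Proof.
rewrite /run grow_edges; last exact: schedule_sorted.
split=> -[p [k [pQ h ->]]]; exists p, k; split=> //.
- by rewrite -mem_schedule.
- by rewrite exit_index_schedule.
- by rewrite mem_schedule.
- by rewrite -exit_index_schedule.
Qed.

Lemma exit_indexP Q p :
  ~ vertices (run x (prior x p Q)) (wk x p (exit_index x Q p)) /\
  forall i, (i < exit_index x Q p)%N -> vertices (run x (prior x p Q)) (wk x p i).
Proof. by apply: first_exitP; apply: regular_exit => //; exact: run_finite. Qed.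

(** The later of the two particles exits outside the aggregate of its predecessors, which contains
    the site of the earlier one. *)
Lemma exit_inj Q p q : p \in Q -> q \in Q ->
  wk x p (exit_index x Q p) = wk x q (exit_index x Q q) -> p = q.
Proof.
wlog pq : p q / tm x p < tm x q.
  move=> H pQ qQ e; have [h|h|/tm_inj//] := ltgtP (tm x p) (tm x q).
    exact: H.
  by apply/esym/H.
move=> pQ qQ e; case: (exit_indexP Q q) => []; rewrite -e => -[].
apply/run_vertices; exists p; first by rewrite mem_filter pq.
by rewrite /exit_index (run_prior qQ).
Qed.

End Regular.

(* Settling is monotone in the set of particles, so the aggregate of an infinite
   set is the union over its finite subsets, without reference to boxes. *)
Definition aggregate x (D : set particle) : set (lattice d) :=
  [set y | exists2 Q, (forall p, p \in Q -> D p) & vertices (run x Q) y].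

Definition released x (B : set (source d)) (n : nat) : set particle :=
  [set p | B p.1 /\ 0 <= tm x p <= n%:R].

Definition earlier x (B : set (source d)) p : set particle :=
  [set q | B q.1 /\ 0 <= tm x q < tm x p].

Definition limit_exit x B p := first_exit (aggregate x (earlier x B p)) (wk x p).

(** Stated without [limit_exit], whose default value 0 would give a fictitious site to a walk that
    never leaves the aggregate. *)
Definition settles x B n p y := 
  [/\ released x B n p, ~ aggregate x (earlier x B p) y &
      exists2 k, wk x p k = y &
       forall i, (i < k)%N -> aggregate x (earlier x B p) (wk x p i)].

Lemma aggregate_subset x D D' : D `<=` D' -> aggregate x D `<=` aggregate x D'.
Proof. by move=> DD' y [Q QD h]; exists Q => // p /QD/DD'. Qed.

Lemma earlier_released x B n p : tm x p <= n%:R -> earlier x B p `<=` released x B n.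
Proof.
by move=> pn q [Bq /andP[q0 qp]]; split=> //; rewrite q0 (le_trans (ltW qp)).
Qed.

Section Limit.
Variable x : input.
Hypothesis hx : regular x.

Lemma aggregate_finite_union D (A : set (lattice d)) : finite_set A ->
  A `<=` aggregate x D ->
  exists2 Q, (forall p, p \in Q -> D p) & A `<=` vertices (run x Q).
Proof.
move=> /finite_fsetP[F ->] AD.
have {AD} : forall y, y \in enum_fset F -> aggregate x D y by move=> y yF; exact: AD.
suff H : forall s : seq (lattice d), (forall y, y \in s -> aggregate x D y) ->
    exists2 Q, (forall p, p \in Q -> D p) & forall y, y \in s -> vertices (run x Q) y.
  by move=> /H[Q QD h]; exists Q => // y; exact: h.
elim=> [_|y s IH h]; first by exists [::].
have [Q1 Q1D h1] := IH (fun z zs => h z (@mem_behead _ (y :: s) z zs)).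
have [Q2 Q2D h2] := h y (mem_head _ _).
exists (Q1 ++ Q2) => [p|z].
  by rewrite mem_cat => /orP[/Q1D|/Q2D].
rewrite inE => /predU1P[->|/h1].
  by move: h2; apply: run_subset => // p; rewrite mem_cat orbC => ->.
by apply: run_subset => // p; rewrite mem_cat => ->.
Qed.

(** The walk visits finitely many sites before its limiting exit, and finitely many particles
    suffice to occupy them. No further particle can occupy the exit site before [p] is released,
    since it lies outside the limiting aggregate of the earlier particles. *)
Lemma exit_stable B n p : released x B n p -> (exists k,
  ~ aggregate x (earlier x B p) (wk x p k)) ->
  exists2 Q0 : seq particle, (forall q, q \in Q0 -> released x B n q) &
    forall Q, {subset Q0 <= Q} -> (forall q, q \in Q -> released x B n q) ->
    exit_index x Q p = limit_exit x B p.
Proof.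
move=> [Bp /andP[p0 pn]] /first_exitP; rewrite -/(limit_exit x B p) => -[nk lk].
have [||Q0 Q0D h0] := @aggregate_finite_union (earlier x B p)
    [set wk x p i | i in `I_(limit_exit x B p)].
- by apply: finite_image; exact: finite_II.
- by move=> _ [i /= /lk ? <-].
exists Q0 => [q /Q0D|]; first exact: earlier_released.
move=> Q Q0Q QD; apply: first_exit_unique.
  apply: contra_not nk => hk; exists (prior x p Q) => // q.
  by rewrite mem_filter => /andP[qp /QD[Bq /andP[q0 _]]]; split; rewrite ?q0.
move=> i ik; have : vertices (run x Q0) (wk x p i) by apply: h0; exists i.
apply: run_subset => // q qQ0; rewrite mem_filter Q0Q// andbT.
by have [_ /andP[]] := Q0D _ qQ0.
Qed.

Lemma settles_limit B n p y : settles x B n p y -> 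
  [/\ released x B n p, exists k,
    ~ aggregate x (earlier x B p) (wk x p k) & y = wk x p (limit_exit x B p)].
Proof.
move=> [rp na [k ky hk]];
  have nk : ~ aggregate x (earlier x B p) (wk x p k) by rewrite ky.
by split=> //; [exists k|rewrite /limit_exit (first_exit_unique nk hk)].
Qed.

Lemma limit_settles B n p : released x B n p ->
  (exists k, ~ aggregate x (earlier x B p) (wk x p k)) -> 
  settles x B n p (wk x p (limit_exit x B p)).
Proof.
move=> rp ex; have [nk hk] := first_exitP ex.
by split=> //; exists (limit_exit x B p).
Qed.

(** Both limiting positions are realized in one finite run, large enough for the two exit indices to
    have stabilized; there [exit_inj] applies. *)
Lemma settles_inj B n p q y : settles x B n p y -> settles x B n q y -> p = q.
Proof.
move=> /settles_limit[rp ep yp] /settles_limit[rq eq yq].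
have [Qp QpD hp] := exit_stable rp ep; have [Qq QqD hq] := exit_stable rq eq.
pose Q := p :: q :: Qp ++ Qq.
have QD r : r \in Q -> released x B n r.
  by rewrite !inE mem_cat => /or4P[/eqP->|/eqP->|/QpD|/QqD].
apply: (@exit_inj _ hx Q); rewrite ?inE ?eqxx ?orbT// hp ?hq -?yp -?yq// => r rQ;
  by rewrite !inE mem_cat rQ ?orbT.
Qed.

Lemma settles_aggregate B n p y : settles x B n p y -> aggregate x (released x B n) y.
Proof.
move=> /settles_limit[rp ep ->].
have [Qp QpD hp] := exit_stable rp ep.
have QD q : q \in p :: Qp -> released x B n q by rewrite inE => /predU1P[->|/QpD].
exists (p :: Qp) => //.
apply/run_vertices => //; exists p; rewrite ?mem_head// hp// => q qQ.
by rewrite inE qQ orbT.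
Qed.

Lemma aggregate_seq D Q : (forall p, D p <-> p \in Q) ->
  aggregate x D = vertices (run x Q).
Proof.
move=> DQ; apply/seteqP; split=> y; last by move=> h; exists Q => // p /DQ.
by move=> [Q' Q'D]; apply: run_subset => // p /Q'D/DQ.
Qed.

(** With finitely many particles the limit is a single run, in which every occupied site has its
    particle. For all sources together, the same conclusion is reached only almost surely, in
    [ae_settles]. *)
Lemma finite_settles B n y : finite_set (released x B n) ->
  aggregate x (released x B n) y -> exists p, settles x B n p y.
Proof.
move=> /finite_fsetP[F FE].
have rF p : released x B n p <-> p \in enum_fset F by rewrite FE /=; split.
rewrite (aggregate_seq rF) => /(run_vertices hx)[p pF ->].
have rp : released x B n p by apply/rF.
have eQ : forall q, earlier x B p q <-> q \in prior x p (enum_fset F).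
  move=> q; rewrite mem_filter; split=> [qe|/andP[qp /rF[Bq /andP[q0 _]]]].
    have [_ /andP[_ ->]] := qe; apply/rF; case: rp => _ /andP[_ pn].
    exact: earlier_released qe.
  by split=> //; rewrite q0.
exists p; have [nk hk] := exit_indexP hx (enum_fset F) p.
by split; rewrite ?(aggregate_seq eQ)//; exists (exit_index x (enum_fset F) p).
Qed.

End Limit.

Definition limit_forest x n : graph d :=
  Graph (aggregate x (released x setT n))
   [set e | exists p k, [/\ released x setT n p,
     limit_exit x setT p = k.+1 & e = (wk x p k, wk x p k.+1)]].

(** The deterministic conditions under which the forests stabilize. The last two exclude particles
    pushed away forever and sites whose occupant keeps changing; [ae_stable] shows that all of them
    hold almost surely. *)
Record stable x : Prop := Stable {
  stable_regular : regular x;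
  stable_released : forall z n, finite_set [set j | 0 <= x.1 z j <= n%:R];
  stable_finite : forall n K, finite_set (aggregate x (released x setT n) `&` [set y |
    in_cylinder K y]);
  stable_escape : forall n p, released x setT n p -> 
    exists k, ~ aggregate x (earlier x setT p) (wk x p k);
  stable_settles : forall n y, aggregate x (released x setT n) y -> exists p,
    settles x setT n p y }.

(** The cylinder contains finitely many occupied sites. [Q0] is large enough for the limiting
    occupant of each of them to be in place for good; since positions are distinct, the occupants,
    and with them the edges leading to these sites, agree in all larger runs. *)
Lemma run_stabilizes x n K : stable x -> exists2 Q0 : seq particle,
  forall q, q \in Q0 -> released x setT n q &
  forall Q, {subset Q0 <= Q} -> (forall q, q \in Q -> released x setT n q) ->
    restrict_graph K (run x Q) = restrict_graph K (limit_forest x n).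
Proof.
move=> [hx _ fin esc stl]; have /finite_fsetP[F FE] := fin n K.
have Fagg y : y \in enum_fset F -> aggregate x (released x setT n) y.
  by move=> yF; have : (aggregate x (released x setT n) `&` [set y |
    in_cylinder K y]) y; [rewrite FE|case].
have [Q0 Q0D hQ0] : exists2 Q0 : seq particle, forall q, q \in Q0 ->
  released x setT n q &
   forall y, y \in enum_fset F -> exists p, [/\ p \in Q0, settles x setT n p y &
      forall Q, {subset Q0 <= Q} -> (forall q, q \in Q -> released x setT n q) ->
        exit_index x Q p = limit_exit x setT p].
  elim: (enum_fset F) Fagg => [|y s IH] h; first by exists [::].
  have [Q1 Q1D h1] := IH (fun z zs => h z (@mem_behead _ (y :: s) z zs)).
  have [p sp] := stl _ _ (h y (mem_head _ _)).
  have [rp ep yp] := settles_limit sp.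
  have [Qp QpD hp] := exit_stable hx rp ep.
  exists (p :: Q1 ++ Qp) => [q|z].
    by rewrite inE mem_cat => /predU1P[->//|/orP[/Q1D|/QpD]].
  rewrite inE => /predU1P[->|/h1[q [qQ sq hq]]].
    exists p; split=> //; first exact: mem_head.
    by move=> Q sQ; apply: hp => q qQ; apply: sQ; rewrite inE mem_cat qQ !orbT.
  exists q; split=> //; first by rewrite inE mem_cat qQ orbT.
  by move=> Q sQ; apply: hq => r rQ; apply: sQ; rewrite inE mem_cat rQ !orbT.
exists Q0 => // Q Q0Q QD.
have inF y : aggregate x (released x setT n) y -> in_cylinder K y -> y \in enum_fset F.
  move=> ay yK; have : (aggregate x (released x setT n) `&` [set y |
    in_cylinder K y]) y by [].
  by rewrite FE /=.
have QF y : y \in enum_fset F -> vertices (run x Q) y.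
  move=> /hQ0[p [pQ /settles_limit[_ _ ->] hp]].
  by apply/(run_vertices hx); exists p; rewrite ?hp//; exact: Q0Q.
apply/graph_eqP; split=> [y|[a b]] /=.
  split=> -[yr yK]; split=> //; first by exists Q.
  exact: QF (inF _ yr yK).
split=> -[eQ aK bK]; split=> //; move: eQ.
- move=> /(run_edges hx)[p [k [pQ pk ab]]]; exists p, k; split=> //; first exact: QD.
  have vb : vertices (run x Q) b.
    by apply/(run_vertices hx); exists p; rewrite ?pk//; case: ab.
  have [q [qQ0 sq hq]] := hQ0 b (inF _ (ex_intro2 _ _ Q QD vb) bK).
  (* The particle [p] which draws the edge and the limiting occupant [q] of [b] both sit at [b] in
     the run of [Q]. *)
  suff pq : p = q by rewrite pq -(hq Q)// -pq.
  apply: (exit_inj hx pQ (Q0Q _ qQ0)); rewrite hq//.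
  by have [_ _ <-] := settles_limit sq; rewrite pk; case: ab.
- move=> [p [k [rp pk ab]]]; apply/(run_edges hx).
  have sp := limit_settles rp (esc _ _ rp).
  have eb : b = wk x p (limit_exit x setT p) by rewrite pk; case: ab.
  rewrite -eb in sp.
  have [q [qQ0 sq hq]] := hQ0 b (inF _ (settles_aggregate hx sp) bK).
  have pq := settles_inj hx sp sq.
  by exists p, k; split=> //; [rewrite pq; exact: Q0Q|rewrite -pk pq; exact: hq].
Qed.

End Deterministic.

Arguments tm {d R} x p : simpl never.
Arguments wk {d R} x p _ : simpl never.

(** * Translations *)

Section Sources.
Variable d : nat.
Implicit Types (u z : source d).

Lemma add_source_subproof u z : in_H (val z + val u).
Proof.
apply/forallP => i; apply/implyP => i0; rewrite mxE.
by have /forallP/(_ i)/implyP/(_ i0)/eqP-> := valP z;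
   have /forallP/(_ i)/implyP/(_ i0)/eqP-> := valP u.
Qed.
Definition add_source u z : source d := exist (@in_H d) _ (add_source_subproof u z).

Lemma opp_source_subproof u : in_H (- val u).
Proof.
apply/forallP => i; apply/implyP => i0; rewrite mxE.
by have /forallP/(_ i)/implyP/(_ i0)/eqP-> := valP u.
Qed.
Definition opp_source u : source d := exist (@in_H d) _ (opp_source_subproof u).

Lemma source0_subproof : in_H (0 : lattice d).
Proof. by apply/forallP => i; apply/implyP => _; rewrite mxE. Qed.
Definition source0 : source d := exist (@in_H d) _ source0_subproof.

Lemma add_sourceK u : cancel (add_source u) (add_source (opp_source u)).
Proof. by move=> z; apply: val_inj; rewrite /= addrK. Qed.
Lemma add_sourceVK u : cancel (add_source (opp_source u)) (add_source u).
Proof. by move=> z; apply: val_inj; rewrite /= subrK. Qed.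
Lemma opp_sourceK : involutive opp_source.
Proof. by move=> z; apply: val_inj; rewrite /= opprK. Qed.
Lemma add_source0 u : add_source u source0 = u.
Proof. by apply: val_inj; rewrite /= add0r. Qed.

End Sources.

Section Shift.
Variables (d : nat) (R : realType).
Notation particle := (source d * nat)%type.
Implicit Types (x : input d R) (p q : particle) (Q : seq particle) (u : source d).

(** Sources are relabelled and walks are moved by the same vector, so that a walk starting at its
    own source still does so. *)
Definition shift_input u x : input d R :=
  (fun z => x.1 (add_source (opp_source u) z),
   fun z j k => (x.2 (add_source (opp_source u) z) j k + val u : lattice d)).

Definition shift_particle u p : particle := (add_source u p.1, p.2).

Lemma shift_particleK u : cancel (shift_particle u) (shift_particle (opp_source u)).
Proof. by move=> [z j]; rewrite /shift_particle /= add_sourceK. Qed.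
Lemma shift_particleVK u : cancel (shift_particle (opp_source u)) (shift_particle u).
Proof. by move=> [z j]; rewrite /shift_particle /= add_sourceVK. Qed.
Lemma shift_particle_inj u : injective (shift_particle u).
Proof. exact: can_inj (shift_particleK u). Qed.

Lemma tm_shift u x p : tm (shift_input u x) (shift_particle u p) = tm x p.
Proof. by rewrite /tm /shift_input /= add_sourceK. Qed.
Lemma wk_shift u x p k : wk (shift_input u x) (shift_particle u p) k = (wk x p k + val
  u : lattice d).
Proof. by rewrite /wk /shift_input /= add_sourceK. Qed.

Lemma translate_vertices u (G : graph d) y :
  vertices (translate_graph u G) y <-> vertices G (y - val u).
Proof.
split=> [[z zG <-]|h]; first by rewrite addrK.
by exists (y - val u) => //; rewrite subrK.
Qed.

Lemma translate_edges u (G : graph d) e :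
  edges (translate_graph u G) e <-> edges G (e.1 - val u, e.2 - val u).
Proof.
split=> [[[a b] zG <-]|h] /=; first by rewrite !addrK.
by exists (e.1 - val u, e.2 - val u) => //=; rewrite !subrK; case: e h.
Qed.

Lemma first_exit_translate u (A A' : set (lattice d)) (s s' : nat -> lattice d) :
  (forall y, A' (y + val u) <-> A y) -> (forall i, s' i = s i + val u) ->
  first_exit A' s' = first_exit A s.
Proof.
move=> AA' ss'; rewrite /first_exit; congr xget; apply/seteqP.
have E i : A' (s' i) <-> A (s i) by rewrite ss' AA'.
by split=> k /= [h1 h2]; split=> [/E//|i /h2/E].
Qed.

Lemma settle_translate u (G : graph d) (s s' : nat -> lattice d) :
  (forall i, s' i = s i + val u) ->
  settle (translate_graph u G) s' = translate_graph u (settle G s).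
Proof.
move=> ss'.
have fe : first_exit (vertices (translate_graph u G)) s' = first_exit (vertices G) s.
  by apply: (@first_exit_translate u) => // y; rewrite translate_vertices addrK.
apply/graph_eqP; split=> [y|e].
  rewrite translate_vertices !settle_vertices fe; split=> -[].
  - by move=> /translate_vertices; left.
  - by move=> ->; right; rewrite /= ss' addrK.
  - by move=> ?; left; apply/translate_vertices.
  - by move=> h; right; rewrite /= ss' -h subrK.
rewrite translate_edges !settle_edges fe translate_edges; split=> -[|[k [h1 h2]]];
  try by left.
  by right; exists k; rewrite h2 !ss' !addrK.
right; exists k; split=> //; rewrite !ss'; case: h2 => <- <-; rewrite !subrK;
  by case: e.
Qed.

Lemma grow_shift u x G Q :
  grow (shift_input u x) (translate_graph u G) (map (shift_particle u) Q) =
  translate_graph u (grow x G Q).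
Proof.
elim: Q G => //= p Q IH G; rewrite -IH; congr grow.
by apply: settle_translate => i; exact: wk_shift.
Qed.

Lemma schedule_shift u x Q : schedule (shift_input u x) (map (shift_particle u) Q) =
  map (shift_particle u) (schedule x Q).
Proof.
rewrite /schedule undup_map_inj; last exact: shift_particle_inj.
rewrite sort_map; congr map; congr sort; apply/funext => p; apply/funext => q.
by rewrite /= /release !tm_shift.
Qed.

Lemma run_shift u x Q : run (shift_input u x) (map (shift_particle u) Q) =
  translate_graph u (run x Q).
Proof.
rewrite /run schedule_shift -grow_shift; congr grow.
by apply/graph_eqP; split=> [y|e]; rewrite ?translate_vertices ?translate_edges.
Qed.

Lemma aggregate_shift u x (D D' : set particle) y :
  (forall p, D' (shift_particle u p) <-> D p) ->
  aggregate (shift_input u x) D' y <-> aggregate x D (y - val u).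
Proof.
move=> DD'; split=> -[Q QD h].
  exists (map (shift_particle (opp_source u)) Q).
    by move=> _ /mapP[p /QD Dp ->]; apply/DD'; rewrite shift_particleVK.
  apply/translate_vertices; rewrite -run_shift -map_comp.
  by rewrite (eq_map (g := id)) ?map_id// => p /=; rewrite shift_particleVK.
exists (map (shift_particle u) Q); first by move=> _ /mapP[p /QD/DD' ? ->].
by rewrite run_shift translate_vertices.
Qed.

Lemma released_shift u x B n p :
  released (shift_input u x) B n (shift_particle u p) <->
    released x (add_source u @^-1` B) n p.
Proof. by rewrite /released /mkset tm_shift. Qed.

Lemma earlier_shift u x B p q :
  earlier (shift_input u x) B (shift_particle u p) (shift_particle u q) <->
  earlier x (add_source u @^-1` B) p q.
Proof. by rewrite /earlier /mkset !tm_shift. Qed.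

Lemma settles_shift u x B n p y :
  settles (shift_input u x) B n (shift_particle u p) y <->
  settles x (add_source u @^-1` B) n p (y - val u).
Proof.
have E z : aggregate (shift_input u x) (earlier (shift_input u x) B (shift_particle u
  p)) z <->
    aggregate x (earlier x (add_source u @^-1` B) p) (z - val u).
  by apply: aggregate_shift => q; exact: earlier_shift.
rewrite /settles (propext (released_shift _ _ _ _ _)) (propext (E _)).
split=> -[h1 h2 [k h3 h4]]; split=> //; exists k.
- by rewrite -h3 wk_shift addrK.
- by move=> i /h4/E; rewrite wk_shift addrK.
- by rewrite wk_shift h3 subrK.
- by move=> i /h4 h; apply/E; rewrite wk_shift addrK.
Qed.

Lemma limit_forest_shift u x n : limit_forest (shift_input u x) n = translate_graph u
  (limit_forest x n).
Proof.
have E p z : aggregate (shift_input u x) (earlier (shift_input u x) setT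
  (shift_particle u p)) z <->
    aggregate x (earlier x setT p) (z - val u).
  by apply: aggregate_shift => q; exact: earlier_shift.
have LE p : limit_exit (shift_input u x) setT (shift_particle u p) = limit_exit x setT
  p.
  apply: (@first_exit_translate u) => i; last exact: wk_shift.
  by rewrite E addrK.
apply/graph_eqP; split=> [y|e].
  rewrite translate_vertices /=; apply: aggregate_shift => p; exact: released_shift.
rewrite translate_edges /=; split=> -[p [k [h1 h2 h3]]].
  rewrite -(shift_particleVK u p) in h1 h2 h3.
  exists (shift_particle (opp_source u) p), k; split.
  - by move/released_shift: h1.
  - by rewrite -LE.
  - by rewrite h3 /= !wk_shift !addrK.
exists (shift_particle u p), k; split; first by apply/released_shift.
  by rewrite LE.
by rewrite !wk_shift; case: h3 => <- <-; rewrite !subrK; case: e.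
Qed.

End Shift.

(** * Stabilization *)

Section Box.
Variable d : nat.

(** In dimension [d.+1] a source has [d] free coordinates. Shifting them by [M] lists them by
    ordinals, which yields the cardinality of a box at once. *)
Definition box_point_row M (f : {ffun 'I_d -> 'I_M.*2.+1}) : lattice d.+1 :=
  \row_i (if unlift ord0 i is Some j then (f j)%:Z - M%:Z else 0).

Lemma box_point_subproof M (f : {ffun 'I_d -> 'I_M.*2.+1}) : in_H (box_point_row f).
Proof.
apply/forallP => i; apply/implyP => /eqP i0.
have -> : i = ord0 by exact: val_inj.
by rewrite mxE unlift_none.
Qed.

Definition box_point M f : source d.+1 :=
  exist (@in_H d.+1) _ (@box_point_subproof M f).
Definition box M : seq (source d.+1) := [seq box_point f | f <- enum {ffun 'I_d ->
  'I_M.*2.+1}].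

Lemma box_point_inj M : injective (@box_point M).
Proof.
move=> f g /(congr1 val)/= /matrixP fg; apply/ffunP => j; apply/val_inj.
by have := fg ord0 (lift ord0 j); rewrite !mxE liftK => /addIr[].
Qed.

Lemma box_uniq M : uniq (box M).
Proof. by rewrite map_inj_uniq ?enum_uniq//; exact: box_point_inj. Qed.

Lemma size_box M : size (box M) = (M.*2.+1 ^ d)%N.
Proof. by rewrite size_map -cardE card_ffun !card_ord. Qed.

Lemma mem_box M z : (z \in box M) = in_cylinder M (val z).
Proof.
apply/mapP/forallP => [[f _ ->] i|h].
  apply/implyP => i0; rewrite /= mxE.
  case: unliftP => [j _|ii]; last by move: i0; rewrite ii.
  by case: (f j) => a /= ha; lia.
have H j : (absz ((val z) ord0 (lift ord0 j) + M%:Z)%R < M.*2.+1)%N.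
  by have := h (lift ord0 j); rewrite /= => ?; lia.
exists [ffun j => Ordinal (H j)]; first by rewrite mem_enum.
apply: val_inj; apply/matrixP => a i; rewrite !mxE (_ : a = ord0) ?(ord1 a)//.
case: unliftP => [j ->|->].
  by rewrite ffunE /=; have := h (lift ord0 j); rewrite /= => hh; lia.
by have /forallP/(_ ord0)/implyP/(_ (eqxx _))/eqP := valP z.
Qed.

Lemma box_subset M N : (M <= N)%N -> {subset box M <= box N}.
Proof.
move=> MN z; rewrite !mem_box => /forallP h; apply/forallP => i.
by apply/implyP => /(implyP (h i)) /leq_trans; apply.
Qed.

Lemma box_total z : exists M, z \in box M.
Proof.
exists (sup_norm (val z)); rewrite mem_box; apply/forallP => i; apply/implyP => _.
exact: (leq_bigmax (F := fun i => `|(val z) ord0 i|%N) i).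
Qed.

Lemma box_total_seq (s : seq (source d.+1)) : exists M, {subset s <= box M}.
Proof.
elim: s => [|z s [M IH]]; first by exists 0%N.
have [N zN] := box_total z; exists (maxn M N) => y; rewrite inE => /predU1P[->|/IH].
  by apply: box_subset zN; exact: leq_maxr.
by apply: box_subset; exact: leq_maxl.
Qed.

Lemma in_cylinder_total (y : lattice d.+1) : exists K, (1 <= K)%N /\ in_cylinder K y.
Proof.
exists (sup_norm y).+1; split=> //; apply/forallP => i; apply/implyP => _.
exact/leqW/(leq_bigmax (F := fun i => `|y ord0 i|%N) i).
Qed.

Lemma in_cylinder_leq K K' (y : lattice d.+1) : (K <= K')%N -> in_cylinder K y ->
  in_cylinder K' y.
Proof.
move=> KK /forallP h; apply/forallP => i.
by apply/implyP => /(implyP (h i)) /leq_trans; apply.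
Qed.

End Box.

(** * The forests as limits over boxes *)

Section Forest.
Variables (d : nat) (R : realType).
Notation particle := (source d.+1 * nat)%type.
Implicit Types (x : input d.+1 R).

Definition forest_of x n := forest x.1 x.2 n.

Definition batch x n M : seq particle :=
  enum_fset (fset_set [set p : particle |
    in_cylinder M (val p.1) /\ 0 <= tm x p <= n%:R]).

Lemma finite_forestE x n M : finite_forest x.1 x.2 n M = run x (batch x n M).
Proof. by rewrite /run /schedule undup_id ?fset_uniq. Qed.

Definition locally_finite x := forall z n, finite_set [set j | 0 <= x.1 z j <= n%:R].

Lemma mem_batch x n M p : locally_finite x ->
  p \in batch x n M = (p.1 \in box d M) && (0 <= tm x p <= n%:R).
Proof.
move=> lf.
have fin : finite_set [set p : particle |
  in_cylinder M (val p.1) /\ 0 <= tm x p <= n%:R].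
  apply: (@sub_finite_set _ _ (\bigcup_(z in [set` box d M])
    ([set (z, j) | j in [set j | 0 <= x.1 z j <= n%:R]]))).
    move=> [z j] [/= zM zj]; exists z; first by rewrite /= mem_box.
    by exists j.
  by apply: bigcup_finite => [|z _]; [exact: finite_seq|exact: finite_image].
rewrite mem_box; have /= E := in_fset_set fin p.
by rewrite [LHS]E; apply/idP/andP => [/set_mem//|]; exact: mem_set.
Qed.

(** Ranks found separately for each pair [(n, K)] become monotone after taking maxima over all
    smaller pairs. The left-hand side quantifies over integers only, which makes the existence of a
    rank a measurable event. *)
Lemma stabilizing_exists x :
  (forall n K, (1 <= n)%N -> (1 <= K)%N -> exists N0, forall N, (N0 <= N)%N ->
    restrict_graph K (finite_forest x.1 x.2 n N) =
    restrict_graph K (finite_forest x.1 x.2 n N0)) <->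
  exists N0, stabilizing x.1 x.2 N0.
Proof.
split=> [Nex|[N0 [_ _ h]] n K n1 K1]; last by exists (N0 n K) => N; exact: h.
pose stab n K N0 := forall N, (N0 <= N)%N ->
    restrict_graph K (finite_forest x.1 x.2 n N) =
    restrict_graph K (finite_forest x.1 x.2 n N0).
pose N1 n K := xget 0%N [set N0 | stab n K N0].
have hN1 n K : (1 <= n)%N -> (1 <= K)%N -> stab n K (N1 n K).
  by move=> n1 K1; have [N0 h] := Nex n K n1 K1; rewrite /N1; case: xgetP => [N2 ->
    //|/(_ N0)].
have N1le m K : (N1 m K <= \max_(i < m.+1) \max_(j < K.+1) N1 i j)%N.
  apply: (@leq_trans (\max_(j < K.+1) N1 (@ord_max m) j)%N).
    exact: (leq_bigmax (F := fun j : 'I_K.+1 => N1 (@ord_max m) j) ord_max).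
  exact: (leq_bigmax (F := fun i : 'I_m.+1 => \max_(j < K.+1) N1 i j)%N ord_max).
exists (fun n K => \max_(i < n.+1) \max_(j < K.+1) N1 i j)%N.
split=> [K m m' mm'|m K K' KK'|m K N m1 K1 NN].
- apply/bigmax_leqP => i _.
  exact: (leq_bigmax (F := fun i : 'I_m'.+1 =>
    \max_(j < K.+1) N1 i j)%N (widen_ord (mm' : (m.+1 <= m'.+1)%N) i)).
- apply/bigmax_leqP => i _; apply: (@leq_trans (\max_(j < K'.+1) N1 i j)%N); last first.
    exact: (leq_bigmax (F := fun i : 'I_m.+1 => \max_(j < K'.+1) N1 i j)%N i).
  apply/bigmax_leqP => j _.
  exact: (leq_bigmax (F := fun j : 'I_K'.+1 =>
    N1 i j) (widen_ord (KK' : (K.+1 <= K'.+1)%N) j)).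
- by rewrite (hN1 m K m1 K1 N (leq_trans (N1le _ _) NN)) (hN1 m K m1 K1 _ (N1le _ _)).
Qed.

(** Eliminates the arbitrary rank: belonging to the forest means belonging to all finite forests of
    large boxes. *)
Lemma forest_eventually x n (y : lattice d.+1) (e : lattice d.+1 * lattice d.+1) :
  (exists N0, stabilizing x.1 x.2 N0) -> n != 0%N ->
  (vertices (forest_of x n) y <->
   exists N0, forall N, (N0 <= N)%N -> vertices (finite_forest x.1 x.2 n N) y) /\
  (edges (forest_of x n) e <->
   exists N0, forall N, (N0 <= N)%N -> edges (finite_forest x.1 x.2 n N) e).
Proof.
move=> [N1 stb] n0; rewrite /forest_of /forest (negbTE n0).
have : stabilizing x.1 x.2 (stabilization_rank x.1 x.2).
  by rewrite /stabilization_rank; case: xgetP => [N -> //|/(_ _ stb)].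
set rk := stabilization_rank x.1 x.2 => -[_ _ hrk].
have {}n0 : (1 <= n)%N by rewrite lt0n.
split; split.
- move=> [K K1] /=; rewrite -/rk => h; exists (rk n K) => N /(hrk n K N n0 K1) E.
  by have : vertices (restrict_graph K (finite_forest x.1 x.2 n N)) y; [rewrite E|case].
- move=> [N0 h]; have [K [K1 yK]] := in_cylinder_total y; exists K => //.
  by rewrite -/rk -(hrk n K _ n0 K1 (leq_maxl _ N0)); split=> //; apply: h;
    exact: leq_maxr.
- move=> [K K1] /=; rewrite -/rk => h; exists (rk n K) => N /(hrk n K N n0 K1) E.
  by have : edges (restrict_graph K (finite_forest x.1 x.2 n N)) e; [rewrite E|case].
- move=> [N0 h]; have [K [K1 yK]] := in_cylinder_total e.1; have [K' [K'1 yK']] :=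
    in_cylinder_total e.2.
  have K2 : (1 <= maxn K K')%N by rewrite leq_max K1.
  exists (maxn K K') => //; rewrite -/rk -(hrk n _ _ n0 K2 (leq_maxl _ N0)); split.
  + by apply: h; exact: leq_maxr.
  + by apply: in_cylinder_leq yK; exact: leq_maxl.
  + by apply: in_cylinder_leq yK'; exact: leq_maxr.
Qed.

(** Large boxes contain the sources of the finite set given by [run_stabilizes]. Time 0 is set apart
    because the forest is then empty by convention, while [limit_forest] would admit a particle
    released exactly at 0. *)
Lemma forest_limit x n : stable x ->
  forest_of x n = if n == 0%N then empty_graph _ else limit_forest x n.
Proof.
move=> st; case: eqP => [->|/eqP n0]; first by rewrite /forest_of /forest eqxx.
have lf : locally_finite x by case: st.
have Nex m K : exists N0, forall N, (N0 <= N)%N ->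
    restrict_graph K (finite_forest x.1 x.2 m N) = restrict_graph K (limit_forest x m).
  have [Q0 Q0D hQ] := run_stabilizes m K st.
  have [N0 hN] := box_total_seq (map fst Q0).
  exists N0 => N N0N; rewrite finite_forestE; apply: hQ => p.
    move=> pQ; rewrite mem_batch//; have [_ ->] := Q0D _ pQ; rewrite andbT.
    by apply: (box_subset N0N); apply: hN; apply: map_f.
  by rewrite mem_batch// => /andP[].
have stb : exists N0, stabilizing x.1 x.2 N0.
  apply/stabilizing_exists => m K _ _; have [N0 hN] := Nex m K.
  by exists N0 => N NN; rewrite hN// hN.
apply/graph_eqP; split=> [y|e].
- have [-> _] := forest_eventually y (y, y) stb n0.
  have [K [_ yK]] := in_cylinder_total y; have [N1 hN1] := Nex n K.
  split=> [[N0 h]|h].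
    have : vertices (restrict_graph K (limit_forest x n)) y; last by case.
    by rewrite -(hN1 _ (leq_maxr N0 _)); split=> //; apply: h; exact: leq_maxl.
  exists N1 => N /hN1 E.
  by have : vertices (restrict_graph K (finite_forest x.1 x.2 n N)) y; [rewrite E|case].
- have [_ ->] := forest_eventually e.1 e stb n0.
  have [K [K1 yK]] := in_cylinder_total e.1; have [K' [K'1 yK']] :=
    in_cylinder_total e.2.
  have {}yK : in_cylinder (maxn K K') e.1 by apply: in_cylinder_leq yK; exact: leq_maxl.
  have {}yK' : in_cylinder (maxn K K') e.2 by apply: in_cylinder_leq yK';
    exact: leq_maxr.
  have [N1 hN1] := Nex n (maxn K K').
  split=> [[N0 h]|h].
    have : edges (restrict_graph (maxn K K') (limit_forest x n)) e; last by case.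
    by rewrite -(hN1 _ (leq_maxr N0 _)); split=> //; apply: h; exact: leq_maxl.
  exists N1 => N /hN1 E.
  by have : edges (restrict_graph (maxn K K') (finite_forest x.1 x.2 n N)) e;
    [rewrite E|case].
Qed.

End Forest.

Section Cover.
Variables (d : nat) (R : realType).
Variable x : input d R.
Hypothesis hx : regular x.

(* Each of the more than m walks that follow the path settles on it. *)
Lemma run_path Q Q0 (c : nat -> lattice d) m : uniq Q0 -> {subset Q0 <= Q} ->
  (m < size Q0)%N ->
  (forall p i, p \in Q0 -> (i <= m)%N -> wk x p i = c i) -> vertices (run x Q) (c m).
Proof.
move=> uQ Q0Q mQ hc; apply: contrapT => ncm.
have pos p : p \in Q0 -> vertices (run x Q) (wk x p (exit_index x Q p)).
  by move=> pQ; apply/run_vertices => //; exists p => //; exact: Q0Q.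
have lem p : p \in Q0 -> (exit_index x Q p < m)%N.
  move=> pQ; have em : (exit_index x Q p <= m)%N.
    rewrite leqNgt; apply/negP => /(exit_indexP hx Q p).2.
    rewrite hc// => h; apply: ncm; move: h; apply: run_subset => //.
    by move=> q; rewrite mem_filter => /andP[].
  rewrite ltn_neqAle em andbT; apply/eqP => e.
  by apply: ncm; have := pos _ pQ; rewrite e hc.
have inj : {in Q0 &, injective (exit_index x Q)}.
  move=> p q pQ qQ e; apply: (exit_inj hx (Q0Q _ pQ) (Q0Q _ qQ)).
  by rewrite e !hc//; apply: ltnW; apply: lem.
have : (size (map (exit_index x Q) Q0) <= size (iota 0 m))%N.
  apply: uniq_leq_size; first by rewrite map_inj_in_uniq.
  by move=> _ /mapP[p pQ ->]; rewrite mem_iota add0n lem.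
by rewrite size_map size_iota leqNgt mQ.
Qed.

End Cover.

(** * Measurability *)

Section MeasurableComprehension.
Context (disp : measure_display) (T : measurableType disp).
Implicit Types P Q : T -> Prop.

Lemma mset_and P Q : measurable [set x | P x] -> measurable [set x | Q x] ->
  measurable [set x | P x /\ Q x].
Proof. exact: measurableI. Qed.

Lemma mset_or P Q : measurable [set x | P x] -> measurable [set x | Q x] ->
  measurable [set x | P x \/ Q x].
Proof. exact: measurableU. Qed.

Lemma mset_not P : measurable [set x | P x] -> measurable [set x | ~ P x].
Proof. exact: measurableC. Qed.

Lemma mset_imply P Q : measurable [set x | P x] -> measurable [set x | Q x] ->
  measurable [set x | P x -> Q x].
Proof.
move=> mP mQ; rewrite [X in measurable X](_ : _ = [set x | ~ P x \/ Q x]).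
  exact/mset_or/mQ/mset_not.
by apply/seteqP; split=> x /=; [case: (pselect (P x)); tauto|tauto].
Qed.

Lemma mset_iff P Q : measurable [set x | P x] -> measurable [set x | Q x] ->
  measurable [set x | P x <-> Q x].
Proof. by move=> mP mQ; apply: mset_and; exact: mset_imply. Qed.

Lemma mset_cst (P : Prop) : measurable [set x : T | P].
Proof.
have [p|np] := pselect P.
  by rewrite [X in measurable X](_ : _ = setT)//; apply/seteqP; split.
by rewrite [X in measurable X](_ : _ = set0)//; apply/seteqP; split.
Qed.

Lemma mset_exists (I : countType) (P : I -> T -> Prop) :
  (forall i, measurable [set x | P i x]) -> measurable [set x | exists i, P i x].
Proof.
move=> mP; rewrite [X in measurable X](_ : _ = \bigcup_i [set x | P i x]).
  exact: countable_bigcupT_measurable.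
by apply/seteqP; split=> x [i]; [exists i|exists i].
Qed.

Lemma mset_exists2 (I : countType) (P Q : I -> T -> Prop) :
  (forall i, measurable [set x | P i x]) -> (forall i, measurable [set x | Q i x]) -> 
  measurable [set x | exists2 i, P i x & Q i x].
Proof.
move=> mP mQ; rewrite [X in measurable X](_ : _ = [set x | exists i, P i x /\ Q i x]).
  by apply: mset_exists => i; exact: mset_and.
by apply/seteqP; split=> x [i]; [exists i|case; exists i].
Qed.

Lemma mset_forall (I : countType) (P : I -> T -> Prop) :
  (forall i, measurable [set x | P i x]) -> measurable [set x | forall i, P i x].
Proof.
move=> mP; rewrite [X in measurable X](_ : _ = ~` [set x | exists i, ~ P i x]).
  by apply: measurableC; apply: mset_exists => i; exact: mset_not.
apply/seteqP; split=> x /=; first by move=> h [i]; exact.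
by move=> h i; apply: contrapT => n; apply: h; exists i.
Qed.

Lemma mset_all (I : eqType) (s : seq I) (P : I -> T -> Prop) :
  (forall i, measurable [set x | P i x]) -> measurable [set x | forall i, i \in s ->
    P i x].
Proof.
move=> mP; rewrite (_ : [set x | _] = \bigcap_(i in [set` s]) [set x | P i x]).
  by apply: fin_bigcap_measurable => //; exact: finite_seq.
by apply/seteqP; split=> x h i; exact: h.
Qed.

Lemma mset_eq (A B : set T) : measurable A -> (forall x, B x <-> A x) -> measurable B.
Proof. by move=> mA BA; rewrite (_ : B = A)//; apply/seteqP; split=> x /BA. Qed.

End MeasurableComprehension.

(** Events are written as formulas with countable quantifiers. Sites, particles and finite sequences
    of particles all form countable types, so that quantifying over them preserves measurability. *)
Ltac mset := repeat first [ assumption | match goal with H : _ |- _ =>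
  solve [simple eapply H] end | apply: mset_cst | apply: mset_and | apply: mset_or
  | apply: mset_not | apply: mset_iff | apply: mset_exists2 => ? |
    apply: mset_exists => ? 
  | apply: mset_forall => ? | apply: mset_imply ].

(** * The measurable space of inputs *)

Section InputSpace.
Variables (d : nat) (R : realType).

Definition clock_or_walk : Type := (source d + source d * nat)%type.
HB.instance Definition _ := Countable.on clock_or_walk.

(** The index set [J] selects some clocks and walks; independence on the input space is expressed
    through the sigma-algebras of disjoint index sets. *)
Definition input_coordinates (J : set clock_or_walk) : set_system (input d R) :=
  [set A | (exists z j B, [/\ J (inl z), measurable B & A = [set x | B (x.1 z j)]]) \/
           (exists z j k y, J (inr (z, j)) /\ A = [set x | x.2 z j k = y])].

HB.instance Definition _ := gen_eqMixin (input d R).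
HB.instance Definition _ := gen_choiceMixin (input d R).
HB.instance Definition _ := isPointed.Build (input d R) (fun _ _ => 0, fun _ _ _ => 0).
HB.instance Definition _ :=
  @isMeasurable.Build (sigma_display (input_coordinates setT)) (input d R)
    <<s input_coordinates setT >>
    (@sigma_algebra0 _ setT (input_coordinates setT))
    (@sigma_algebraC _ (input_coordinates setT))
    (@sigma_algebra_bigcup _ setT (input_coordinates setT)).

Definition sigma_input (J : set clock_or_walk) : set_system (input d R) :=
  <<s input_coordinates J >>.

Lemma sigma_input_subset J J' : J `<=` J' -> sigma_input J `<=` sigma_input J'.
Proof.
move=> JJ'; apply: smallest_sub; first exact: smallest_sigma_algebra.
move=> A HA; apply: sub_gen_smallest; case: HA =>
  [[z [j [B [Jz mB ->]]]]|[z [j [k [y [Jz ->]]]]]].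
  by left; exists z, j, B; split=> //; exact: JJ'.
by right; exists z, j, k, y; split=> //; exact: JJ'.
Qed.

Lemma sigma_input_measurable J : sigma_input J `<=` measurable.
Proof. exact: sigma_input_subset. Qed.

Lemma measurable_clock p B : measurable B -> measurable [set x : input d R |
  B (tm x p)].
Proof. by move=> mB; apply: sub_gen_smallest; left; exists p.1, p.2, B. Qed.

Lemma measurable_tm p : measurable_fun setT (fun x : input d R => tm x p).
Proof. by move=> _ B mB; rewrite setTI; exact: measurable_clock. Qed.

Lemma measurable_wk p k y : measurable [set x : input d R | wk x p k = y].
Proof. by apply: sub_gen_smallest; right; exists p.1, p.2, k, y; split=> //. Qed.

Lemma measurable_le_clock (f g : input d R -> R) : measurable_fun setT f ->
  measurable_fun setT g -> measurable [set x | f x <= g x].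
Proof.
move=> mf mg; have := @measurable_fun_ler _ _ _ _ _ _ mf mg measurableT [set true] I.
by rewrite setTI.
Qed.

Lemma measurable_lt_clock (f g : input d R -> R) : measurable_fun setT f ->
  measurable_fun setT g -> measurable [set x | f x < g x].
Proof.
move=> mf mg; apply: (@mset_eq _ _ [set x | ~ (g x <= f x)]).
  by apply: mset_not; exact: measurable_le_clock.
by move=> x /=; rewrite ltNge; split=> /negP.
Qed.

Definition restrict_input (J : set clock_or_walk) (x : input d R) : input d R :=
  (fun z j => if `[< J (inl z) >] then x.1 z j else 0,
   fun z j k => if `[< J (inr (z, j)) >] then x.2 z j k else 0).

Lemma preimage_sigma (T T' : Type) (f : T ->
  T') (G : set_system T') (H : set_system T) :
  sigma_algebra setT H -> (forall A, G A -> H (f @^-1` A)) ->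
  forall A, <<s G >> A -> H (f @^-1` A).
Proof.
move=> sH GH A /(_ [set B | H (f @^-1` B)]); apply; split=> //; split.
- by rewrite /= preimage_set0; case: sH.
- by move=> B HB; case: sH => _ h _; exact: (h _ HB).
- by move=> F HF; rewrite /= preimage_bigcup; case: sH => _ _; apply.
Qed.

Lemma restrict_input_sigma J A : measurable A ->
  sigma_input J (restrict_input J @^-1` A).
Proof.
apply: preimage_sigma; first exact: smallest_sigma_algebra.
have cst (P : Prop) : sigma_input J [set x | P].
  exact: (@mset_cst _ (g_sigma_algebraType (input_coordinates J))).
move=> _ [[z [j [B [_ mB ->]]]]|[z [j [k [y [_ ->]]]]]]; rewrite /preimage/=;
  case: asboolP => h; rewrite ?if_same; try exact: cst.
  by apply: sub_gen_smallest; left; exists z, j, B.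
by apply: sub_gen_smallest; right; exists z, j, k, y.
Qed.

(** An event insensitive to erasing the coordinates outside [J] is its own preimage under the
    erasing map, which is measurable for [sigma_input J]. *)
Lemma depends_sigma J A : measurable A -> (forall x, A (restrict_input J x) <->
  A x) -> sigma_input J A.
Proof.
move=> mA h; rewrite (_ : A = restrict_input J @^-1` A);
  first exact: restrict_input_sigma.
by apply/seteqP; split=> x /h.
Qed.

End InputSpace.

(** The default value for a walk that never exits is spelled out, so that measurability holds on the
    whole space. *)
Lemma first_exitE d (A : set (lattice d)) s k : first_exit A s = k <->
  (~ A (s k) /\ forall i, (i < k)%N -> A (s i)) \/ (k = 0%N /\ forall i, A (s i)).
Proof.
split=> [<-|[[sk si]|[-> h]]].
- have [/first_exitP h|h] := pselect (exists k, ~ A (s k)); [by left|right].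
  have hA i : A (s i) by apply: contrapT => n; apply: h; exists i.
  by split=> //; rewrite /first_exit; case: xgetP => // j -> [].
- exact: first_exit_unique.
- by rewrite /first_exit; case: xgetP => // j -> [].
Qed.

Lemma sort_congr (T : eqType) (r r' : rel T) (s : seq T) :
  (forall p q, p \in s -> q \in s -> r p q = r' p q) -> sort r s = sort r' s.
Proof.
case: s => // p0 s0; set s := p0 :: s0 => rr'.
rewrite -(mkseq_nth p0 s) /mkseq !sort_map; congr map; congr sort.
apply/funext => i; apply/funext => j.
have mem k : nth p0 s k \in s.
  by have [/mem_nth->//|/(nth_default p0)->] := ltnP k (size s); exact: mem_head.
exact: rr'.
Qed.

Section MeasurableGraph.
Context (disp : measure_display) (T : measurableType disp) (d : nat).
Implicit Types (A : T -> set (lattice d)) (s : T -> nat -> lattice d) (G : T ->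
  graph d).

Lemma mset_at A s i : (forall y, measurable [set x | A x y]) ->
  (forall i y, measurable [set x | s x i = y]) -> measurable [set x | A x (s x i)].
Proof.
move=> mA ms; apply: (@mset_eq _ _ [set x | exists y, s x i = y /\ A x y]).
  by apply: mset_exists => y; exact: mset_and.
by move=> x; split=> [h|[_ [<-]]//]; exists (s x i).
Qed.

Lemma mset_first_exit A s k : (forall y, measurable [set x | A x y]) ->
  (forall i y, measurable [set x | s x i = y]) ->
  measurable [set x | first_exit (A x) (s x) = k].
Proof.
move=> mA ms; apply: mset_eq; last by move=> x; exact: first_exitE.
by mset; first [exact: mA|exact: (mset_at _ mA ms)].
Qed.

Definition measurable_graph G : Prop :=
  (forall y, measurable [set x | vertices (G x) y]) /\
  (forall e, measurable [set x | edges (G x) e]).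

Lemma measurable_graphP G : measurable_graph G <-> measurable_fun setT G.
Proof.
split=> [[mV mE] _ B mB|mG].
  rewrite setTI; apply: (preimage_sigma _ _ mB).
    exact: sigma_algebra_measurable.
  by move=> _ [[y ->]|[e ->]]; [exact: mV|exact: mE].
have mp B : measurable B -> measurable [set x | B (G x)].
  by move=> mB; have := mG measurableT _ mB; rewrite setTI.
by split=> [y|e]; [apply: (mp [set H | vertices H y])|apply: (mp [set H | edges H e])];
  apply: sub_gen_smallest; [left; exists y|right; exists e].
Qed.

Lemma measurable_settle G s : measurable_graph G ->
  (forall i y, measurable [set x | s x i = y]) ->
  measurable_graph (fun x => settle (G x) (s x)).
Proof.
move=> [mV mE] ms; split=> [y|e].
- apply: (@mset_eq _ _ [set x | vertices (G x) y \/ exists k,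
    first_exit (vertices (G x)) (s x) = k /\ s x k = y]).
    mset; first [exact: mV|exact: mE|exact: ms|exact: (mset_first_exit _ mV ms)].
  move=> x; rewrite /= settle_vertices; split=> [[|->]|[|[k [<- <-]]]];
    [by left|right|by left|by right].
  by exists (first_exit (vertices (G x)) (s x)).
- apply: (@mset_eq _ _ [set x | edges (G x) e \/ exists k,
     first_exit (vertices (G x)) (s x) = k.+1 /\ (s x k = e.1 /\ s x k.+1 = e.2)]).
    by mset; first [exact: mV|exact: mE|exact: ms|exact: (mset_first_exit _ mV ms)].
  move=> x; rewrite /= settle_edges; split=> -[|[k [h1 h2]]]; [by left| |by left|].
    by right; exists k; rewrite h2.
  by right; exists k; case: h2 => -> ->; case: (e).
Qed.

Lemma mset_restrict_eq K G H : measurable_graph G -> measurable_graph H ->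
  measurable [set x | restrict_graph K (G x) = restrict_graph K (H x)].
Proof.
move=> [mV mE] [mV' mE']; apply: mset_eq; last by move=> x; exact: graph_eqP.
have mrV F y : measurable_graph F -> measurable [set x |
  vertices (restrict_graph K (F x)) y].
  by move=> [h _]; apply: mset_and; [exact: h|exact: mset_cst].
have mrE F e : measurable_graph F -> measurable [set x |
  edges (restrict_graph K (F x)) e].
  move=> [_ h]; apply: (@mset_eq _ _ [set x |
    edges (F x) e /\ (in_cylinder K e.1 /\ in_cylinder K e.2)]).
    by mset; exact: h.
  by move=> x; split=> /= [[]|[? []]].
by apply: mset_and; apply: mset_forall => i; apply: mset_iff;
  first [exact: mrV|exact: mrE].
Qed.

End MeasurableGraph.

Section MeasurableForest.
Variables (d : nat) (R : realType).
Notation particle := (source d * nat)%type.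
Notation T := (input d R).

Lemma mset_release p q : measurable [set x : T | release x p q].
Proof. by apply: measurable_le_clock; exact: measurable_tm. Qed.

Lemma mset_schedule (Q l : seq particle) : measurable [set x : T | schedule x Q = l].
Proof.
(* The release order on [Q] is coded by a finite list of pairs, so that the union over all possible
   orders is countable. *)
pose r (e : seq (particle * particle)) : rel particle := fun p q => (p, q) \in e.
apply: (@mset_eq _ _ [set x : T | exists e : seq (particle * particle),
   (forall p q, p \in Q -> q \in Q -> (release x p q <->
     r e p q)) /\ sort (r e) (undup Q) = l]).
  mset; exact: mset_release.
have rE (x : T) e : (forall p q, p \in Q -> q \in Q -> (release x p q <-> r e p q)) ->
    schedule x Q = sort (r e) (undup Q).
  move=> h; apply: sort_congr => p q; rewrite !mem_undup => pQ qQ.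
  by apply/idP/idP => /h; apply.
move=> x /=; split=> [<-|[e [/rE-> //]]].
pose e := [seq pq <- [seq (p, q) | p <- Q, q <- Q] | release x pq.1 pq.2].
have he : forall p q, p \in Q -> q \in Q -> (release x p q <-> r e p q).
  move=> p q pQ qQ; rewrite /r mem_filter /=; split=> [->/=|/andP[]//].
  by apply/allpairsP; exists (p, q).
by exists e; rewrite -(rE _ _ he).
Qed.

Lemma measurable_grow Q : measurable_graph (fun x : T => grow x (empty_graph d) Q).
Proof.
elim/last_ind: Q => [|Q p IH].
  by split=> ? /=; exact: mset_cst.
have -> : (fun x : T => grow x (empty_graph d) (rcons Q p)) =
    (fun x : T => settle (grow x (empty_graph d) Q) (wk x p)).
  by apply/funext => x; rewrite /grow foldl_rcons.
apply: measurable_settle => // i y; exact: measurable_wk.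
Qed.

Lemma measurable_run Q : measurable_graph (fun x : T => run x Q).
Proof.
split=> [y|e].
- apply: (@mset_eq _ _ [set x : T | exists l,
    schedule x Q = l /\ vertices (grow x (empty_graph d) l) y]).
    apply: mset_exists => l; apply: mset_and; first exact: mset_schedule.
    by have [h _] := measurable_grow l.
  by move=> x; split=> [h|[l [<-]]//]; exists (schedule x Q).
- apply: (@mset_eq _ _ [set x : T | exists l,
    schedule x Q = l /\ edges (grow x (empty_graph d) l) e]).
    apply: mset_exists => l; apply: mset_and; first exact: mset_schedule.
    by have [_ h] := measurable_grow l.
  by move=> x; split=> [h|[l [<-]]//]; exists (schedule x Q).
Qed.

Lemma mset_aggregate (D : T -> set particle) y : (forall p, measurable [set x |
  D x p]) ->
  measurable [set x | aggregate x (D x) y].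
Proof.
move=> mD; apply: mset_exists2 => Q; first by mset.
by have [h _] := measurable_run Q.
Qed.

Lemma mset_released B n p : measurable [set x : T | released x B n p].
Proof.
apply: mset_and; first exact: mset_cst.
apply: (@mset_eq _ _ [set x : T | 0 <= tm x p /\ tm x p <= n%:R]).
  by apply: mset_and; apply: measurable_le_clock; try exact: measurable_tm;
    exact: measurable_cst.
by move=> x /=; split=> /andP.
Qed.

Lemma mset_earlier B p q : measurable [set x : T | earlier x B p q].
Proof.
apply: mset_and; first exact: mset_cst.
apply: (@mset_eq _ _ [set x : T | 0 <= tm x q /\ tm x q < tm x p]).
  apply: mset_and; [apply: measurable_le_clock|apply: measurable_lt_clock];
    try exact: measurable_tm; exact: measurable_cst.
by move=> x /=; split=> /andP.
Qed.

Lemma mset_aggregate_released B n y : measurable [set x : T |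
  aggregate x (released x B n) y].
Proof. by apply: mset_aggregate => p; exact: mset_released. Qed.

Lemma mset_aggregate_earlier B p y : measurable [set x : T |
  aggregate x (earlier x B p) y].
Proof. by apply: mset_aggregate => q; exact: mset_earlier. Qed.

Lemma mset_settles B n p y : measurable [set x : T | settles x B n p y].
Proof.
apply: (@mset_eq _ _ [set x : T |
  released x B n p /\ (~ aggregate x (earlier x B p) y /\
      exists2 k, wk x p k = y &
       forall i, (i < k)%N -> aggregate x (earlier x B p) (wk x p i))]).
  have mA z := mset_aggregate_earlier B p z.
  have mW k z := @measurable_wk d R p k z.
  have mR := mset_released B n p.
  have mAW i := mset_at i mA mW.
  by mset.
by move=> x; split=> [[]|[? []]].
Qed.

End MeasurableForest.

Section MeasurableIDLA.
Variables (d : nat) (R : realType).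
Notation particle := (source d.+1 * nat)%type.
Notation T := (input d.+1 R).

(** The batch takes countably many values: one for each finite set of particles, and the empty list,
    by the convention of [fset_set], when infinitely many particles are released. *)
Lemma measurable_finite_forest n M : measurable_graph (fun x : T =>
  finite_forest x.1 x.2 n M).
Proof.
pose D (x : T) := [set p : particle | in_cylinder M (val p.1) /\ 0 <= tm x p <= n%:R].
have mD p : measurable [set x | D x p].
  apply: mset_and; first exact: mset_cst.
  by apply: (mset_eq (mset_released setT n p)) => x; split=> [|[]].
pose iD (x : T) (Q : seq particle) := (forall p, D x p <-> p \in Q).
have key (U : seq particle -> T -> Prop) : (forall Q, measurable [set x | U Q x]) ->
    measurable [set x | U (batch x n M) x].
  move=> mU; apply: (@mset_eq _ _ [set x | (exists F : {fset particle},
    iD x (enum_fset F) /\ U (enum_fset F) x) \/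
     (~ (exists F : {fset particle}, iD x (enum_fset F)) /\ U [::] x)]).
    by mset.
  have iP (x : T) (F : {fset particle}) : iD x (enum_fset F) <-> D x = [set` F].
    split=> [h|h p]; first by apply/seteqP; split=> p /=; [move/h|move=> ?; apply/h].
    by rewrite h /=.
  have bE x : batch x n M = enum_fset (fset_set (D x)) by [].
  have nfin (x : T) : ~ (exists F : {fset particle}, iD x (enum_fset F)) ->
    batch x n M = [::].
    move=> nF; rewrite bE /fset_set; case: pselect => // fD; case: nF.
    by have [F FE] := finite_fsetP.1 fD; exists F; apply/iP.
  move=> x; split=> [h|[[F [/iP FE h]]|[/nfin nF h]]] /=; last by rewrite nF.
    have [[F FE]|nF] := pselect (exists F : {fset particle}, iD x (enum_fset F)).
      left; exists F; split=> //; move: h; rewrite /= bE.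
      by move/iP : FE => ->; rewrite set_fsetK.
    by right; split=> //; move: h; rewrite /= nfin.
  by rewrite bE FE set_fsetK.
split=> [y|e].
- apply: (@mset_eq _ _ [set x | vertices (run x (batch x n M)) y]).
    apply: (key (fun Q x => vertices (run x Q) y)) => Q.
    by have [h _] := measurable_run R Q.
  by move=> x; rewrite /= finite_forestE.
- apply: (@mset_eq _ _ [set x | edges (run x (batch x n M)) e]).
    apply: (key (fun Q x => edges (run x Q) e)) => Q.
    by have [_ h] := measurable_run R Q.
  by move=> x; rewrite /= finite_forestE.
Qed.

Lemma mset_stabilizing : measurable [set x : T | exists N0, stabilizing x.1 x.2 N0].
Proof.
apply: mset_eq; last by move=> x; exact: iff_sym (stabilizing_exists x).
by mset; apply: mset_restrict_eq; exact: measurable_finite_forest.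
Qed.

Lemma measurable_forest n : measurable_graph (fun x : T => forest_of x n).
Proof.
have [->|n0] := eqVneq n 0%N.
  have -> : (fun x : T => forest_of x 0) = fun _ => empty_graph _.
    by apply/funext => x; rewrite /forest_of /forest eqxx.
  by split=> ?; exact: mset_cst.
(* Where no rank exists, [xget] returns the zero rank, and the forest is the finite forest of the
   box of radius 0. *)
have fE (x : T) : ~ (exists N0, stabilizing x.1 x.2 N0) ->
    forest_of x n = finite_forest x.1 x.2 n 0.
  move=> nst; rewrite /forest_of /forest (negbTE n0).
  have -> : stabilization_rank x.1 x.2 = fun _ _ => 0%N.
    rewrite /stabilization_rank; case: xgetP => [N _ st|//]; by case: nst; exists N.
  apply/graph_eqP; split=> [y|e]; split.
  - by move=> [K _ []].
  - by move=> h; have [K [K1 yK]] := in_cylinder_total y; exists K.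
  - by move=> [K _ []].
  - move=> h; have [K [K1 yK]] := in_cylinder_total e.1; have [K' [K'1 yK']] :=
      in_cylinder_total e.2.
    exists (maxn K K'); first by rewrite /= leq_max K1.
    by split=> //; [apply: in_cylinder_leq yK;
      exact: leq_maxl|apply: in_cylinder_leq yK'; exact: leq_maxr].
have mS := mset_stabilizing.
split=> [y|e].
- apply: (@mset_eq _ _ [set x : T | ((exists N0, stabilizing x.1 x.2 N0) /\
      exists N0, forall N, (N0 <= N)%N -> vertices (finite_forest x.1 x.2 n N) y) \/
    (~ (exists N0, stabilizing x.1 x.2 N0) /\ vertices (finite_forest x.1 x.2 n 0) y)]).
    have m N : measurable [set x : T | vertices (finite_forest x.1 x.2 n N) y].
      by have [h _] := measurable_finite_forest n N.
    apply: mset_or; apply: mset_and => //; last exact: mset_not.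
    by mset.
  move=> x /=; have [st|nst] := pselect (exists N0, stabilizing x.1 x.2 N0).
    have [-> _] := forest_eventually y (y, y) st n0.
    by split=> [h|[[]|[]]//]; left.
  by rewrite fE//; split=> [h|[[]|[]]//]; right.
- apply: (@mset_eq _ _ [set x : T | ((exists N0, stabilizing x.1 x.2 N0) /\
      exists N0, forall N, (N0 <= N)%N -> edges (finite_forest x.1 x.2 n N) e) \/
    (~ (exists N0, stabilizing x.1 x.2 N0) /\ edges (finite_forest x.1 x.2 n 0) e)]).
    have m N : measurable [set x : T | edges (finite_forest x.1 x.2 n N) e].
      by have [_ h] := measurable_finite_forest n N.
    apply: mset_or; apply: mset_and => //; last exact: mset_not.
    by mset.
  move=> x /=; have [st|nst] := pselect (exists N0, stabilizing x.1 x.2 N0).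
    have [_ ->] := forest_eventually e.1 e st n0.
    by split=> [h|[[]|[]]//]; left.
  by rewrite fE//; split=> [h|[[]|[]]//]; right.
Qed.

End MeasurableIDLA.

(** * Sums, almost sure events and independence *)

Section Esum.
Context (R : realType).
Local Open Scope ereal_scope.

Lemma esum_swap (I J : choiceType) (a : I -> J -> \bar R) : (forall i j, 0 <= a i j) ->
  \esum_(i in setT) \esum_(j in setT) a i j = \esum_(j in setT) \esum_(i in setT) a i j.
Proof.
move=> a0; rewrite !esum_esum//.
rewrite (@reindex_esum _ _ _ [set: I * J] _ (fun k => (k.2, k.1))).
  by congr esum; apply/seteqP; split.
split=> //; first by move=> [i j] [i' j'] _ _ [-> ->].
by move=> [j i] _; exists (i, j).
Qed.

Lemma esum_pair (I J : choiceType) (a : I * J -> \bar R) : (forall k, 0 <= a k) ->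
  \esum_(k in setT) a k = \esum_(i in setT) \esum_(j in setT) a (i, j).
Proof.
move=> a0; rewrite esum_esum//; have -> : (setT `*`` fun=>
  setT) = [set: I * J] by apply/seteqP; split.
by apply: eq_esum => -[].
Qed.

Lemma esum_bij (I J : choiceType) (f : I -> J) (g : J -> I) (a : J -> \bar R) :
  cancel f g -> cancel g f ->
  \esum_(j in setT) a j = \esum_(i in setT) a (f i).
Proof.
move=> fg gf; apply: reindex_esum; split=> //; first by move=> i j _ _ /(can_inj fg).
by move=> j _; exists (g j).
Qed.

Lemma esum_fin (I : choiceType) (s : seq I) (a : I -> \bar R) : uniq s -> (forall i,
  0 <= a i) ->
  \esum_(i in [set` s]) a i = \sum_(i <- s) a i.
Proof. by move=> us a0; rewrite esum_fset// -fsbig_seq. Qed.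

Lemma esum_subset (I : choiceType) (A B : set I) (a : I -> \bar R) : A `<=` B ->
  (forall i, 0 <= a i) ->
  \esum_(i in A) a i <= \esum_(i in B) a i.
Proof.
move=> AB a0; rewrite (esumID A B)// (setIidr AB) leeDl//; exact: esum_ge0.
Qed.

Lemma esum_seq_le (I : choiceType) (a : I -> \bar R) (A : set I) b :
  (forall s : seq I, uniq s -> (forall i, i \in s -> A i) -> \sum_(i <- s) a i <= b) ->
  \esum_(i in A) a i <= b.
Proof.
move=> h; apply: ge_ereal_sup => /= _ [X [finX XA] <-].
by rewrite fsbig_finite//=; apply: h => // i; rewrite in_fset_set// inE => /XA.
Qed.

(** The conclusion of the mass transport: masses that are ordered termwise and have the same finite
    total are equal. The rest of the sum is finite and can be cancelled. *)
Lemma esum_eq (I : choiceType) (A : set I) (a b : I -> \bar R) : (forall i, 0 <= a i) ->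
  (forall i, a i <= b i) -> \esum_(i in A) b i <= \esum_(i in A) a i ->
  \esum_(i in A) a i < +oo -> forall i, A i -> a i = b i.
Proof.
move=> a0 ab ba aoo i Ai; have b0 j : 0 <= b j by exact: le_trans (ab j).
have afin : \esum_(i in A) a i \is a fin_num by rewrite ge0_fin_numE// esum_ge0.
have ED (c : I -> \bar R) : (forall j, 0 <= c j) ->
  \esum_(j in A) c j = c i + \esum_(j in A `&` ~` [set i]) c j.
  move=> c0; rewrite (esumID [set i])//; congr (_ + _).
  by rewrite setIidr ?esum_set1// => _ ->.
move: ba aoo afin; rewrite (ED a)// (ED b)//.
set A' := _ `&` _; have : \esum_(j in A') a j <= \esum_(j in A') b j by exact: le_esum.
move: (\esum_(j in A') a j) (\esum_(j in A') b j) (esum_ge0 (fun j (_ : A' j) =>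
  a0 j)) (esum_ge0 (fun j (_ : A' j) => b0 j)).
move=> s t s0 t0 st h1 h2 h3; apply/eqP; rewrite eq_le ab/=.
have sfin : s \is a fin_num by move: h3; rewrite fin_numD => /andP[].
rewrite -(leeD2rE _ _ sfin); apply: le_trans h1; exact: leeD2l.
Qed.

End Esum.

Section MeasureCountable.
Context (disp : measure_display) (T : measurableType disp) (R : realType)
  (mu : {measure set T -> \bar R}).
Local Open Scope ereal_scope.

(** Reduces countable index types to sequences; an integer that codes no index contributes the empty
    set. *)
Definition pickle_family (I : countType) (F : I -> set T) (n : nat) : set T :=
  if choice.pickle_inv n is Some i then F i else set0.

Lemma bigcup_pickle (I : countType) (F : I ->
  set T) : \bigcup_i F i = \bigcup_n pickle_family F n.
Proof.
apply/seteqP; split=> x [i _].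
  by exists (choice.pickle i) => //; rewrite /pickle_family choice.pickleK_inv.
by rewrite /pickle_family; case: choice.pickle_inv => // j; exists j.
Qed.

Lemma esum_pickle (I : countType) (F : I -> set T) :
  \sum_(n <oo) mu (pickle_family F n) = \esum_(i in setT) mu (F i).
Proof.
rewrite nneseries_esumT//; have -> : \esum_(i in setT) mu (F i) =
    \esum_(n in choice.pickle @` [set: I]) mu (pickle_family F n).
  rewrite esum_image.
    by apply: eq_esum => i _; rewrite /pickle_family choice.pickleK_inv.
  by move=> i j _ _ /(pcan_inj (@choice.pickleK I)).
rewrite (esum_mkcond (choice.pickle @` _)); apply: eq_esum => n _; case: ifPn => //.
rewrite notin_setE => /= nI; rewrite /pickle_family.
have := @choice.pickle_invK I n; case: choice.pickle_inv => //= i e; case: nI;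
  by exists i.
Qed.

Lemma measurable_pickle_family (I : countType) (F : I -> set T) n :
  (forall i, measurable (F i)) -> measurable (pickle_family F n).
Proof. by move=> mF; rewrite /pickle_family; case: choice.pickle_inv. Qed.

Lemma measure_countable_bigcup (I : countType) (F : I -> set T) :
  (forall i, measurable (F i)) -> trivIset setT F ->
  mu (\bigcup_i F i) = \esum_(i in setT) mu (F i).
Proof.
move=> mF tF; rewrite bigcup_pickle measure_bigcup//.
- by rewrite -esum_pickle; apply: eq_eseriesl => n; rewrite in_setT.
- by move=> n _; exact: measurable_pickle_family.
- move=> m n _ _; rewrite /pickle_family.
  have := @choice.pickle_invK I m; have := @choice.pickle_invK I n.
  case: (choice.pickle_inv n) => [i|] /=; case: (choice.pickle_inv m) => [j|] /=;
    rewrite ?setI0 ?set0I => e1 e2 [] // x [xj xi].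
  by rewrite -e1 -e2 (tF j i)//; exists x.
Qed.

Lemma measure_countable_bigcup_le (I : countType) (F : I -> set T) :
  (forall i, measurable (F i)) ->
  mu (\bigcup_i F i) <= \esum_(i in setT) mu (F i).
Proof.
move=> mF; rewrite bigcup_pickle -esum_pickle.
have mP n := @measurable_pickle_family _ F n mF.
by apply: measure_sigma_subadditive => //; exact: bigcupT_measurable.
Qed.

Lemma measure_bigcup_eq0 (I : countType) (F : I -> set T) :
  (forall i, measurable (F i)) -> (forall i, mu (F i) = 0) -> mu (\bigcup_i F i) = 0.
Proof.
move=> mF F0; apply/eqP; rewrite eq_le measure_ge0 andbT.
by apply: le_trans (measure_countable_bigcup_le mF) _; rewrite esum1.
Qed.

Lemma ae_forall_countable (I : countType) (Q : I -> T -> Prop) :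
  (forall i, {ae mu, forall x, Q i x}) -> {ae mu, forall x, forall i, Q i x}.
Proof.
move=> h; pose Q' n x := if choice.pickle_inv n is Some i then Q i x else True.
have : {ae mu, forall x, forall n, Q' n x}.
  apply: ae_foralln => n; rewrite /Q'; case: choice.pickle_inv => //; exact: aeW.
by apply: filterS => x hx i; have := hx (choice.pickle i);
  rewrite /Q' choice.pickleK_inv.
Qed.

Lemma ae_measure0 (Q : T -> Prop) : measurable [set x | Q x] -> 
  mu (~` [set x | Q x]) = 0 <-> {ae mu, forall x, Q x}.
Proof.
move=> mQ; split=> [h|]; first by exists (~` [set x | Q x]); split=> //;
  exact: measurableC.
move=> [N [mN N0 h]]; apply/eqP; rewrite eq_le measure_ge0 andbT -N0.
by apply: le_measure; rewrite ?inE//; exact: measurableC.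
Qed.

Lemma ae_measure_le (A B : set T) : measurable A -> measurable B ->
  {ae mu, forall x, A x -> B x} -> mu A <= mu B.
Proof.
move=> mA mB [N [mN N0 h]]; apply: (@le_trans _ _ (mu (B `|` N))).
  apply: le_measure; rewrite ?inE//; first exact: measurableU.
  move=> x Ax; have [Bx|nB] := pselect (B x); [by left|right].
  by apply: h => /= /(_ Ax).
by rewrite (measureU0 mB mN N0).
Qed.

Lemma ae_measure_eq (A B : set T) : measurable A -> measurable B ->
  {ae mu, forall x, A x <-> B x} -> mu A = mu B.
Proof.
move=> mA mB h; apply/eqP; rewrite eq_le !ae_measure_le//; apply: filterS h => x [] //.
Qed.

End MeasureCountable.

Section Dynkin.
Context (disp : measure_display) (T : measurableType disp) (R : realType).
Local Open Scope ereal_scope.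

(** Dynkin's pi-lambda theorem. *)
Lemma dynkin_class (T' : Type) (G H : set_system T') : setI_closed G -> dynkin H ->
  G `<=` H ->
  <<s G >> `<=` H.
Proof.
move=> GI dH GH; rewrite -(setI_closed_g_dynkin_g_sigma_algebra GI).
exact: smallest_sub.
Qed.

Lemma dynkin_eq (P Q : probability T R) : dynkin [set A | measurable A /\ P A = Q A].
Proof.
split=> /=; first by rewrite !probability_setT.
- by move=> A [mA PQ]; split; [exact: measurableC|rewrite !probability_setC// PQ].
- move=> F tF h; have mF n : measurable (F n) by case: (h n).
  split; first exact: bigcupT_measurable.
  by rewrite !measure_semi_bigcup//; [|exact: bigcupT_measurable..];
    apply: eq_eseriesr => n _; case: (h n).
Qed.

Lemma dynkin_indep (P : probability T R) B : measurable B ->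
  dynkin [set A | measurable A /\ P (A `&` B) = P A * P B].
Proof.
move=> mB; split=> /=; first by rewrite setTI probability_setT mul1e.
- move=> A [mA PAB]; split; first exact: measurableC.
  have mAB := measurableI _ _ mA mB.
  rewrite setIC -setDE measureD// ?ltey_eq ?fin_num_measure//.
  rewrite [X in _ - X](_ : _ = P A * P B); last by rewrite setIC.
  by rewrite probability_setC// muleBl ?mul1e// fin_num_measure.
- move=> F tF h; have mF n : measurable (F n) by case: (h n).
  have mU : measurable (\bigcup_n F n) by exact: bigcupT_measurable.
  have mFB n : measurable (F n `&` B) by exact: measurableI.
  have tFB : trivIset setT (fun n => F n `&` B) by exact: trivIset_setIr.
  split=> //; rewrite setI_bigcupl (measure_semi_bigcup P mFB tFB);
    last exact: bigcupT_measurable.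
  rewrite (measure_semi_bigcup P mF tF mU) muleC.
  have PB : P B \is a fin_num by rewrite fin_num_measure.
  rewrite -(fineK PB) -nneseriesZl//; apply: eq_eseriesr => n _.
  by rewrite fineK// muleC; case: (h n).
Qed.

(** The pi-lambda theorem is applied to one factor at a time, the other being fixed. *)
Lemma indep_sigma (P : probability T R) (G1 G2 : set_system T) :
  setI_closed G1 -> setI_closed G2 -> G1 `<=` measurable -> G2 `<=` measurable ->
  (forall A B, G1 A -> G2 B -> P (A `&` B) = P A * P B) ->
  forall A B, <<s G1 >> A -> <<s G2 >> B -> P (A `&` B) = P A * P B.
Proof.
move=> I1 I2 m1 m2 h.
have h1 A B : <<s G1 >> A -> G2 B -> P (A `&` B) = P A * P B.
  move=> sA GB; apply: (@dynkin_class _ G1 _ I1 (dynkin_indep P (m2 _ GB)) _ _ sA).2.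
  by move=> C GC; split; [exact: m1|exact: h].
move=> A B sA sB.
have mA : measurable A.
  by move: sA; apply: smallest_sub => //; exact: sigma_algebra_measurable.
rewrite setIC muleC.
apply: (@dynkin_class _ G2 _ I2 (dynkin_indep P mA) _ _ sB).2.
by move=> C GC; split; [exact: m2|rewrite setIC muleC; exact: h1].
Qed.

End Dynkin.

Section IndependentGroups.
Context (disp : measure_display) (T : measurableType disp) (R : realType)
  (P : probability T R) (I : choiceType) (F : I -> set_system T).
Local Open Scope ereal_scope.
Hypothesis sF : forall i, sigma_algebra setT (F i).
Hypothesis mF : forall i, F i `<=` measurable.
Hypothesis iF : independent P F.

(** Choosing one event per index makes this a pi-system, on which independence is the product
    formula; it generates the sigma-algebra of the whole group [I1]. *)
Definition cylinders (I1 : set I) : set_system T :=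
  [set A | exists J : {fset I}, exists E : I -> set T,
    [/\ forall i, i \in J -> I1 i, forall i, i \in J -> F i (E i) &
        A = \bigcap_(i in [set` J]) E i]].

Let FT i : F i setT.
Proof. by case: (sF i) => h0 hD _; rewrite -(setD0 setT); exact: hD. Qed.

Let FI i : setI_closed (F i).
Proof. by move: (sF i) => /(sigma_algebraP (fun _ _ => subsetT _))[]. Qed.

Lemma cylindersI I1 : setI_closed (cylinders I1).
Proof.
move=> _ _ [J [E [JI FE ->]]] [J' [E' [JI' FE' ->]]].
exists (J `|` J')%fset, (fun i =>
  (if i \in J then E i else setT) `&` (if i \in J' then E' i else setT)).
split=> [i|i _|].
- by rewrite inE => /orP[/JI|/JI'].
- by apply: FI; case: ifP => // h; [exact: FE|exact: FE'].
- apply/seteqP; split=> x /=.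
    by move=> [h h'] i /= _; split; case: ifP => // ?; [exact: h|exact: h'].
  move=> h; split=> i /= iJ; have /= := h i; rewrite inE iJ ?orbT => /(_ isT)[]//.
Qed.

Lemma cylinders_measurable I1 : cylinders I1 `<=` measurable.
Proof.
move=> _ [J [E [_ FE ->]]]; apply: fin_bigcap_measurable => // i iJ.
by apply: (@mF i); exact: FE.
Qed.

Lemma sigma_cylinders (I1 : set I) : <<s \bigcup_(i in I1) F i >> `<=` <<s cylinders
  I1 >>.
Proof.
apply: smallest_sub; first exact: smallest_sigma_algebra.
move=> A [i I1i FA]; apply: sub_gen_smallest; exists [fset i]%fset, (fun=> A); split.
- by move=> j; rewrite inE => /eqP->.
- by move=> j; rewrite inE => /eqP->.
- apply/seteqP; split=> [x Ax j //|x h].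
  by apply: (h i) => /=; rewrite inE.
Qed.

Lemma independent_groups (I1 I2 : set I) A B : I1 `&` I2 = set0 ->
  <<s \bigcup_(i in I1) F i >> A -> <<s \bigcup_(i in I2) F i >> B ->
  P (A `&` B) = P A * P B.
Proof.
move=> I12 /sigma_cylinders sA /sigma_cylinders sB.
apply: indep_sigma sA sB; try exact: cylindersI; try exact: cylinders_measurable.
move=> _ _ [J [E [JI FE ->]]] [J' [E' [JI' FE' ->]]].
pose E'' i := if i \in J then E i else E' i.
have dJ i : i \in J' -> i \in J = false.
  move=> iJ'; apply/negP => iJ; have : (I1 `&` I2) i by split; [exact: JI|exact: JI'].
  by rewrite I12.
have EJ : \bigcap_(i in [set` J]) E i = \bigcap_(i in [set` J]) E'' i.
  by apply: eq_bigcapr => i /= iJ; rewrite /E'' iJ.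
have EJ' : \bigcap_(i in [set` J']) E' i = \bigcap_(i in [set` J']) E'' i.
  by apply: eq_bigcapr => i /= iJ; rewrite /E'' dJ.
have F1 i : i \in J -> F i (E'' i) by move=> iJ; rewrite /E'' iJ; exact: FE.
have F2 i : i \in J' -> F i (E'' i) by move=> iJ; rewrite /E'' dJ//; exact: FE'.
have F3 i : i \in (J `|` J')%fset -> F i (E'' i) by rewrite inE => /orP[/F1|/F2].
rewrite EJ EJ' -bigcap_setU.
have -> : [set` J] `|` [set` J'] = [set` (J `|` J')%fset].
  by apply/seteqP; split=> i /=; rewrite inE => /orP.
rewrite (iF F1) (iF F2) (iF F3) -big_cat /=; apply: perm_big.
apply: uniq_perm; rewrite ?fset_uniq// ?cat_uniq ?fset_uniq ?andbT//=.
  by apply/hasPn => i /= /dJ; rewrite /= => ->.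
by move=> i; rewrite mem_cat inE.
Qed.

(** By independence of disjoint groups, the first [M] events all fail with probability at most
    [(1 - p) ^+ M], which tends to 0. *)
Lemma independent_some (I_ : nat -> set I) (E : nat -> set T) p : (0 < p)%R ->
  trivIset setT I_ -> (forall m, <<s \bigcup_(i in I_ m) F i >> (E m)) ->
  (forall m, p%:E <= P (E m)) -> P (\bigcap_m ~` E m) = 0.
Proof.
move=> p0 tI sE pE.
have mE m : measurable (E m).
  move: (sE m); apply: smallest_sub; first exact: sigma_algebra_measurable.
  by move=> A [i _]; exact: mF.
pose G M := \bigcap_(m < M) ~` E m.
have mG M : measurable (G M) by apply: bigcap_measurableType => m _; exact: measurableC.
have sG M : <<s \bigcup_(i in \bigcup_(m < M) I_ m) F i >> (G M).
  have := @smallest_sigma_algebra _ setT (\bigcup_(i in \bigcup_(m < M) I_ m) F i).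
  set S := <<s _ >> => sS.
  have sEM m : (m < M)%N -> S (E m).
    move=> mM; move: (sE m); apply: smallest_sub => // A [i Ii FA].
    by apply: sub_gen_smallest; exists i => //; exists m.
  rewrite /G -setC_bigcup.
  have := @bigcup_measurable _ (g_sigma_algebraType (\bigcup_(i in \bigcup_(m < M) I_
    m) F i)) E `I_M (fun m => sEM m).
  exact: (@measurableC _ (g_sigma_algebraType (\bigcup_(i in \bigcup_(m < M) I_ m) F
    i))).
have p1 : (p <= 1)%R by rewrite -lee_fin (le_trans (pE 0%N))// probability_le1.
have PG M : P (G M) <= ((1 - p) ^+ M)%:E.
  elim: M => [|M IH]; first by rewrite expr0 probability_le1.
  have -> : G M.+1 = G M `\` E M.
    apply/seteqP; split=> [x h|x [h hM] m /=].
      by split=> [m /= mM|]; apply: h => //=; rewrite ltnS ltnW.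
    by rewrite ltnS leq_eqVlt => /predU1P[->//|]; exact: h.
  have GE : P (G M `&` E M) = P (G M) * P (E M).
    apply: (@independent_groups (\bigcup_(m < M) I_ m) (I_ M)) => //.
    rewrite setI_bigcupl; rewrite -subset0 => i [m /= mM [im iM]].
    have mM' := tI m M Logic.I Logic.I (ex_intro _ i (conj im iM)).
    by rewrite mM' ltnn in mM.
  have -> : P (G M `\` E M) = P (G M) - P (G M) * P (E M).
    by rewrite measureD// ?ltey_eq ?fin_num_measure//; congr (_ - _).
  have fG : P (G M) \is a fin_num by rewrite fin_num_measure.
  have fE : P (E M) \is a fin_num by rewrite fin_num_measure.
  move: IH (pE M); rewrite -(fineK fG) -(fineK fE) -EFinM -EFinB !lee_fin.
  have : (0 <= fine (P (G M)))%R by rewrite fine_ge0.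
  have : (fine (P (E M)) <= 1)%R by rewrite -lee_fin fineK// probability_le1.
  move: (fine (P (G M))) (fine (P (E M))) => g e e1 g0 h1 h2.
  rewrite -[X in (X - _)%R]mulr1 -mulrBr exprSr.
  apply: ler_pM => //; last by rewrite lerD2l lerN2.
  by rewrite subr_ge0.
have mI : measurable (\bigcap_m ~` E m) by apply: bigcapT_measurable => m;
  exact: measurableC.
have fI : P (\bigcap_m ~` E m) \is a fin_num by rewrite fin_num_measure.
apply/eqP; rewrite eq_le measure_ge0 andbT -(fineK fI) lee_fin.
have cv : ((1 - p) ^+ M)%R @[M --> \oo] --> (0 : R)%R.
  by apply: cvg_expr; rewrite ger0_norm ?subr_ge0// ltrBlDr ltrDl.
rewrite -(cvg_lim _ cv)//; apply: limr_ge; first by apply/cvg_ex; exists 0%R.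
apply: nearW => M; rewrite -lee_fin (fineK fI); apply: le_trans (PG M).
by apply: le_measure; rewrite ?inE//; move=> x h m _; exact: h.
Qed.

End IndependentGroups.

(** * Poisson clocks and random walks *)

Section EqProb.
Context (disp : measure_display) (Omega : measurableType disp) (R : realType)
  (P : probability Omega R).
Local Open Scope ereal_scope.

(** If a countable observable almost surely decides whether [A] holds, the probability of [A]
    depends only on the law of that observable. The laws of two clocks, or of two walks, are
    compared in this way. *)
Lemma prob_partition (V : countType) (E : V -> set Omega) (phi : V ->
  bool) (A : set Omega) :
  (forall v, measurable (E v)) -> trivIset setT E -> measurable A ->
  {ae P, forall w, exists v, E v w} ->
  {ae P, forall w, forall v, E v w -> (A w <-> phi v)} ->
  P A = \esum_(v in setT) (if phi v then P (E v) else 0).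
Proof.
move=> mE tE mA cE AE; pose F v := if phi v then E v else set0.
have mF v : measurable (F v) by rewrite /F; case: ifP.
have tF : trivIset setT F.
  move=> v v' _ _ [w []]; rewrite /F; case: ifP => // _ Ev; case: ifP => // _ Ev'.
  by apply: tE => //; exists w.
rewrite (_ : P A = P (\bigcup_v F v)).
  rewrite measure_countable_bigcup//; apply: eq_esum => v _.
  by rewrite /F; case: ifP => // _; rewrite measure0.
apply: ae_measure_eq => //; first exact: countable_bigcupT_measurable.
apply: filterS2 cE AE => w [v Ev] h; split=> [/(h _ Ev) pv|[v' _]].
  by exists v => //; rewrite /F pv.
by rewrite /F; case: ifP => // pv' /h ->.
Qed.

Lemma prob_ae (A : set Omega) : measurable A -> {ae P, forall w, A w} <-> P A = 1.
Proof.
move=> mA; split=> [h|h]; first rewrite -(probability_setT P).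
  by apply: ae_measure_eq => //; apply: filterS h.
by exists (~` A); split=> //; [exact: measurableC|rewrite probability_setC// h subee].
Qed.

Lemma probability0_ae (A : set Omega) : measurable A -> P A = 0 -> {ae P, forall w,
  ~ A w}.
Proof. by move=> mA A0; exists A; split=> // w /=; apply: contrapT. Qed.

End EqProb.

Section Clock.
Context (disp : measure_display) (Omega : measurableType disp) (R : realType)
  (P : probability Omega R).
Local Open Scope ereal_scope.

Lemma counting_natP (D : set nat) (m : nat) : counting D = m%:R%:E :> \bar R <->
  exists l : seq nat, [/\ uniq l, size l = m & D = [set` l]].
Proof.
rewrite /counting; case: asboolP => [fD|nfD]; split=> //.
- move=> [/eqP]; rewrite eqr_nat => /eqP <-.
  exists (enum_fset (fset_set D)); split=> //; first exact: fset_uniq.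
  by apply/seteqP; split=> j /=; rewrite in_fset_set// inE.
- move=> [l [ul <- DE]]; congr (_%:R%:E).
  apply/eqP; rewrite -uniq_size_uniq ?fset_uniq// => j.
  by rewrite [RHS]in_fset_set// DE; apply/idP/idP; rewrite inE.
- by move=> [l [_ _ DE]]; case: nfD; rewrite DE; exact: finite_seq.
Qed.

(** For points enumerated in increasing order, the indices of those below a given time form an
    initial segment, so their number tells which they are. *)
Lemma initial_segment (D : set nat) (l : seq nat) : uniq l -> D = [set` l] ->
  (forall i j, (i <= j)%N -> D j -> D i) -> forall j, D j <-> (j < size l)%N.
Proof.
move=> ul DE down j; split=> [Dj|jl].
  rewrite -[X in (X <= _)%N](size_iota 0 j.+1); apply: uniq_leq_size;
    first exact: iota_uniq.
  move=> i; rewrite mem_iota add0n ltnS => /andP[_ ij].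
  by have : D i by [exact: down Dj]; rewrite DE.
apply: contrapT => nDj; move: jl; rewrite ltnNge => /negP; apply.
rewrite -[X in (_ <= X)%N](size_iota 0 j); apply: uniq_leq_size => // i il.
rewrite mem_iota add0n /= ltnNge; apply/negP => ji; apply: nDj; apply: (down j i) => //.
by rewrite DE.
Qed.

Section OneClock.
Variable tau : nat -> Omega -> R.
Hypothesis mtau : forall j, measurable_fun setT (tau j).
Hypothesis ctau : poisson_clock P tau.

Lemma mset_clock j (B : set R) : measurable B -> measurable [set w | B (tau j w)].
Proof. by move=> mB; have := mtau j measurableT mB; rewrite setTI. Qed.

Lemma mset_count (B : set R) (m : nat) : measurable B ->
  measurable [set w | point_count tau B w = m%:R%:E].
Proof.
move=> mB; apply: (@mset_eq _ _ [set w | exists l : seq nat, (uniq l /\ size l = m) /\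
    forall j, B (tau j w) <-> j \in l]).
  by mset; exact: mset_clock.
move=> w /=; rewrite /point_count counting_natP; split=>
  [[l [ul sl E]]|[l [[ul sl] E]]]; exists l; split=> //.
  by move=> j; have := congr1 (fun D => D j) E => /= ->.
by apply/seteqP; split=> j /= /E.
Qed.

(** The definition of a clock gives the probability of each finite count; these Poisson weights
    already sum to 1, which leaves no mass for infinity. *)
Lemma count_finite (B : set R) : measurable B -> lebesgue_measure (B `&` `[0%R,
  +oo[) < +oo ->
  {ae P, forall w, exists m : nat, point_count tau B w = m%:R%:E}.
Proof.
move=> mB lB; apply/prob_ae; first by apply: mset_exists => m; exact: mset_count.
case: ctau => _ /(_ B mB lB) hB _.
rewrite [X in P X = _](_ : _ = \bigcup_m [set w | point_count tau B w = m%:R%:E]);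
  last first.
  by apply/seteqP; split=> w [m]; [exists m|exists m].
rewrite measure_countable_bigcup; first last.
- by move=> i j _ _ [w [/= -> [/eqP]]]; rewrite eqr_nat => /eqP.
- by move=> m; exact: mset_count.
set r := fine _ in hB.
have -> : 1 = \esum_(m in [set: nat]) poisson_prob r 0%N [set m].
  rewrite -measure_countable_bigcup//; last by move=> i j _ _ [k [/= <- <-]].
  rewrite -[LHS](probability_setT (poisson_prob r 0%N)); congr (poisson_prob r 0%N _).
  by apply/seteqP; split=> // m _; exists m.
by apply: eq_esum => m _; exact: hB.
Qed.

Lemma clock_increasing : {ae P, forall w, forall i j, (i <= j)%N ->
  (tau i w <= tau j w)%R}.
Proof.
case: ctau => + _ _; apply: filterS => w h i j /subnK <-.
elim: (j - i)%N => // k IH; apply: le_trans IH _; rewrite addSn; exact/ltW/h.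
Qed.

Lemma clock_injective : {ae P, forall w, forall i j, tau i w = tau j w -> i = j}.
Proof.
case: ctau => + _ _; apply: filterS => w h i j.
have lt a b : (a < b)%N -> (tau a w < tau b w)%R.
  move=> /subnK <-; elim: (b - a.+1)%N => [|k IH]; first exact: h.
  by apply: lt_trans IH _; rewrite addSn; exact: h.
by have [/lt + e|/lt + e|//] := ltngtP i j; rewrite e ltxx.
Qed.

(** The negative half-line has intensity 0, so the law of its count is the Dirac mass at 0. *)
Lemma clock_ge0 : {ae P, forall w, forall j, (0 <= tau j w)%R}.
Proof.
case: ctau => _ hc _; pose B : set R := `]-oo, 0%R[%classic.
have B0 : B `&` `[0%R, +oo[ = set0.
  apply/seteqP; split=> // r [/=]; rewrite !in_itv/= andbT => r0 /(lt_le_trans r0);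
    by rewrite ltxx.
have mB : measurable B by exact: measurable_itv.
have : P [set w | point_count tau B w = 0%:R%:E] = 1.
  rewrite hc// B0 ?measure0// /poisson_prob ltxx.
  by rewrite diracE mem_set.
move/prob_ae => /(_ (mset_count 0 mB)); apply: filterS =>
  w /counting_natP[l [_ /size0nil-> E]] j.
rewrite leNgt; apply/negP => tj; have : [set j |
  B (tau j w)] j by rewrite /= /B /= in_itv.
by rewrite E.
Qed.

(** A point is present with probability [1 - expR (- r)], at most [r]; the value [r = 0] is the
    Dirac case of [poisson_prob]. *)
Lemma count_prob0 (B : set R) (r : R) : measurable B -> lebesgue_measure (B `&` `[0%R,
  +oo[) = r%:E ->
  P [set w | exists j, B (tau j w)] <= r%:E.
Proof.
move=> mB lB; case: ctau => _ hc _.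
have r0 : (0 <= r)%R by rewrite -lee_fin -lB measure_ge0.
rewrite (_ : [set w | _] = ~` [set w | point_count tau B w = 0%:R%:E]); last first.
  apply/seteqP; split=> w /=.
    move=> [j Bj] /counting_natP[l [_ /size0nil-> E]].
    by have : [set j | B (tau j w)] j by []; rewrite E.
  move=> h; apply: contrapT => nj; apply: h; apply/counting_natP; exists [::]; split=>
    //.
  by apply/seteqP; split=> // j /= Bj; case: nj; exists j.
rewrite probability_setC ?hc ?lB ?ltry//=; last exact: mset_count.
rewrite /poisson_prob; case: ifPn => r1.
  rewrite esum_set1 ?lee_fin ?poisson_pmf_ge0// /poisson_pmf.
  rewrite r1 expr0 fact0 invr1 !mul1r lerBlDr.
  have := expR_ge1Dx (- r)%R; lra.
by rewrite diracE mem_set// subee// lee_fin.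
Qed.

(* The sum is the mean of the number of points below t; bounding m by 2 ^ m
   turns the Poisson law of mean t into [expR t] times the one of mean 2t. *)
Lemma clock_summable (t : R) : \esum_(j in setT) P [set w | (tau j w <= t)%R] < +oo.
Proof.
wlog t0 : t / (0 < t)%R => [H|].
  apply: le_lt_trans (H (`|t| + 1)%R (ltr_wpDl _ ltr01)) => //.
  apply: le_esum => j _; apply: le_measure; rewrite ?inE.
  - exact: (@mset_clock j `]-oo, t]%classic).
  - exact: (@mset_clock j `]-oo, (`|t|+1)%R]%classic).
  - by move=> w /= /le_trans; apply; rewrite (le_trans (ler_norm _))// lerDl.
pose B : set R := `]-oo, t]%classic.
have mB : measurable B by exact: measurable_itv.
have lB : lebesgue_measure (B `&` `[0%R, +oo[) = t%:E.
  rewrite (_ : B `&` _ = `[0%R, t]%classic); last first.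
    by apply/seteqP; split=> r /=; rewrite /B /= !in_itv/= ?andbT; [move=> [->
      ->]|move=> /andP[-> ->]].
  by rewrite lebesgue_measure_itv/= lte_fin t0 sube0.
have ptB m : P [set w | point_count tau B w = m%:R%:E] = (poisson_pmf t m)%:E.
  case: ctau => _ hc _; rewrite hc ?lB ?ltry//= /poisson_prob t0 esum_set1//.
  by rewrite lee_fin poisson_pmf_ge0.
have jle j : P [set w | (tau j w <= t)%R] <= \esum_(m in setT) (if (j < m)%N then
  (poisson_pmf t m)%:E else 0).
  rewrite (@prob_partition _ _ _ P nat (fun m => [set w |
    point_count tau B w = m%:R%:E]) (fun m => (j < m)%N)).
  - by apply: le_esum => m _; rewrite ptB.
  - by move=> m; exact: mset_count.
  - by move=> i k _ _ [w [/= -> [/eqP]]]; rewrite eqr_nat => /eqP.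
  - exact: (@mset_clock j `]-oo, t]%classic).
  - by apply: count_finite => //; rewrite lB ltry.
  - apply: filterS clock_increasing => w inc m /counting_natP[l [ul <- E]].
    rewrite -(initial_segment ul E); last first.
      by move=> a b ab; rewrite /= /B /= !in_itv/=; apply: le_trans; exact: inc.
    by rewrite /= /B /= in_itv.
apply: (@le_lt_trans _ _ (\esum_(j in [set: nat]) \esum_(m in setT) (if (j < m)%N then
  (poisson_pmf t m)%:E else 0))).
  exact: le_esum.
rewrite esum_swap; last by move=> j m; case: ifP; rewrite ?lee_fin ?poisson_pmf_ge0.
apply: (@le_lt_trans _ _ (\esum_(m in [set: nat]) ((expR t)%:E * (poisson_pmf (t + t)
  m)%:E))).
  apply: le_esum => m _.
  rewrite (_ : \esum_(j in _) _ = \esum_(j in [set` iota 0 m]) (poisson_pmf t m)%:E);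
    last first.
    rewrite [RHS]esum_mkcond; apply: eq_esum => j _.
    case: ltnP => jm; first by rewrite mem_set //= mem_iota.
    by rewrite memNset //= mem_iota add0n ltnNge jm.
  rewrite esum_fin ?iota_uniq//; last by move=> _; rewrite lee_fin poisson_pmf_ge0.
  rewrite sumEFin -EFinM lee_fin big_const_seq count_predT size_iota iter_addr addr0.
  rewrite /poisson_pmf t0 addr_gt0// -[X in (X <= _)%R]mulr_natl.
  have -> : (expR t * ((t + t) ^+ m * m`!%:R^-1 * expR (- (t + t))) = 2 ^+ m * (t ^+ m
    * m`!%:R^-1 * expR (- t)))%R.
    rewrite (_ : (- (t + t) = - t + - t)%R); last by ring.
    rewrite expRD (_ : (t + t = 2 * t)%R) ?exprMn; last by ring.
    have : (expR t * expR (-t) = 1)%R by rewrite -expRD subrr expR0.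
    move: (expR t) (expR (- t)) => a b ab.
    rewrite (_ : (a * _ = (a * b) * (2 ^+ m * (t ^+ m * m`!%:R^-1 * b)))%R);
      last by ring.
    by rewrite ab mul1r.
  rewrite ler_wpM2r//; first by rewrite !mulr_ge0 ?invr_ge0 ?exprn_ge0 ?expR_ge0// ltW.
  by rewrite -natrX ler_nat ltnW// ltn_expl.
rewrite -nneseries_esumT; last first.
  by move=> m; rewrite mule_ge0 ?lee_fin ?expR_ge0 ?poisson_pmf_ge0.
rewrite nneseriesZl; last by move=> m _; rewrite lee_fin poisson_pmf_ge0.
have -> : \sum_(0 <= i <oo) (poisson_pmf (t + t) i)%:E = 1.
  have E : poisson_prob (t + t) 0%N [set: nat] = \esum_(k in setT) (poisson_pmf (t +
    t) k)%:E.
    by rewrite /poisson_prob addr_gt0.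
  rewrite nneseries_esumT; last by move=> m; rewrite lee_fin poisson_pmf_ge0.
  by rewrite -E; exact: probability_setT.
by rewrite mule1 ltry.
Qed.

End OneClock.

End Clock.

Section ClockLaw.
Context (disp : measure_display) (Omega : measurableType disp) (R : realType)
  (P : probability Omega R).
Local Open Scope ereal_scope.

Lemma counting_fibers (V : eqType) (f : nat -> V) (M : seq V) (c : V -> nat) : uniq M ->
  (forall b, b \in M -> counting [set j | f j = b] = (c b)%:R%:E :> \bar R) ->
  counting [set j | f j \in M] = (\sum_(b <- M) c b)%N%:R%:E :> \bar R.
Proof.
move=> uM hc; apply/counting_natP; elim: M uM hc => [_ _|b M IH /= /andP[bM uM] hc].
  by exists [::]; split=> //=; rewrite big_nil.
have [l [ul sl lE]] := IH uM (fun b' h => hc b' (mem_behead (s := b :: M) h)).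
have /counting_natP[l' [ul' sl' lE']] := hc b (mem_head _ _).
have ll' j : (j \in l) = (f j \in M) by apply/idP/idP => h;
  [have : [set` l] j by []|have : [set j | f j \in M] j by []]; rewrite -?lE// lE.
have ll'' j : (j \in l') = (f j == b).
  apply/idP/eqP => h; [have : [set` l'] j by []|have : [set j | f j = b] j by []];
    rewrite -?lE'// lE'//.
exists (l' ++ l); split.
- rewrite cat_uniq ul ul' andbT /=; apply/hasPn => j; rewrite /= ll' ll'' => fM.
  by apply: contra bM => /eqP<-.
- by rewrite size_cat sl sl' big_cons.
- by apply/seteqP; split=> j /=; rewrite inE mem_cat ll' ll''.
Qed.

(** A pair [(j, t)] of [s] stands for the constraint that the point of index [j] is at most [t].
    Finite conjunctions of such constraints form a pi-system for the law of a clock. *)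
Variable s : seq (nat * R).

Let code (r : R) : seq bool := [seq (r <= jt.2)%R | jt <- s].
(* The half-lines ]-oo, t], for t in [s], are unions of these disjoint cells. *)
Let cell (n : nat) : set R := [set r | choice.pickle (code r) = n].
Let bit i n : bool := nth false (odflt [::] (choice.unpickle n)) i.
(** Only cells with a true bit are kept, that is those below some time of [s]: they have finite
    intensity, so that their counts follow Poisson laws. *)
Let codes : seq nat :=
  [seq choice.pickle b | b <- [seq val b |
    b <- enum {: (size s).-tuple bool}] & has id b].

Let mem_codes r : has id (code r) -> choice.pickle (code r) \in codes.
Proof.
move=> h; apply: map_f; rewrite mem_filter h /=; apply/mapP.
have sz : size (code r) == size s by rewrite size_map.
by exists (Tuple sz) => //; rewrite mem_enum.
Qed.

Let codes_uniq : uniq codes.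
Proof.
rewrite map_inj_uniq; last exact: (pcan_inj (@choice.pickleK _)).
by rewrite filter_uniq// map_inj_uniq ?enum_uniq//; exact: val_inj.
Qed.

Let measurable_cell n : measurable (cell n).
Proof.
rewrite /cell; suff mc b : measurable [set r | code r = b].
  apply: (@mset_eq _ _ [set r | exists b, code r = b /\ choice.pickle b = n]);
    first by mset.
  by move=> r; split=> [h|[b [<-]]//]; exists (code r).
rewrite /code; elim: s b => [|jt s' IH] [|c b] /=; try exact: mset_cst.
  by apply: (@mset_eq _ _ set0) => // r.
apply: (@mset_eq _ _ [set r : R | (r <= jt.2)%R = c /\ [seq (r <= jt0.2)%R |
  jt0 <- s'] = b]).
  apply: mset_and => //; case: c.
    apply: (@mset_eq _ _ `]-oo, jt.2]%classic); first exact: measurable_itv.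
    by move=> r; rewrite /= in_itv.
  apply: (@mset_eq _ _ `]jt.2, +oo[%classic); first exact: measurable_itv.
  by move=> r; rewrite /= in_itv/= andbT ltNge; split=> [->//|/negbTE].
by move=> r; split=> /= [[-> ->]|[-> ->]].
Qed.

Let cell_finite n : n \in codes -> lebesgue_measure (cell n `&` `[0%R, +oo[) < +oo.
Proof.
move=> /mapP[b]; rewrite mem_filter => /andP[/(has_nthP false)[i ib bi] _] ->.
set t := (nth (0%N, 0%R) s i).2.
apply: (@le_lt_trans _ _ (lebesgue_measure (`[0%R, t]%classic : set R))).
  apply: le_measure; rewrite ?inE//.
    by apply: measurableI; [exact: measurable_cell|exact: measurable_itv].
  move=> r [/(pcan_inj (@choice.pickleK _)) cb] /=; rewrite !in_itv/= andbT => -> /=.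
  have : nth false (code r) i by rewrite cb.
  by rewrite (nth_map (0%N, 0%R))// -(size_map (fun jt => (r <= jt.2)%R)) -/(code r) cb.
by rewrite lebesgue_measure_itv/=; case: ifP; rewrite // -EFinB ltry.
Qed.

Let counts (tau : nat -> Omega -> R) (v : seq nat) : set Omega :=
  [set w | size v = size codes /\ forall n, n \in codes ->
    point_count tau (cell n) w = (nth 0%N v (index n codes))%:R%:E].

(** The point of index [j] is at most [t] exactly when more than [j] points lie in []-oo, t]]; their
    number is the sum of the counts of the cells composing this half-line. *)
Let phi (v : seq nat) : bool :=
  all (fun i => ((nth (0%N, 0%R) s i).1 < \sum_(n <- codes |
    bit i n) nth 0%N v (index n codes))%N) (iota 0 (size s)).

Let countsP tau v w : (forall i j, (i <= j)%N -> (tau i w <= tau j w)%R) ->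
  counts tau v w -> (forall jt, jt \in s -> (tau jt.1 w <= jt.2)%R) <-> phi v.
Proof.
move=> inc [_ hv].
have key i : (i < size s)%N -> (tau (nth (0%N, 0%R) s i).1 w <= (nth (0%N,
  0%R) s i).2)%R <->
    ((nth (0%N, 0%R) s i).1 < \sum_(n <- codes | bit i n) nth 0%N v (index n codes))%N.
  move=> si; set jt := nth _ s i.
  have bE r : bit i (choice.pickle (code r)) = (r <= jt.2)%R.
    by rewrite /bit choice.pickleK /= (nth_map (0%N, 0%R)).
  have /counting_natP[l [ul sl lE]] : counting [set j | (tau j w <= jt.2)%R] =
      (\sum_(n <- codes | bit i n) nth 0%N v (index n codes))%N%:R%:E :> \bar R.
    rewrite -big_filter.
    rewrite -(@counting_fibers _ (fun j =>
      choice.pickle (code (tau j w))) [seq n <- codes | bit i n]).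
    - congr counting; apply/seteqP; split=> j /=; rewrite mem_filter bE;
        last by case/andP.
      move=> tj; rewrite tj mem_codes//; apply/(has_nthP false); exists i;
        first by rewrite size_map.
      by rewrite (nth_map (0%N, 0%R)).
    - by rewrite filter_uniq.
    - by move=> n; rewrite mem_filter => /andP[_ /hv].
  rewrite -sl -(initial_segment ul lE)// => a b ab /=; apply: le_trans; exact: inc.
split=> [h|/allP h jt js].
  by apply/allP => i; rewrite mem_iota add0n => si; apply/key => //; apply: h;
    exact: mem_nth.
rewrite -(nth_index (0%N, 0%R) js); apply/key; first by rewrite index_mem.
by apply: h; rewrite mem_iota add0n index_mem.
Qed.

Let prob_counts tau v : poisson_clock P tau -> P (counts tau v) =
  if size v == size codes then
    \prod_(n <- [fset n | n in codes]%fset)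
      poisson_prob (fine (lebesgue_measure (cell n `&` `[0%R,
        +oo[))) 0%N [set nth 0%N v (index n codes)]
  else 0.
Proof.
move=> [_ hc hi]; case: eqP => [sv|nsv]; last first.
  by rewrite (_ : counts tau v = set0) ?measure0//; apply/seteqP; split=> // w [].
have tC : trivIset setT cell by move=> i j _ _ [r [/= <- <-]].
rewrite (_ : counts tau v = \bigcap_(n in [set` [fset n | n in codes]%fset])
    [set w | point_count tau (cell n) w = (nth 0%N v (index n codes))%:R%:E]);
      last first.
  apply/seteqP; split=> w; first by move=> [_ h] n /=; rewrite !inE => /h.
  by move=> h; split=> // n nc; apply: h; rewrite /= !inE.
rewrite (hi cell measurable_cell tC); last first.
  move=> n _; exists [set (nth 0%N v (index n codes))%:R%:E];
    first exact: emeasurable_set1.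
  by rewrite setTI.
rewrite big_seq [RHS]big_seq; apply: eq_bigr => n; rewrite !inE => nc.
by rewrite hc//; exact: cell_finite.
Qed.

(** A Poisson clock is specified through counts in sets. These determine the joint laws of the
    enumerated points, because the counts of the disjoint cells are independent with known laws. *)
Lemma clock_law (tau tau' : nat -> Omega -> R) :
  (forall j, measurable_fun setT (tau j)) -> (forall j, measurable_fun setT (tau' j)) ->
  poisson_clock P tau -> poisson_clock P tau' ->
  P [set w | forall jt, jt \in s -> (tau jt.1 w <= jt.2)%R] =
  P [set w | forall jt, jt \in s -> (tau' jt.1 w <= jt.2)%R].
Proof.
move=> mt mt' ct ct'.
have main t : (forall j, measurable_fun setT (t j)) -> poisson_clock P t ->
    P [set w | forall jt, jt \in s -> (t jt.1 w <= jt.2)%R] =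
    \esum_(v in setT) (if phi v then P (counts t v) else 0).
  move=> m c; have mc j u : measurable [set w | (t j w <= u)%R].
    apply: (@mset_eq _ _ [set w | `]-oo, u]%classic (t j w)]); last by move=> w;
      rewrite /= in_itv.
    by apply: mset_clock => //; exact: measurable_itv.
  apply: prob_partition.
  - move=> v; mset; exact: mset_count.
  - move=> v v' _ _ [w [[sv hv] [sv' hv']]]; apply: (@eq_from_nth _ 0%N) => [|k];
      first by rewrite sv sv'.
    rewrite sv => kc; have nc := mem_nth 0%N kc.
    have := hv _ nc; rewrite hv'// index_uniq// => -[/eqP]; by rewrite eqr_nat => /eqP.
  - by apply: mset_all => jt; exact: mc.
  - have : {ae P, forall w, forall n : nat, exists k : nat, n \in codes ->
      point_count t (cell n) w = k%:R%:E}.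
      apply: ae_forall_countable => n; have [nc|nc] := boolP (n \in codes).
        by apply: filterS (count_finite m c (measurable_cell n) (cell_finite nc)) =>
          w [k ->]; exists k.
      by apply: aeW => w; exists 0%N.
    apply: filterS => w h; have {h} [k hk] := choice h.
    exists [seq k n | n <- codes]; split; first by rewrite size_map.
    by move=> n nc; rewrite (nth_map 0%N) ?index_mem// nth_index// hk.
  - apply: filterS (clock_increasing c) => w inc v; exact: countsP.
rewrite !main//; apply: eq_esum => v _; case: ifP => // _.
by rewrite !prob_counts.
Qed.

End ClockLaw.

(** * Simple random walks: increments, unboundedness, law *)

Section Walk.
Context (d : nat) (disp : measure_display) (Omega : measurableType disp) (R : realType)
  (P : probability Omega R).
Local Open Scope ereal_scope.

Definition is_step (e : lattice d.+1) : bool :=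
  ((\sum_(i < d.+1) `|e ord0 i|)%N == 1)%N.

Definition unit_step (ib : 'I_d.+1 * bool) : lattice d.+1 :=
  \row_j (if j == ib.1 then (-1) ^+ ib.2 else 0)%R.

Lemma unit_step_inj : injective unit_step.
Proof.
move=> [i b] [i' b'] /matrixP/(_ ord0 i); rewrite !mxE eqxx /=.
by case: eqP => [<-|_]; case: b; case: b'.
Qed.

Lemma is_step_unit ib : is_step (unit_step ib).
Proof.
rewrite /is_step (bigD1 ib.1)//= mxE eqxx big1 ?addn0 => [|j /negbTE ji];
  last by rewrite mxE ji.
by case: ib => i [].
Qed.

Lemma prod_EFin (I : Type) (J : seq I) (c : R) : \prod_(i <- J) c%:E = (c ^+ size J)%:E.
Proof. by elim: J => [|i J IH]; rewrite ?big_nil// big_cons IH -EFinM exprS. Qed.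

Section OneWalk.
Variables (z : lattice d.+1) (S : nat -> Omega -> lattice d.+1).
Hypothesis mS : forall k y, measurable [set w | S k w = y].
Hypothesis wS : simple_random_walk P z S.

Definition step k w : lattice d.+1 := (S k.+1 w - S k w)%R.

Lemma mset_step k e : measurable [set w | step k w = e].
Proof.
apply: (@mset_eq _ _ [set w | exists y,
  S k w = y /\ S k.+1 w = (e + y)%R :> lattice d.+1]); first by mset.
move=> w; rewrite /= /step; split=> [<-|[y [-> ->]]]; last by rewrite addrK.
by exists (S k w); rewrite subrK.
Qed.

(** The [2 * d.+1] unit steps carry total mass 1, so every other increment has probability 0. *)
Lemma step_prob k e : P [set w |
  step k w = e] = if is_step e then ((2 * d.+1)%:R^-1)%:E else 0.
Proof.
case: wS => _ hs _; case: ifP => [/eqP|ne]; first exact: hs.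
pose U := [set` [seq unit_step ib | ib <- enum {: 'I_d.+1 * bool}]].
have mUe : measurable [set w | U (step k w)].
  apply: (@mset_eq _ _ [set w | exists u, step k w = u /\ U u]).
    by mset; exact: mset_step.
  by move=> w; split=> [h|[u [<-]]//]; exists (step k w).
have PU : P [set w | U (step k w)] = 1.
  rewrite (_ : [set w | _] = \bigcup_ib [set w | step k w = unit_step ib]); last first.
    apply/seteqP; split=> w; first by move=> /mapP[ib _ h]; exists ib.
    by move=> [ib _ /= h]; apply/mapP; exists ib; rewrite ?mem_enum.
  rewrite measure_countable_bigcup; first last.
  - by move=> i j _ _ [w [/= -> /unit_step_inj]].
  - by move=> ib; exact: mset_step.
  rewrite (eq_esum (b := fun=> ((2 * d.+1)%:R^-1)%:E)); last first.
    by move=> ib _; apply: hs; apply/eqP; exact: is_step_unit.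
  rewrite (_ : setT = [set` enum {: 'I_d.+1 * bool}]); last by apply/seteqP; split=>
    ib //= _; rewrite mem_enum.
  rewrite esum_fin ?enum_uniq//.
  rewrite sumEFin big_const_seq count_predT iter_addr addr0 -cardE card_prod card_ord
    card_bool.
  by rewrite -[X in X%:E]mulr_natr mulnC mulVf// pnatr_eq0.
apply/eqP; rewrite eq_le measure_ge0 andbT.
apply: (@le_trans _ _ (P (~` [set w | U (step k w)]))); last first.
  by rewrite probability_setC// PU subee.
apply: le_measure; rewrite ?inE; [exact: mset_step|exact: measurableC|].
move=> w /= -> /mapP[ib _ eE]; move: ne; by rewrite eE is_step_unit.
Qed.

Lemma prob_steps (J : seq nat) (e : nat -> lattice d.+1) : uniq J ->
  P [set w | forall k, k \in J ->
    step k w = e k] = \prod_(k <- J) (if is_step (e k) then ((2 * d.+1)%:R^-1)%:E else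
    0).
Proof.
move=> uJ; case: wS => _ _ hi.
rewrite (_ : [set w | _] = \bigcap_(k in [set` [fset k | k in J]%fset]) [set w |
  step k w = e k]); last first.
  by apply/seteqP; split=> w h k; [rewrite /= !inE => /h|move=> kJ; apply: h;
    rewrite /= !inE].
rewrite hi; last by move=> k _; exists [set e k] => //; rewrite setTI.
rewrite (perm_big J)/=; last by apply: uniq_perm; rewrite ?fset_uniq// => k;
  rewrite !inE.
by apply: eq_bigr => k _; exact: step_prob.
Qed.

Lemma walk_sum : {ae P, forall w, forall k, (S k w = z + \sum_(i < k) step i w)%R}.
Proof.
case: wS => h _ _; apply: filterS h => w S0; elim=> [|k IH];
  first by rewrite big_ord0 addr0.
by rewrite big_ord_recr /= addrA -IH /step addrC subrK.
Qed.

Lemma prob_path (c : nat -> lattice d.+1) m : c 0%N = z ->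
  (forall i, (i < m)%N -> is_step (c i.+1 - c i)%R) ->
  P [set w | forall i, (i <= m)%N -> S i w = c i] = (((2 * d.+1)%:R^-1) ^+ m)%:E.
Proof.
move=> c0 cs; rewrite -[in RHS](size_iota 0 m) -prod_EFin.
rewrite [RHS]big_seq (eq_bigr (fun k =>
  if is_step (c k.+1 - c k)%R then ((2 * d.+1)%:R^-1)%:E else 0 : \bar R)); last first.
  by move=> i; rewrite mem_iota add0n => /cs ->.
rewrite -big_seq -(@prob_steps (iota 0 m) (fun k => c k.+1 - c k)%R) ?iota_uniq//.
apply: ae_measure_eq; first by mset.
  by mset; exact: mset_step.
case: wS => h _ _; apply: filterS h => w S0; split=> h.
  by move=> k; rewrite mem_iota add0n => km; rewrite /step !h// ltnW.
elim=> [|i IH] im; first by rewrite S0 c0.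
have := h i; rewrite mem_iota add0n => /(_ im); rewrite /step IH; last exact: ltnW.
by move=> /addIr.
Qed.

Let height (y : lattice d.+1) : nat := `|y ord0 ord0|%N.

Lemma walk_unbounded h : {ae P, forall w, exists k, (h <= height (S k w))%N}.
Proof.
(* From any height above [-h], a block of [h.*2.+1] upward steps leads beyond [h]. Disjoint blocks
   are independent and each consists of such steps with the same positive probability, so one of
   them almost surely does. *)
pose L := (h.*2.+1)%N; pose e0 := unit_step (ord0, false).
pose E m := [set w | forall k, k \in iota (m * L) L -> step k w = e0].
have mE m : measurable (E m) by mset; exact: mset_step.
case: (wS) => _ _ hi.
have sF k : sigma_algebra setT (sigma_rv (step k)).
  by apply: sigma_algebra_preimage; exact: sigma_algebra_measurable.
have mF k : sigma_rv (step k) `<=` measurable.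
  move=> _ [B _ <-]; rewrite setTI; apply: (@mset_eq _ _ [set w | exists u,
    step k w = u /\ B u]).
    by mset; exact: mset_step.
  by move=> w; split=> [hB|[u [<-]]//]; exists (step k w).
have pos : (0 < ((2 * d.+1)%:R^-1) ^+ L :> R)%R by rewrite exprn_gt0// invr_gt0 ltr0n.
have PE m : (((2 * d.+1)%:R^-1) ^+ L)%:E <= P (E m).
  rewrite prob_steps ?iota_uniq//; rewrite (eq_bigr (fun=>
    ((2 * d.+1)%:R^-1)%:E : \bar R)); last first.
    by move=> k _; rewrite is_step_unit.
  by rewrite prod_EFin size_iota.
have tI : trivIset setT (fun m => [set k | k \in iota (m * L) L]).
  have kL m k : k \in iota (m * L) L -> m = (k %/ L)%N.
    rewrite mem_iota => /andP[h1 h2]; apply/eqP; rewrite eqn_leq leq_divRL// h1 /=.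
    by rewrite -ltnS ltn_divLR// mulSn addnC.
  by move=> m m' _ _ [k [/= /kL-> /kL->]].
have sE m : <<s \bigcup_(k in [set k |
  k \in iota (m * L) L]) sigma_rv (step k) >> (E m).
  set G := \bigcup_(k in _) _.
  have -> : E m = \bigcap_(k in [set` iota (m * L) L]) [set w | step k w = e0].
    by apply/seteqP; split=> w hw k; exact: hw.
  apply: (@fin_bigcap_measurable _ (g_sigma_algebraType G)) => [|k kL];
    first exact: finite_seq.
  apply: sub_gen_smallest; exists k => //; exists [set e0] => //.
  by rewrite setTI.
have := independent_some sF mF hi pos tI sE PE.
move/probability0_ae => /(_ (bigcapT_measurable (fun m => measurableC (mE m)))).
apply: filterS => w nE.
have [m Em] : exists m, E m w by apply: contrapT => nm; apply: nE => m _ Em;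
  apply: nm; exists m.
apply: contrapT => nk.
have lt k : (height (S k w) < h)%N by rewrite ltnNge; apply/negP => hk; apply: nk;
  exists k.
have inc i : (i <= L)%N ->
  S (m * L + i)%N w ord0 ord0 = (S (m * L)%N w ord0 ord0 + i%:Z)%R.
  elim: i => [_|i IH iL]; first by rewrite addn0 addr0.
  have : step (m * L + i) w = e0 by apply: Em; rewrite mem_iota leq_addr ltn_add2l.
  move=> /matrixP/(_ ord0 ord0); rewrite !mxE /= addnS => /eqP; rewrite subr_eq =>
    /eqP ->.
  by rewrite IH 1?ltnW//; lia.
have := inc L (leqnn _); have := lt (m * L)%N; have := lt (m * L + L)%N.
rewrite /height /L; move: (S (m * h.*2.+1)%N w ord0 ord0) (S (m * h.*2.+1 + h.*2.+1)%N
  w ord0 ord0) => a b.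
lia.
Qed.

End OneWalk.

(** As for clocks, with the list of increments up to the last time in [s] as the countable
    observable. Positions are taken relative to the starting points, which may differ. *)
Lemma walk_law (s : seq (nat * lattice d.+1)) z z' (S S' : nat -> Omega ->
  lattice d.+1) :
  (forall k y, measurable [set w | S k w = y]) -> (forall k y, measurable [set w |
    S' k w = y]) ->
  simple_random_walk P z S -> simple_random_walk P z' S' ->
  P [set w | forall ky, ky \in s -> S ky.1 w = (z + ky.2 : lattice d.+1)%R] =
  P [set w | forall ky, ky \in s -> S' ky.1 w = (z' + ky.2 : lattice d.+1)%R].
Proof.
move=> mS mS' wS wS'.
pose M := (\max_(ky <- s) ky.1)%N.
have sM ky : ky \in s -> (ky.1 <= M)%N by move=> ks; exact: leq_bigmax_seq.
pose phi (v : seq (lattice d.+1)) := all (fun ky =>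
  (\sum_(i < ky.1) nth 0 v i)%R == ky.2) s.
pose E X v := [set w : Omega | size v = M /\ forall k, k \in iota 0 M ->
  step X k w = nth 0%R v k].
have main X x : (forall k y, measurable [set w | X k w = y]) ->
  simple_random_walk P x X ->
    P [set w | forall ky, ky \in s -> X ky.1 w = (x + ky.2 : lattice d.+1)%R] =
    \esum_(v in setT) (if phi v then P (E X v) else 0).
  move=> mX wX; apply: prob_partition.
  - by move=> v; mset; exact: mset_step.
  - move=> v v' _ _ [w [[sv hv] [sv' hv']]]; apply: (@eq_from_nth _ 0%R) => [|k];
      first by rewrite sv sv'.
    by rewrite sv => kM; rewrite -hv ?hv' ?mem_iota.
  - by apply: mset_all => ky; exact: mX.
  - apply: aeW => w; exists (mkseq (fun k => step X k w) M); split;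
      first by rewrite size_mkseq.
    by move=> k; rewrite mem_iota add0n => kM; rewrite nth_mkseq.
  - apply: filterS (walk_sum wX) => w hw v [sv hv].
    have E1 ky : ky \in s -> (\sum_(i < ky.1) step X i w = \sum_(i < ky.1) nth 0 v i)%R.
      move=> ks; apply: eq_bigr => i _; apply: hv; rewrite mem_iota add0n.
      exact: leq_trans (ltn_ord i) (sM _ ks).
    split=> [h|/allP h ky ks].
      by apply/allP => ky ks; apply/eqP; rewrite -E1//; apply: (@addrI _ x);
        rewrite -hw h.
    by rewrite hw E1//; have /eqP-> := h _ ks.
rewrite !main//; apply: eq_esum => v _; case: ifP => // _.
have PE X x : (forall k y, measurable [set w | X k w = y]) ->
  simple_random_walk P x X -> P (E X v) =
    if size v == M then \prod_(k <- iota 0 M) (if is_step (nth 0%R v k) then ((2 *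
      d.+1)%:R^-1)%:E else 0) else 0.
  move=> mX wX; case: eqP => sv.
    rewrite -(prob_steps mX wX) ?iota_uniq//; congr (P _).
    by apply/seteqP; split=> w; [move=> []|].
  by rewrite (_ : E X v = set0) ?measure0//; apply/seteqP; split=> // w [].
by rewrite !(PE _ _ mS wS) (PE _ _ mS' wS').
Qed.

End Walk.

(** * The law of the input *)

Section IndependentUnique.
Context (disp : measure_display) (T : measurableType disp) (R : realType)
  (P Q : probability T R) (I : choiceType) (F : I -> set_system T).
Local Open Scope ereal_scope.
Hypothesis sF : forall i, sigma_algebra setT (F i).
Hypothesis mF : forall i, F i `<=` measurable.

Lemma independent_unique : independent P F -> independent Q F ->
  (forall i A, F i A -> P A = Q A) ->
  forall A, <<s \bigcup_(i in setT) F i >> A -> P A = Q A.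
Proof.
move=> iP iQ PQ A sA0; have sA := sigma_cylinders sA0.
have := dynkin_class (cylindersI sF (I1 := setT)) (dynkin_eq P Q) _ sA; case=> //.
move=> _ [J [E [_ FE ->]]]; split.
  by apply: fin_bigcap_measurable => // i iJ; apply: (@mF i); exact: FE.
by rewrite iP// iQ// !big_seq; apply: eq_bigr => i iJ; rewrite (PQ i)//; exact: FE.
Qed.

End IndependentUnique.

Section Law.
Variables (d : nat) (R : realType).
Local Open Scope ereal_scope.
Notation X := (input d.+1 R).
Notation particle := (source d.+1 * nat)%type.

Lemma measurable_shift u : measurable_fun setT (@shift_input d.+1 R u).
Proof.
move=> _ A mA; rewrite setTI; apply: (preimage_sigma _ _ mA);
  first exact: sigma_algebra_measurable.
move=> _ [[z [j [B [_ mB ->]]]]|[z [j [k [y [_ ->]]]]]].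
  exact: (measurable_clock (add_source (opp_source u) z, j) mB).
apply: (@mset_eq _ _ [set x | wk x (add_source (opp_source u) z,
  j) k = (y - val u)%R :> lattice d.+1]).
  exact: measurable_wk.
by move=> x; rewrite /wk /shift_input /=; split=> [<-|->]; rewrite ?addrK ?subrK.
Qed.
HB.instance Definition _ u :=
  isMeasurableFun.Build _ _ _ _ (@shift_input d.+1 R u) (measurable_shift u).

Definition coordinate_sigma (i : clock_or_walk d.+1) : set_system X :=
  sigma_input [set i].

Lemma sigma_input_coordinates J : @sigma_input d.+1 R J `<=` <<s \bigcup_(i in J)
  coordinate_sigma i >>.
Proof.
apply: smallest_sub; first exact: smallest_sigma_algebra.
move=> A [[z [j [B [Jz mB ->]]]]|[z [j [k [y [Jz ->]]]]]]; apply: sub_gen_smallest.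
  by exists (inl z) => //; apply: sub_gen_smallest; left; exists z, j, B.
by exists (inr (z, j)) => //; apply: sub_gen_smallest; right; exists z, j, k, y.
Qed.

Definition shift_index u (i : clock_or_walk d.+1) : clock_or_walk d.+1 :=
  match i with inl z => inl (add_source u z) | inr p => inr (shift_particle u p) end.

Lemma shift_indexVK u : cancel (shift_index (opp_source u)) (shift_index u).
Proof. by move=> [z|p] /=; rewrite ?add_sourceVK ?shift_particleVK. Qed.

Lemma preimage_shift_sigma u J A : @sigma_input d.+1 R J A ->
  sigma_input (shift_index (opp_source u) @` J) (shift_input u @^-1` A).
Proof.
apply: preimage_sigma; first exact: smallest_sigma_algebra.
move=> _ [[z [j [B [Jz mB ->]]]]|[z [j [k [y [Jz ->]]]]]]; apply: sub_gen_smallest.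
  left; exists (add_source (opp_source u) z), j, B; split=> //.
  by exists (inl z).
right; exists (add_source (opp_source u) z), j, k, (y - val u)%R; split.
  by exists (inr (z, j)).
by apply/seteqP; split=> x; rewrite /preimage /shift_input /=; [move=> <-|move=> ->];
  rewrite ?addrK ?subrK.
Qed.

(** The interface between the definition of the input and the study of aggregates, which uses
    nothing else about the law. The field [law_path] provides arbitrarily late walks of a source
    following a prescribed path. *)
Record idla_law (mu : probability X R) : Prop := IdlaLaw {
  law_shift : forall u A, measurable A -> mu (shift_input u @^-1` A) = mu A;
  law_indep : forall J1 J2 A B, J1 `&` J2 = set0 ->
    sigma_input J1 A -> sigma_input J2 B -> mu (A `&` B) = mu A * mu B;
  law_ge0 : {ae mu, forall x : X, forall p, (0 <= tm x p)%R};
  law_inj : {ae mu, forall x : X, injective (tm x)};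
  law_count : forall z (n : nat),
    \esum_(j in setT) mu [set x | (tm x (z, j) <= n%:R)%R] < +oo;
  law_height : forall p h, {ae mu, forall x : X, exists k,
    (h <= `|wk x p k ord0 ord0|)%N};
  law_path : forall z (c : nat -> lattice d.+1) m, c 0%N = val z ->
    (forall i, (i < m)%N -> is_step (c i.+1 - c i)%R) ->
    {ae mu, forall x : X, forall j0, exists2 j, (j0 <= j)%N &
      forall i, (i <= m)%N -> wk x (z, j) i = c i} }.

Section FromInput.
Context (disp : measure_display) (Omega : measurableType disp) (P : probability Omega
  R).
Variables (tau : source d.+1 -> nat -> {RV P >-> R})
    (S : source d.+1 -> nat -> nat -> {RV P >-> lattice d.+1}).
Hypothesis hin : idla_input tau S.

Definition input_map w : X := (fun z j => tau z j w, fun z j k => S z j k w).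

Let mtau z j : measurable_fun setT (tau z j : Omega -> R).
Proof. exact: measurable_funPT. Qed.

Let mS z j k y : measurable [set w | S z j k w = y].
Proof.
have := @measurable_funPT _ _ _ _ (S z j k) measurableT [set y] Logic.I.
by rewrite setTI.
Qed.

Let family (i : clock_or_walk d.+1) : set_system Omega := match i with
  | inl z => sigma_process (fun j => tau z j : Omega -> R)
  | inr (z, j) => sigma_process (fun k => S z j k : Omega -> lattice d.+1) end.

Let family_measurable i : family i `<=` measurable.
Proof.
case: i => [z|[z j]]; apply: smallest_sub; try exact: sigma_algebra_measurable.
  by move=> A [k _ [B mB <-]];
    exact: (@measurable_funPT _ _ _ _ (tau z k) measurableT B mB).
by move=> A [k _ [B mB <-]];
  exact: (@measurable_funPT _ _ _ _ (S z j k) measurableT B mB).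
Qed.

Lemma preimage_coordinate i A : coordinate_sigma i A -> family i (input_map @^-1` A).
Proof.
apply: preimage_sigma; first by case: i => [z|[z j]]; exact: smallest_sigma_algebra.
move=> _ [[z [j [B [/= <- mB ->]]]]|[z [j [k [y [/= <- ->]]]]]];
  apply: sub_gen_smallest.
  by exists j => //; exists B => //; rewrite setTI.
by exists k => //; exists [set y] => //; rewrite setTI.
Qed.

Lemma measurable_input_map : measurable_fun setT input_map.
Proof.
move=> _ A mA; rewrite setTI; apply: (preimage_sigma _ _ mA);
  first exact: sigma_algebra_measurable.
move=> _ [[z [j [B [_ mB ->]]]]|[z [j [k [y [_ ->]]]]]].
  by have := mtau z j measurableT mB; rewrite setTI.
exact: mS.
Qed.
HB.instance Definition _ :=
  isMeasurableFun.Build _ _ _ _ input_map measurable_input_map.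

Definition law : probability X R := distribution P input_map.

Lemma ae_law (Q : X -> Prop) : measurable [set x | Q x] ->
  {ae P, forall w, Q (input_map w)} -> {ae law, forall x, Q x}.
Proof.
move=> mQ h; apply/(ae_measure0 _ mQ).
have := measurable_input_map measurableT (measurableC mQ); rewrite setTI => mI.
apply/(@ae_measure0 _ _ _ P (fun w => Q (input_map w))) => //.
by have := measurable_input_map measurableT mQ; rewrite setTI.
Qed.

Let sF i : sigma_algebra setT (coordinate_sigma i).
Proof. exact: smallest_sigma_algebra. Qed.
Let mF i : coordinate_sigma i `<=` measurable.
Proof. exact: sigma_input_measurable. Qed.

Lemma law_independent : independent law coordinate_sigma.
Proof.
move=> J A JA; have := input_independent hin (J := J) (A := fun i =>
  input_map @^-1` A i).
by rewrite -preimage_bigcap; apply => i /JA /preimage_coordinate.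
Qed.

Definition shifted_law u : probability X R := distribution law (@shift_input d.+1 R u).

Lemma shifted_law_independent u : independent (shifted_law u) coordinate_sigma.
Proof.
move=> J A JA.
pose s := shift_index (opp_source u).
have sK : cancel s (shift_index u) by exact: shift_indexVK.
have sI : injective s := can_inj sK.
pose A' k := shift_input u @^-1` A (shift_index u k).
have := @law_independent [fset s i | i in J]%fset A'.
rewrite (big_imfset _ _ (fun i => _ (A' i)))/=; last by move=> i j _ _ /sI.
rewrite (_ : \bigcap_(i in _) A' i = shift_input u @^-1` (\bigcap_(i in [set` J]) A
  i)); last first.
  rewrite preimage_bigcap; apply/seteqP; split=> x h i /=.
    by move=> iJ; have := h (s i); rewrite /A' sK; apply; rewrite /= in_imfset.
  by move=> /imfsetP[j /= jJ ->]; rewrite /A' sK; exact: h.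
move=> -> //.
  by rewrite big_seq [RHS]big_seq; apply: eq_bigr => i iJ; rewrite /A' sK.
move=> k /imfsetP[i /= iJ ->]; rewrite /A' sK /coordinate_sigma.
rewrite (_ : [set s i] = s @` [set i]); last by rewrite image_set1.
by apply: preimage_shift_sigma; exact: JA.
Qed.

(** Each coordinate has its own pi-system: joint upper bounds on the points of a clock, joint
    displacements of a walk from its source. There [clock_law] and [walk_law] compare two sources,
    and the pi-lambda theorem does the rest. *)
Lemma law_shift_coordinate u i A : coordinate_sigma i A -> law A = shifted_law u A.
Proof.
case: i => [z|[z j]] sA.
- pose G : set_system X := [set B | exists s : seq (nat * R), B = [set x | forall jt,
    jt \in s -> (tm x (z, jt.1) <= jt.2)%R]].
  have mG : G `<=` measurable.
    move=> _ [s ->]; apply: mset_all => jt.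
    apply: (@mset_eq _ _ [set x | `]-oo, jt.2]%classic (tm x (z, jt.1))]);
      first by apply: measurable_clock; exact: measurable_itv.
    by move=> x; rewrite /= in_itv.
  have GI : setI_closed G.
    move=> _ _ [s ->] [s' ->]; exists (s ++ s'); apply/seteqP; split=> x /=.
      by move=> [h h'] jt; rewrite mem_cat => /orP[/h|/h'].
    by move=> h; split=> jt js; apply: h; rewrite mem_cat js ?orbT.
  have sG : coordinate_sigma (inl z) `<=` <<s G >>.
    apply: smallest_sub; first exact: smallest_sigma_algebra.
    move=> _ [[z' [j [B [/= -[->] mB ->]]]]|[z' [j [k [y [] ]]]]//].
    have {mB} : (@RGenOInfty.G R).-sigma.-measurable B by rewrite
      -RGenOInfty.measurableE.
    apply: (@preimage_sigma _ _ (fun x : X => x.1 z j));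
      first exact: smallest_sigma_algebra.
    move=> _ [t ->]; rewrite (_ : _ @^-1` _ = ~` [set x : X | forall jt,
      jt \in [:: (j, t)] -> (tm x (z, jt.1) <= jt.2)%R]).
      by apply: sigma_algebraC; apply: sub_gen_smallest; exists [:: (j, t)].
    apply/seteqP; split=> x; rewrite /preimage /= in_itv/= andbT.
      by move=> lt /(_ _ (mem_head _ _)); rewrite /tm /= leNgt lt.
    move=> h; rewrite ltNge; apply/negP => le; apply: h => jt; by rewrite inE => /eqP->.
  have [] := dynkin_class GI (dynkin_eq law (shifted_law u)) _ (sG _ sA) => //.
  move=> B GB; split; first exact: mG.
  case: GB => s ->.
  exact: (clock_law s (mtau z) (mtau (add_source (opp_source u) z)) (input_clock hin
    z) (input_clock hin _)).
- pose G : set_system X := [set B | exists s : seq (nat * lattice d.+1),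
     B = [set x | forall ky, ky \in s -> wk x (z,
       j) ky.1 = (val z + ky.2 : lattice d.+1)%R]].
  have mG : G `<=` measurable.
    by move=> _ [s ->]; apply: mset_all => ky; exact: measurable_wk.
  have GI : setI_closed G.
    move=> _ _ [s ->] [s' ->]; exists (s ++ s'); apply/seteqP; split=> x /=.
      by move=> [h h'] jt; rewrite mem_cat => /orP[/h|/h'].
    by move=> h; split=> jt js; apply: h; rewrite mem_cat js ?orbT.
  have sG : coordinate_sigma (inr (z, j)) `<=` <<s G >>.
    apply: smallest_sub; first exact: smallest_sigma_algebra.
    move=> _ [[z' [j' [B [] ]]]//|[z' [j' [k [y [/= -[-> ->] ->]]]]]].
    apply: sub_gen_smallest; exists [:: (k, (y - val z)%R : lattice d.+1)].
    apply/seteqP; split=> x /=; first by move=> <- ky; rewrite inE => /eqP-> /=;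
      rewrite addrC subrK.
    by move=> /(_ _ (mem_head _ _)) /=; rewrite addrC subrK.
  have [] := dynkin_class GI (dynkin_eq law (shifted_law u)) _ (sG _ sA) => //.
  move=> B GB; split; first exact: mG.
  case: GB => s ->.
  have := walk_law s (mS z j) (mS (add_source (opp_source u) z) j) (input_walk hin z
    j) (input_walk hin _ j).
  move=> /= E; rewrite [LHS]E; congr (P _); apply/seteqP; split=> w /= h ky /h;
    rewrite /wk /shift_input /=.
    by move=> ->; rewrite addrAC subrK.
  by move=> e; apply: (@addIr _ (val u)); rewrite e addrAC subrK.
Qed.

Lemma law_shift_invariant u A : measurable A -> law (shift_input u @^-1` A) = law A.
Proof.
move=> /sigma_input_coordinates sA; apply/esym.
apply: (independent_unique sF mF law_independent (shifted_law_independent u)) => //.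
by move=> i B; exact: law_shift_coordinate.
Qed.

Lemma law_indep_groups J1 J2 A B : J1 `&` J2 = set0 ->
    sigma_input J1 A -> sigma_input J2 B -> law (A `&` B) = law A * law B.
Proof.
move=> J12 /sigma_input_coordinates sA /sigma_input_coordinates sB.
exact: (independent_groups sF mF law_independent J12).
Qed.

End FromInput.
End Law.

Section IdlaLaw.
Variables (d : nat) (R : realType).
Local Open Scope ereal_scope.
Notation X := (input d.+1 R).
Notation particle := (source d.+1 * nat)%type.
Context (disp : measure_display) (Omega : measurableType disp) (P : probability Omega
  R).
Variables (tau : source d.+1 -> nat -> {RV P >-> R})
    (S : source d.+1 -> nat -> nat -> {RV P >-> lattice d.+1}).
Hypothesis hin : idla_input tau S.

Local Notation mu := (law tau S).

Let mtau z j : measurable_fun setT (tau z j : Omega -> R).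
Proof. exact: measurable_funPT. Qed.

Let mS z j k y : measurable [set w | S z j k w = y].
Proof.
have := @measurable_funPT _ _ _ _ (S z j k) measurableT [set y] Logic.I.
by rewrite setTI.
Qed.

Let eq_le_refl (a b : \bar R) : a = b -> a <= b.
Proof. by move=> ->. Qed.

Lemma mset_tm_eq (p q : particle) : measurable [set x : X | tm x p = tm x q].
Proof.
apply: (@mset_eq _ _ [set x : X | (tm x p <= tm x q)%R /\ (tm x q <= tm x p)%R]).
  by apply: mset_and; apply: measurable_le_clock; exact: measurable_tm.
move=> x /=; split=> [->|[h1 h2]]; first by rewrite lexx.
by apply/eqP; rewrite eq_le h1 h2.
Qed.

Lemma mset_clock_hits z (B : set R) : measurable B ->
  sigma_input [set inl z] [set x : X | exists j, B (tm x (z, j))].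
Proof.
move=> mB; apply: depends_sigma.
  by mset; exact: measurable_clock.
by move=> x; rewrite /restrict_input /tm /=; rewrite asboolT.
Qed.

(* Two independent clocks both ring in one of the [n * N] intervals of length
   [1 / N] covering [0, n] with probability at most [n / N]. *)
Lemma clocks_distinct (p q : particle) : p.1 != q.1 ->
  mu [set x | tm x p = tm x q /\ (0 <= tm x p)%R] = 0.
Proof.
move=> pq.
have m0 : measurable [set x : X | (0 <= tm x p)%R].
  by apply: measurable_le_clock; [exact: measurable_cst|exact: measurable_tm].
have mn n : measurable [set x : X | (tm x p < n%:R)%R].
  by apply: measurable_lt_clock; [exact: measurable_tm|exact: measurable_cst].
have meq := mset_tm_eq p q.
have bound n N : mu [set x |
  (tm x p = tm x q /\ (0 <= tm x p)%R) /\ (tm x p < n%:R)%R] <= (n%:R / N.+1%:R)%:E.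
  pose B i : set R := `[(i%:R / N.+1%:R)%R, (i.+1%:R / N.+1%:R)%R[%classic.
  have mB i : measurable (B i) by exact: measurable_itv.
  pose H i z := [set x : X | exists j, B i (tm x (z, j))].
  have N0 : (0 < N.+1%:R :> R)%R by rewrite ltr0n.
  have PH i z : mu (H i z) <= (N.+1%:R^-1)%:E.
    apply: (count_prob0 (mtau z) (input_clock hin z) (mB i)).
    rewrite setIidl; last first.
      move=> r; rewrite /B /= !in_itv/= andbT => /andP[+ _]; apply: le_trans.
      by rewrite divr_ge0.
    rewrite lebesgue_measure_itv/= lte_fin ltr_pM2r ?invr_gt0// ltr_nat ltnSn -EFinB;
      congr (_%:E).
    by rewrite -mulrBl -natrB// subSnn mul1r.
  have mH i z : measurable (H i z) by apply: sigma_input_measurable;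
    exact: mset_clock_hits.
  pose F (i : 'I_(n * N.+1)) := H i p.1 `&` H i q.1.
  have mF i : measurable (F i) by exact: measurableI.
  apply: (@le_trans _ _ (mu (\bigcup_i F i))).
    apply: le_measure; rewrite ?inE.
    - by mset.
    - exact: countable_bigcupT_measurable.
    - move=> x /= [[e t0] tn].
      have t0' : (0 <= tm x p * N.+1%:R)%R by rewrite mulr_ge0.
      have /andP[h1 h2] := truncn_itv t0'.
      have lt : (Num.truncn (tm x p * N.+1%:R) < n * N.+1)%N.
        by rewrite -(ltr_nat R) (le_lt_trans h1)// natrM ltr_pM2r.
      exists (Ordinal lt) => //; split.
        by exists p.2; rewrite /B /= in_itv/= -surjective_pairing ler_pdivrMr// h1
          ltr_pdivlMr.
      by exists q.2; rewrite /B /= in_itv/= -surjective_pairing -e ler_pdivrMr// h1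
        ltr_pdivlMr.
  apply: le_trans (measure_countable_bigcup_le _ mF) _.
  apply: (@le_trans _ _ (\esum_(i in [set: 'I_(n * N.+1)]) (N.+1%:R^-1 *
    N.+1%:R^-1)%:E)).
    apply: le_esum => i _; rewrite EFinM.
    apply: (@le_trans _ _ (mu (H i p.1) * mu (H i q.1))).
      apply: eq_le_refl; apply: (law_indep_groups hin (J1 := [set inl p.1]) (J2 :=
        [set inl q.1])).
      - by apply/seteqP; split=> // k [/= -> []] e; rewrite e eqxx in pq.
      - exact: mset_clock_hits.
      - exact: mset_clock_hits.
    by apply: lee_pmul; rewrite ?measure_ge0//; exact: PH.
  rewrite (_ : setT = [set` enum 'I_(n * N.+1)]); last by apply/seteqP; split=>
    i //= _; rewrite mem_enum.
  rewrite esum_fin ?enum_uniq//.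
  rewrite sumEFin big_const_seq count_predT iter_addr addr0 -cardE card_ord lee_fin.
  by rewrite -[X in (X <= _)%R]mulr_natr natrM mulrACA mulVf ?gt_eqF// mulr1 mulrC.
have zero n : mu [set x |
  (tm x p = tm x q /\ (0 <= tm x p)%R) /\ (tm x p < n%:R)%R] = 0.
  apply/eqP; rewrite eq_le measure_ge0 andbT; apply/lee_addgt0Pr => e e0; rewrite add0e.
  apply: le_trans (bound n (Num.truncn (n%:R / e))) _; rewrite lee_fin.
  rewrite ler_pdivrMr ?ltr0n// mulrC -ler_pdivrMr//.
  by rewrite ltW// truncnS_gt.
apply/eqP; rewrite eq_le measure_ge0 andbT.
have mz n : measurable [set x : X |
  (tm x p = tm x q /\ (0 <= tm x p)%R) /\ (tm x p < n%:R)%R] by mset.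
rewrite -(@measure_bigcup_eq0 _ _ _ mu nat _ mz zero).
apply: le_measure; rewrite ?inE; [by mset|exact: bigcupT_measurable|].
move=> x [e t0]; exists (Num.truncn (tm x p)).+1 => //; split=> //.
by have /andP[] := truncn_itv t0.
Qed.

Lemma law_idla : idla_law mu.
Proof.
have mge p : measurable [set x : X | (0 <= tm x p)%R].
  by apply: measurable_le_clock; [exact: measurable_cst|exact: measurable_tm].
have ge0 : {ae mu, forall x : X, forall p, (0 <= tm x p)%R}.
  apply: (ae_law (Q := fun x : X => forall p, (0 <= tm x p)%R)); first by mset.
  have : {ae P, forall w, forall z j, (0 <= tau z j w)%R}.
    by apply: ae_forall_countable => z; exact: (clock_ge0 (mtau z) (input_clock hin z)).
  by apply: filterS => w h p; exact: h.
split=> //.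
- exact: law_shift_invariant.
- by move=> J1 J2 A B; exact: law_indep_groups.
- have : {ae mu, forall x : X, forall pq : particle * particle,
    tm x pq.1 = tm x pq.2 -> pq.1 = pq.2}.
    apply: ae_forall_countable => -[p q] /=; have [->|npq] := eqVneq p q;
      first exact: aeW.
    have [e1|ne1] := eqVneq p.1 q.1.
      apply: (ae_law (Q := fun x : X => tm x p = tm x q -> p = q)).
        by apply: mset_imply; [exact: mset_tm_eq|exact: mset_cst].
      apply: filterS (clock_injective (input_clock hin p.1)) => w h.
      rewrite /tm /= -e1 => /h; case: p q e1 {npq h} => [z j] [z' j'] /= -> -> //.
    have := probability0_ae _ (clocks_distinct ne1); rewrite /mkset =>
      /(_ (measurableI _ _ (mset_tm_eq p q) (mge p))).
    by apply: filterS2 ge0 => x h n e; case: n; split.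
  by apply: filterS => x h p q e; exact: (h (p, q)).
- move=> z n; apply: le_lt_trans (clock_summable (mtau z) (input_clock hin z) n%:R).
  by apply: le_esum.
- move=> p h; apply: (ae_law (Q := fun x : X => exists k,
    (h <= `|wk x p k ord0 ord0|)%N)).
    apply: (@mset_eq _ _ [set x : X | exists k, exists y,
      wk x p k = y /\ (h <= `|y ord0 ord0|)%N]).
      by mset; exact: measurable_wk.
    by move=> x; split=> [[k hk]|[k [y [<-]]]]; [exists k, (wk x p k)|exists k].
  exact: (walk_unbounded (mS p.1 p.2) (input_walk hin p.1 p.2)).
- move=> z c m c0 cs.
  pose E j := [set x : X | forall i, (i <= m)%N -> wk x (z, j) i = c i].
  have mE j : measurable (E j) by mset; exact: measurable_wk.
  have sE j : sigma_input [set inr (z, j)] (E j).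
    by apply: depends_sigma => // x; rewrite /restrict_input /E /wk /= asboolT.
  (* Starting the independent family at an arbitrary [j0] yields walks of arbitrarily large index,
     hence infinitely many of them. *)
  have : {ae mu, forall x : X, forall j0, ~ (\bigcap_j ~` E (j0 + j)%N) x}.
    apply: ae_forall_countable => j0.
    apply: probability0_ae; first by apply: bigcapT_measurable => j; exact: measurableC.
    have p0 : (0 < ((2 * d.+1)%:R^-1) ^+ m :> R)%R by rewrite exprn_gt0// invr_gt0
      ltr0n.
    have tI : trivIset setT (fun j => [set inr (z, (j0 + j)%N) : clock_or_walk d.+1]).
      by move=> j j' _ _ [i [/= -> [/addnI]]].
    apply: (independent_some (fun i => smallest_sigma_algebra _ _) (fun i =>
      @sigma_input_measurable d.+1 R _)
      (law_independent hin) p0 tI).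
      by move=> j; apply: sigma_input_coordinates; exact: sE.
    move=> j; rewrite -(prob_path (mS z (j0 + j)%N) (input_walk hin z (j0 + j)%N) c0
      cs).
    exact: lexx.
  apply: filterS => x h j0; apply: contrapT => n; apply: (h j0) => j _ Ej.
  by apply: n; exists (j0 + j)%N => //; exact: leq_addr.
Qed.

End IdlaLaw.

(** * Expected number of occupied sites in a column *)

Section MoreMeasure.
Context (disp : measure_display) (T : measurableType disp) (R : realType)
  (mu : {measure set T -> \bar R}).
Local Open Scope ereal_scope.

Lemma borel_cantelli_countable (I : countType) (F : I -> set T) :
  (forall i, measurable (F i)) -> \esum_(i in setT) mu (F i) < +oo ->
  {ae mu, forall x, finite_set [set i | F i x]}.
Proof.
move=> mF sF; have mP n := @measurable_pickle_family _ _ _ F n mF.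
have L0 : mu (lim_sup_set (pickle_family F)) = 0.
  by apply: lim_sup_set_cvg0 => //; rewrite esum_pickle.
exists (lim_sup_set (pickle_family F)); split=> //.
  by apply: bigcapT_measurable => n; exact: bigcup_measurable.
move=> x /=; apply: contra_notP => nl.
have [N hN] : exists N, forall n, (N <= n)%N -> ~ pickle_family F n x.
  apply: contrapT => /forallNP h; apply: nl => N _.
  have /existsNP[n /not_implyP[Nn /contrapT Fn]] := h N.
  by exists n.
apply: (@sub_finite_set _ _ [set` pmap (@choice.unpickle I) (iota 0 N)]);
  last exact: finite_seq.
move=> i /= Fi; rewrite mem_pmap; apply/mapP; exists (choice.pickle i);
  last by rewrite choice.pickleK.
rewrite mem_iota add0n ltnNge; apply/negP => /hN; apply.
by rewrite /pickle_family choice.pickleK_inv.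
Qed.

Lemma measure_bigcup_ae (I : countType) (F : I -> set T) :
  (forall i, measurable (F i)) -> {ae mu, forall x, forall i j, F i x -> F j x ->
    i = j} ->
  mu (\bigcup_i F i) = \esum_(i in setT) mu (F i).
Proof.
move=> mF [N [mN N0 hN]].
have nN x i j : ~ N x -> F i x -> F j x -> i = j.
  by move=> Nx Fi Fj; apply: contrapT => ij; apply: Nx; apply: hN => /= /(_ _ _ Fi Fj).
have mG i : measurable (F i `\` N) by exact: measurableD.
have aeN : {ae mu, forall x, ~ N x} by exists N; split=> // x /=; apply: contrapT.
rewrite (@ae_measure_eq _ _ _ mu _ (\bigcup_i (F i `\` N))).
- rewrite measure_countable_bigcup//.
    apply: eq_esum => i _; apply: ae_measure_eq => //.
    by apply: filterS aeN => x Nx; split=> [[]|].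
  by move=> i j _ _ [x [[Fi Nx] [Fj _]]]; exact: nN Nx Fi Fj.
- exact: countable_bigcupT_measurable.
- exact: countable_bigcupT_measurable.
- by apply: filterS aeN => x Nx; split=> -[i _]; [exists i|move=> []; exists i].
Qed.

End MoreMeasure.

Section Columns.
Variable d : nat.

(** The site at height [h] above the source 0. Letting [h] vary gives one column, which [site] moves
    to any other source. *)
Definition column (h : int) : lattice d.+1 := \row_i (if i == ord0 then h else 0).

Lemma lattice_source_subproof (y : lattice d.+1) : in_H (y - column (y ord0 ord0)).
Proof.
apply/forallP => i; apply/implyP => /eqP i0.
have -> : i = ord0 by exact: val_inj.
by rewrite !mxE eqxx subrr.
Qed.
Definition lattice_source y : source d.+1 :=
  exist (@in_H d.+1) _ (lattice_source_subproof y).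

Definition site (hu : int * source d.+1) : lattice d.+1 := column hu.1 + val hu.2.
Definition unsite (y : lattice d.+1) : int * source d.+1 := (y ord0 ord0,
  lattice_source y).

Lemma unsiteK : cancel unsite site.
Proof. by move=> y; rewrite /site /= addrC subrK. Qed.

Lemma site_height hu : site hu ord0 ord0 = hu.1.
Proof.
rewrite /site !mxE eqxx; have /forallP/(_ ord0)/implyP/(_ (eqxx _))/eqP-> := valP hu.2.
by rewrite addr0.
Qed.

Lemma siteK : cancel site unsite.
Proof.
move=> [h u]; rewrite /unsite site_height; congr pair; apply: val_inj.
by rewrite /= site_height /site /= [X in X - _]addrC addrK.
Qed.

(** The change of variables of the mass transport: the mass sent by [z] to the column of 0 is the
    mass sent by 0 to the column of [-z], and the columns together exhaust the lattice. *)
Lemma site_neg_bij : exists f : lattice d.+1 -> int * source d.+1,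
  cancel (fun hu => site (hu.1, opp_source hu.2)) f /\ cancel f (fun hu => site (hu.1,
    opp_source hu.2)).
Proof.
exists (fun y => ((unsite y).1, opp_source (unsite y).2)); split=> [[h u]|y] /=.
  by rewrite -[X in (_, opp_source X)]/((unsite _).2) -[X in (X,
    _)]/((unsite _).1) siteK /= opp_sourceK.
by rewrite opp_sourceK -[RHS]unsiteK.
Qed.

Lemma in_cylinder_source K (y : lattice d.+1) : in_cylinder K y ->
  lattice_source y \in box d K.
Proof.
rewrite mem_box => /forallP h; apply/forallP => i; apply/implyP => i0.
have := implyP (h i) i0; rewrite !mxE (_ : (i == ord0) = false) ?subr0//.
by apply/negbTE; apply: contra i0 => /eqP->.
Qed.

End Columns.

Section AlmostSure.
Variables (d : nat) (R : realType).
Local Open Scope ereal_scope.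
Notation X := (input d.+1 R).
Notation particle := (source d.+1 * nat)%type.
Variable mu : probability X R.
Hypothesis hmu : idla_law mu.

Lemma ae_regular : {ae mu, forall x : X, regular x}.
Proof.
have h : {ae mu, forall x : X, forall p : particle, forall h, exists k,
  (h <= `|wk x p k ord0 ord0|)%N}.
  by apply: ae_forall_countable => p; apply: ae_forall_countable => h;
    exact: law_height.
apply: filterS2 (law_inj hmu) h => x inj hh; split=> // p A /finite_fsetP[F AF].
have [k hk] := hh p (\max_(y <- enum_fset F) `|y ord0 ord0|).+1%N.
exists k => Ak; have kF : wk x p k \in enum_fset F by move: Ak; rewrite AF.
by have := @leq_bigmax_seq _ (enum_fset F) xpredT (fun y : lattice d.+1 =>
  `|y ord0 ord0|%N) (wk x p k) kF isT; rewrite leqNgt hk.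
Qed.

Definition intensity (n : nat) : \bar R :=
  \esum_(j in [set: nat]) mu [set x | released x setT n (source0 d.+1, j)].

Lemma released_translate z j n :
  mu [set x | released x setT n (z, j)] = mu [set x | released x setT n (source0 d.+1,
    j)].
Proof.
rewrite -(law_shift hmu z (mset_released setT n (z, j))); congr (mu _).
have E : (z, j) = shift_particle z (source0 d.+1,
  j) by rewrite /shift_particle /= add_source0.
by rewrite E; apply/seteqP; split=> x; case: (released_shift z x setT n (source0 d.+1,
  j)).
Qed.

Lemma intensityE z n : \esum_(j in [set: nat]) mu [set x | released x setT n (z,
  j)] = intensity n.
Proof. by apply: eq_esum => j _; exact: released_translate. Qed.

Lemma intensity_fin n : intensity n < +oo.
Proof.
apply: le_lt_trans (law_count hmu (source0 d.+1) n); apply: le_esum => j _.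
apply: le_measure; rewrite ?inE; first exact: mset_released.
  by apply: measurable_le_clock; [exact: measurable_tm|exact: measurable_cst].
by move=> x [_ /andP[]].
Qed.

Lemma ae_locally_finite : {ae mu, forall x : X, locally_finite x}.
Proof.
apply: ae_forall_countable => z; apply: ae_forall_countable => n.
have := @borel_cantelli_countable _ _ _ mu nat (fun j => [set x |
  released x setT n (z, j)]) (fun j => mset_released _ _ _).
rewrite intensityE => /(_ (intensity_fin n)); apply: filterS => x.
by apply: sub_finite_set => j.
Qed.

Definition occupied B n y : set X := [set x | aggregate x (released x B n) y].

Lemma measurable_occupied B n y : measurable (occupied B n y).
Proof. exact: mset_aggregate_released. Qed.

Lemma occupied_translate u B n y :
  mu (occupied (add_source u @^-1` B) n y) = mu (occupied B n (y + val u)%R).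
Proof.
rewrite -(law_shift hmu u (measurable_occupied B n (y + val u)%R)); congr (mu _).
have E (x : X) : aggregate (shift_input u x) (released (shift_input u x) B n) (y + val
  u)%R <->
    aggregate x (released x (add_source u @^-1` B) n) y.
  by rewrite -{2}(addrK (val u) y); apply: aggregate_shift => p; exact: released_shift.
by apply/seteqP; split=> x /E.
Qed.

Lemma settles_site x B n p y y' : settles (x : X) B n p y -> settles x B n p y' ->
  y = y'.
Proof. by move=> /settles_limit[_ _ ->] /settles_limit[_ _ ->]. Qed.

(* Each particle occupies at most one site. *)
Lemma mass_bound (Z : seq (source d.+1)) n : uniq Z ->
  \esum_(y in [set: lattice d.+1]) mu (occupied [set` Z] n y) <= (size Z)%:R%:E *
    intensity n.
Proof.
move=> uZ; set B := [set` Z].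
have le1 y : mu (occupied B n y) <= \esum_(p in [set: particle]) mu [set x |
  settles x B n p y].
  apply: le_trans (measure_countable_bigcup_le mu (fun p => mset_settles B n p y)).
  apply: ae_measure_le; first exact: measurable_occupied.
    by apply: countable_bigcupT_measurable => // p; exact: mset_settles.
  apply: filterS2 ae_regular ae_locally_finite => x hx lf /(finite_settles hx)[|p sp];
    last by exists p.
  apply: (@sub_finite_set _ _ (\bigcup_(z in B) ([set (z, j) | j in [set j |
    (0 <= x.1 z j <= n%:R)%R]]))).
    by move=> [z j] [Bz zj]; exists z => //; exists j.
  by apply: bigcup_finite => [|z _]; [exact: finite_seq|exact: finite_image].
apply: le_trans (le_esum (fun y _ => le1 y)) _.
rewrite esum_swap//.
apply: (@le_trans _ _ (\esum_(p in [set: particle]) if p.1 \in Z then mu [set x |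
  released x setT n p] else 0)).
  apply: le_esum => p _.
  rewrite -measure_countable_bigcup; first last.
  - by move=> y y' _ _ [x [/= s s']]; exact: settles_site s s'.
  - by move=> y; exact: mset_settles.
  have mU : measurable (\bigcup_y [set x : X | settles x B n p y]).
    by apply: countable_bigcupT_measurable => // y; exact: mset_settles.
  case: ifPn => [pZ|npZ].
    apply: le_measure; rewrite ?inE//; first exact: mset_released.
    by move=> x [y _ [[_ h] _ _]]; split.
  rewrite (_ : \bigcup_y _ = set0) ?measure0//; apply/seteqP; split=>
    // x [y _ [[/= pZ _] _ _]].
  by move: npZ; rewrite pZ.
rewrite esum_pair; last by move=> p; case: ifP.
rewrite (eq_esum (b := fun z => if z \in [set` Z] then intensity n else 0)); last first.
  move=> z _ /=; rewrite (_ : (z \in [set` Z]) = (z \in Z)); last by apply/idP/idP =>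
    [/set_mem//|]; exact: mem_set.
  by case: ifP => _; [exact: intensityE|rewrite esum1].
have i0 : 0 <= intensity n by exact: esum_ge0.
rewrite -esum_mkcond esum_fin// big_const_seq count_predT.
suff -> : iter (size Z) (+%R (intensity n)) 0 = (size Z)%:R%:E * intensity n by [].
elim: (size Z) => [|k IH]; first by rewrite mul0e.
by rewrite iterS IH -addn1 natrD EFinD ge0_muleDl ?lee_fin// mul1e addeC.
Qed.

End AlmostSure.

Lemma esum_const (R : realType) (I : choiceType) (s : seq I) (a : \bar R) : uniq s ->
  (0 <= a)%E ->
  (\esum_(i in [set` s]) a = (size s)%:R%:E * a)%E.
Proof.
move=> us a0; rewrite esum_fin// big_const_seq count_predT.
elim: (size s) => [|k IH]; first by rewrite mul0e.
by rewrite iterS IH -addn1 natrD EFinD ge0_muleDl ?lee_fin// mul1e addeC.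
Qed.

Section ColumnMass.
Variables (d : nat) (R : realType).
Local Open Scope ereal_scope.
Notation X := (input d.+1 R).
Notation particle := (source d.+1 * nat)%type.
Variable mu : probability X R.
Hypothesis hmu : idla_law mu.
Variable n : nat.

Let int0 : 0 <= intensity mu n.
Proof. exact: esum_ge0. Qed.
Let intfin : intensity mu n \is a fin_num.
Proof. by rewrite ge0_fin_numE//; exact: intensity_fin. Qed.

(** The expected number of sites above the source 0 occupied by particles of [B]. *)
Definition column_mass (B : set (source d.+1)) : \bar R :=
  \esum_(h in [set: int]) mu (occupied B n (column d h)).

Let cm0 B : 0 <= column_mass B.
Proof. exact: esum_ge0. Qed.

Lemma occupied_subset B B' y : B `<=` B' -> mu (occupied B n y) <= mu (occupied B' n y).
Proof.
move=> BB'; apply: le_measure; rewrite ?inE; try exact: measurable_occupied.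
by move=> x; apply: aggregate_subset => p [Bp h]; split=> //; exact: BB'.
Qed.

(* The boxes of radius N around the sources of a box of radius L lie in the box
   of radius L + N. *)
Lemma box_mass N L : (size (box d L))%:R%:E * column_mass [set` box d N] <=
  (size (box d (L + N)))%:R%:E * intensity mu n.
Proof.
apply: le_trans (mass_bound hmu n (box_uniq d (L + N))).
rewrite (esum_bij _ (@siteK d) (@unsiteK d)) esum_pair// esum_swap// -(esum_const
  (box_uniq d L))//.
apply: (@le_trans _ _ (\esum_(u in [set` box d L]) \esum_(h in [set: int])
    mu (occupied [set` box d (L + N)] n (site (h, u))))); last first.
  by apply: esum_subset => // u; exact: esum_ge0.
apply: le_esum => u uL; apply: le_esum => h _; rewrite /site /=.
rewrite -(occupied_translate hmu); apply: occupied_subset => z /=.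
move: uL => /=; rewrite !mem_box => /forallP hu /forallP hz; apply/forallP => i.
apply/implyP => i0; rewrite !mxE; have := implyP (hu i) i0; have := implyP (hz i) i0.
move: (val z ord0 i) (val u ord0 i) => a b; lia.
Qed.

Lemma box_column_mass N : column_mass [set` box d N] <= intensity mu n.
Proof.
have cfin : column_mass [set` box d N] \is a fin_num.
  rewrite ge0_fin_numE//; apply: (@le_lt_trans _ _ ((size (box d (0 + N)))%:R%:E *
    intensity mu n)).
    by apply: le_trans (box_mass N 0); rewrite size_box exp1n mul1e.
  by rewrite ltey_eq fin_numM ?orbT.
rewrite -(fineK cfin) -(fineK intfin) lee_fin.
set c := fine _; set l := fine (intensity mu n).
have l0 : (0 <= l)%R by rewrite fine_ge0.
(* The ratio of the side lengths of the boxes of radii [L + N] and [L] is [1 + 2N / (2L + 1)],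
   bounded here with [harmonic L = 1 / (L + 1)]. It tends to 1 as [L] grows with [N] fixed. *)
have bound L : (c <= l * (1 + N.*2%:R * harmonic L) ^+ d)%R.
  have := box_mass N L; rewrite -(fineK cfin) -(fineK intfin) -!EFinM lee_fin -/c -/l
    !size_box.
  rewrite !natrX => h; have L0 : (0 < L.*2.+1%:R :> R)%R by rewrite ltr0n.
  have key : ((L + N).*2.+1%:R <= L.*2.+1%:R * (1 + N.*2%:R * harmonic L) :> R)%R.
    rewrite mulrDr mulr1 doubleD -addSn natrD lerD2l mulrCA ler_peMr//.
    by rewrite /harmonic /= -ler_pdivrMr ?invr_gt0 ?ltr0n// invrK mul1r ler_nat; lia.
  rewrite -(ler_pM2l (exprn_gt0 d L0)) (le_trans h)// mulrCA [X in (X <= _)%R]mulrC.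
  by rewrite ler_wpM2l// -exprMn lerXn2r ?nnegrE// (le_trans _ key).
have cv : (l * (1 + N.*2%:R * harmonic L) ^+ d)%R @[L --> \oo] --> l.
  rewrite -[X in _ --> X]mulr1; apply: cvgMl_tmp.
  have h1 : (1 + N.*2%:R * harmonic L)%R @[L --> \oo] --> (1 : R)%R.
    rewrite -[X in _ --> X]addr0; apply: cvgD; first exact: cvg_cst.
    rewrite -[X in _ --> X](mulr0 (N.*2%:R)); apply: cvgMl_tmp; exact: cvg_harmonic.
  rewrite -[X in _ --> X](expr1n _ d).
  exact: (cvg_comp _ _ h1 (@exprn_continuous R d 1%R)).
rewrite -(cvg_lim _ cv)//; apply: limr_ge; first by apply/cvg_ex; exists l.
exact: nearW.
Qed.

Lemma occupied_box_cvg y : mu (occupied [set` box d N] n y) @[N --> \oo] -->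
  mu (occupied setT n y).
Proof.
have -> : occupied setT n y = \bigcup_N (occupied [set` box d N] n y : set X).
  apply/seteqP; split=> x; last by move=> [N _]; apply: aggregate_subset => p [_].
  move=> [Q QD h]; have [N hN] := box_total_seq (map fst Q).
  exists N => //; exists Q => // p pQ; have [_ ?] := QD _ pQ; split=> //=.
  by apply: hN; exact: map_f.
apply: (nondecreasing_cvg_mu (F := fun N => occupied [set` box d N] n y)).
- by move=> N; exact: measurable_occupied.
- by apply: bigcupT_measurable => N; exact: measurable_occupied.
- move=> N M NM; apply/subsetPset => x; apply: aggregate_subset => p [/= h ?]; split=>
    //=.
  exact: (box_subset NM h).
Qed.

(** Partial sums over finitely many heights are bounded by [box_column_mass] uniformly in [N], and
    the limit in [N] is taken at each site. *)
Lemma column_mass_le : column_mass setT <= intensity mu n.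
Proof.
apply: esum_seq_le => s us _.
have cv : \sum_(h <- s) mu (occupied [set` box d N] n (column d h)) @[N --> \oo] -->
    \sum_(h <- s) mu (occupied setT n (column d h)).
  apply: cvg_nnesum => h _; first by apply: nearW.
  exact: occupied_box_cvg.
rewrite -(cvg_lim _ cv)//; apply: lime_le; first by apply/cvg_ex; eexists; exact: cv.
apply: nearW => N; apply: le_trans (box_column_mass N).
by rewrite -esum_fin//; apply: esum_subset.
Qed.

Lemma occupied_column h u : mu (occupied setT n (site (h,
  u))) = mu (occupied setT n (column d h)).
Proof. by rewrite /site /= -(occupied_translate hmu). Qed.

(** By Borel-Cantelli, a finite expected number of occupied sites leaves finitely many in each
    column; a cylinder is a finite union of columns. *)
Lemma ae_column_finite : {ae mu, forall x : X, forall K,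
  finite_set (aggregate x (released x setT n) `&` [set y | in_cylinder K y])}.
Proof.
have : {ae mu, forall x : X, forall u, finite_set [set h | occupied setT n (site (h,
  u)) x]}.
  apply: ae_forall_countable => u; apply: borel_cantelli_countable => [h|].
    exact: measurable_occupied.
  rewrite (eq_esum (b := fun h => mu (occupied setT n (column d h)))); last by move=>
    h _; exact: occupied_column.
  exact: le_lt_trans column_mass_le (intensity_fin hmu n).
apply: filterS => x hx K.
apply: (@sub_finite_set _ _ (\bigcup_(u in [set` box d K]) [set site (h, u) |
  h in [set h | occupied setT n (site (h, u)) x]])).
  move=> y [ay yK]; exists (lattice_source y); first exact: in_cylinder_source.
  exists (y ord0 ord0); last exact: (unsiteK y).
  by rewrite /= /occupied /= -[site _]/(site (unsite y)) unsiteK.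
by apply: bigcup_finite => [|u _]; [exact: finite_seq|exact: finite_image].
Qed.

End ColumnMass.

(** * Escape from the limiting aggregate *)

Section RunCongr.
Variables (d : nat) (R : realType).
Notation particle := (source d * nat)%type.

Lemma run_congr (x y : input d R) Q : tm x = tm y ->
  (forall q, q \in Q -> wk x q = wk y q) -> run x Q = run y Q.
Proof.
move=> t w; rewrite /run /schedule.
have -> : release x = release y by rewrite /release t.
set l := sort _ _; have : forall q, q \in l -> wk x q = wk y q.
  by move=> q; rewrite mem_sort mem_undup; exact: w.
move: (empty_graph d); elim: l => //= p l IH G h; rewrite h ?mem_head// IH// => q ql.
by apply: h; rewrite inE ql orbT.
Qed.

End RunCongr.

Section Escape.
Variables (d : nat) (R : realType).
Local Open Scope ereal_scope.
Notation X := (input d.+1 R).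
Notation particle := (source d.+1 * nat)%type.
Variable mu : probability X R.
Hypothesis hmu : idla_law mu.
Variable n : nat.

(* The walk of [p] is independent of the aggregate of the other particles. *)
Definition others (x : X) (p : particle) : set particle := [set q |
  released x setT n q /\ q != p].

Lemma mset_others p q : measurable [set x : X | others x p q].
Proof. by apply: mset_and; [exact: mset_released|exact: mset_cst]. Qed.

(** Erasing the walk of [p] changes neither the release times, that of [p] included, nor the walks
    of the other particles. *)
Lemma others_sigma p y : sigma_input (~` [set inr p]) [set x : X |
  aggregate x (others x p) y].
Proof.
apply: depends_sigma; first by apply: mset_aggregate => q; exact: mset_others.
move=> x; set x' := restrict_input _ x.
have t : tm x' = tm x by apply/funext => q; rewrite /tm /x' /restrict_input /= asboolT.
have E q : others x' p q <-> others x p q by rewrite /others /released /= t.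
have run_eq Q : (forall q, q \in Q -> q != p) -> run x' Q = run x Q.
  move=> hQ; apply: run_congr => // q /hQ qp; apply/funext => k.
  rewrite /wk /x' /restrict_input /= asboolT//= => -[] e; move/eqP : qp; apply.
  by rewrite -e; exact: surjective_pairing.
split=> -[Q QD h]; have QD' q : q \in Q -> q != p by (move=> /QD[]).
  by exists Q => [q /QD/E//|]; rewrite -run_eq.
by exists Q => [q /QD hq|]; [apply/E|rewrite run_eq].
Qed.

(** For [y] at height at least [H], this says that the walk first reaches such a height at time [k],
    in [y]. Quantifying over the intermediate sites [y'] turns the event into a countable
    formula. *)
Definition first_height (p : particle) (H k : nat) (y : lattice d.+1) : set X :=
  [set x | wk x p k = y /\ forall i, (i < k)%N -> exists y',
    wk x p i = y' /\ (`|y' ord0 ord0| < H)%N].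

Lemma measurable_first_height p H k y : measurable (first_height p H k y).
Proof. by rewrite /first_height; mset; exact: measurable_wk. Qed.

Lemma first_height_sigma p H k y : sigma_input [set inr p] (first_height p H k y).
Proof.
apply: depends_sigma; first exact: measurable_first_height.
have hp : ([set inr p] : set (clock_or_walk d.+1)) (inr (p.1, p.2)) by case: (p).
by move=> x; rewrite /first_height /wk /= /restrict_input /= asboolT.
Qed.

(* Infinitely many sites of a column with probability above [e] would contradict
   the finite expected number of occupied sites of the column. *)
Lemma column_small (e : R) : (0 < e)%R -> exists H : nat, forall y : lattice d.+1,
  (H <= `|y ord0 ord0|)%N -> mu (occupied setT n y) <= e%:E.
Proof.
move=> e0; pose big h := e%:E < mu (occupied setT n (column d h)).
have : finite_set [set h | big h].
  apply: contrapT => inf.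
  have [k hk] : exists k : nat, intensity mu n < (k%:R * e)%:E.
    have fin : intensity mu n \is a fin_num by rewrite ge0_fin_numE ?(intensity_fin
      hmu)//; exact: esum_ge0.
    exists (Num.truncn (fine (intensity mu n) / e)).+1;
      rewrite -(fineK fin) lte_fin -ltr_pdivrMr//.
    exact: truncnS_gt.
  have [F FS Fk] := infinite_set_fset k inf.
  have : (k%:R * e)%:E <= intensity mu n.
    apply: le_trans (column_mass_le hmu n).
    apply: (@le_trans _ _ (\esum_(h in [set` F]) mu (occupied setT n (column d h)))).
      apply: (@le_trans _ _ (\esum_(h in [set` enum_fset F]) e%:E)).
        have e0' : 0 <= e%:E by rewrite lee_fin ltW.
        rewrite (esum_const (fset_uniq F) e0') -EFinM lee_fin.
        by rewrite ler_wpM2r ?(ltW e0)// ler_nat.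
      by apply: le_esum => h hF; apply: ltW; exact: FS.
    exact: esum_subset.
  by rewrite leNgt hk.
move=> /finite_fsetP[F FE]; exists (\max_(h <- enum_fset F) `|h|%N).+1 => y hy.
rewrite -(unsiteK y) (occupied_column hmu) /=.
rewrite leNgt; apply/negP => bg.
have yF : y ord0 ord0 \in enum_fset F by have : [set h | big h] (y ord0 ord0) by [];
  rewrite FE.
have := @leq_bigmax_seq _ (enum_fset F) xpredT (fun h : int =>
  `|h|%N) (y ord0 ord0) yF isT.
by rewrite leqNgt hy.
Qed.

Lemma others_occupied p y : mu [set x |
  aggregate x (others x p) y] <= mu (occupied setT n y).
Proof.
apply: le_measure; rewrite ?inE.
- by apply: mset_aggregate => q; exact: mset_others.
- exact: measurable_occupied.
- by move=> x; apply: aggregate_subset => q [].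
Qed.

Definition trapped p : set X :=
  [set x | released x setT n p /\ forall k, aggregate x (earlier x setT p) (wk x p k)].

Lemma measurable_trapped p : measurable (trapped p).
Proof.
have mW k y := @measurable_wk d.+1 R p k y.
have mA y := @mset_aggregate_earlier d.+1 R setT p y.
by apply: mset_and; [exact: mset_released|apply: mset_forall => k;
  exact: (mset_at k mA mW)].
Qed.

(** At its first passage above height [H], a trapped walk stands in the aggregate of the other
    particles. The passage time and site depend on the walk alone, so for each of their values this
    aggregate contains the site with probability at most [e], by [column_small]. Summing over the
    disjoint passages leaves at most [e]. *)
Lemma trapped0 p : mu (trapped p) = 0.
Proof.
apply/eqP; rewrite eq_le measure_ge0 andbT; apply/lee_addgt0Pr => e e0; rewrite add0e.
have [H hH] := column_small e0.
pose F (ky : nat * lattice d.+1) : set X :=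
  if (H <= `|ky.2 ord0 ord0|)%N then first_height p H ky.1 ky.2 else set0.
have mF ky : measurable (F ky) by rewrite /F; case: ifP => // _;
  exact: measurable_first_height.
have tF : trivIset setT F.
  move=> [k y] [k' y'] _ _ [x [/=]]; rewrite /F /=; case: ifP => // Hy [ky ly];
    case: ifP => // Hy' [ky' ly'].
  suff kk : k = k' by rewrite kk -ky kk ky'.
  have [kk|kk|//] := ltngtP k k'.
    by have [z [kz zH]] := ly' _ kk; rewrite -kz ky ltnNge Hy in zH.
  by have [z [kz zH]] := ly _ kk; rewrite -kz ky' ltnNge Hy' in zH.
pose A (ky : nat * lattice d.+1) : set X := [set x | aggregate x (others x p) ky.2].
have mA ky : measurable (A ky) by apply: mset_aggregate => q; exact: mset_others.
have mFA ky : measurable (F ky `&` A ky) by exact: measurableI.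
apply: (@le_trans _ _ (mu (\bigcup_ky (F ky `&` A ky)))).
  apply: ae_measure_le; [exact: measurable_trapped|exact:
    countable_bigcupT_measurable|].
  apply: filterS (law_height hmu p H) => x ex [rp tr].
  have [k kH kmin] : exists2 k, (H <= `|wk x p k ord0 ord0|)%N & forall i,
    (i < k)%N -> (`|wk x p i ord0 ord0| < H)%N.
    exists (ex_minn ex); first by case: ex_minnP.
    by case: ex_minnP => k kH kmin i; rewrite !ltnNge; apply: contra => /kmin.
  exists (k, wk x p k) => //; split.
    by rewrite /F /= kH; split=> // i /kmin ik; exists (wk x p i).
  have := tr k; apply: aggregate_subset => q eq; split.
    by apply: earlier_released eq; case: rp => _ /andP[].
  by case: eq => _ /andP[_ qp]; apply: contraTneq qp => ->; rewrite ltxx.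
apply: le_trans (measure_countable_bigcup_le _ mFA) _.
apply: (@le_trans _ _ (\esum_(ky in [set: nat * lattice d.+1]) (e%:E * mu (F ky)))).
  apply: le_esum => ky _; rewrite /F; case: ifP => [Hy|_];
    last by rewrite set0I !measure0 mule0.
  apply: (@le_trans _ _ (mu (first_height p H ky.1 ky.2) * mu (A ky))).
    have E : mu (first_height p H ky.1 ky.2 `&` A ky) = mu (first_height p H ky.1
      ky.2) * mu (A ky).
      apply: (law_indep hmu (J1 := [set inr p]) (J2 := ~` [set inr p])).
      - exact: setICr.
      - exact: first_height_sigma.
      - exact: others_sigma.
    by rewrite -E; exact: lexx.
  rewrite muleC; apply: lee_wpmul2r => //.
  exact: le_trans (others_occupied _ _) (hH _ Hy).
apply: esum_seq_le => s us _; rewrite -ge0_sume_distrr//.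
apply: (@le_trans _ _ (e%:E * 1)); last by rewrite mule1.
apply: lee_wpmul2l; first by rewrite lee_fin ltW.
rewrite -esum_fin//.
apply: (@le_trans _ _ (\esum_(ky in [set: nat * lattice d.+1]) mu (F ky)));
  first exact: esum_subset.
by rewrite -measure_countable_bigcup// probability_le1//;
  exact: countable_bigcupT_measurable.
Qed.

Lemma ae_escape : {ae mu, forall x : X, forall p, released x setT n p ->
  exists k, ~ aggregate x (earlier x setT p) (wk x p k)}.
Proof.
apply: ae_forall_countable => p; have :=
  probability0_ae (measurable_trapped p) (trapped0 p).
by apply: filterS => x nt rp; apply: contrapT => /forallNP h; apply: nt; split=> // k;
  apply: contrapT; exact: h.
Qed.

(* Mass transport: a column is settled by [intensity] limit positions on average,
   which is already the largest possible expected number of occupied sites. *)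
Lemma ae_settles_column h : {ae mu, forall x : X,
  aggregate x (released x setT n) (column d h) -> exists p,
    settles x setT n p (column d h)}.
Proof.
pose M p y : set X := [set x | settles x setT n p y].
have mM p y : measurable (M p y) by exact: mset_settles.
have mU y : measurable (\bigcup_p M p y) by apply: countable_bigcupT_measurable =>
  [|p]; [exact: countableP|exact: mM].
have transM z j y : mu (M (z, j) (y + val z)%R) = mu (M (source0 d.+1, j) y).
  rewrite -(law_shift hmu z (mM (z, j) (y + val z)%R)); congr (mu _).
  have E : (z, j) = shift_particle z (source0 d.+1,
    j) by rewrite /shift_particle /= add_source0.
  rewrite E -{2}(addrK (val z) y).
  by apply/seteqP; split=> x; case: (settles_shift z x setT n (source0 d.+1,
    j) (y + val z)%R).
have total p : \esum_(y in [set: lattice d.+1]) mu (M p y) = mu [set x |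
  released x setT n p].
  rewrite -measure_countable_bigcup//; last by move=> y y' _ _ [x [/= s s']];
    exact: settles_site s s'.
  apply: ae_measure_eq; [exact: countable_bigcupT_measurable|exact: mset_released|].
  apply: filterS ae_escape => x esc; split=> [[y _ []]//|rp].
  by exists (wk x p (limit_exit x setT p)) => //; apply: limit_settles => //;
    exact: esc.
have colsum : \esum_(h in [set: int]) mu (\bigcup_p M p (column d h)) = intensity mu n.
  rewrite (eq_esum (b := fun h =>
    \esum_(p in [set: particle]) mu (M p (column d h)))); last first.
    move=> h' _; apply: measure_bigcup_ae => //.
    by apply: filterS (ae_regular hmu) => x hx p q; exact: settles_inj.
  (* Translating by [-z] brings the emitting source to 0. Once the sums over heights and sources are
     combined, the positions of a single particle of source 0 run over the whole lattice. *)
  rewrite (eq_esum (b := fun h =>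
    \esum_(j in [set: nat]) \esum_(z in [set: source d.+1]) mu (M (source0 d.+1,
    j) (site (h, opp_source z))))); last first.
    move=> h' _; rewrite esum_pair// esum_swap//; apply: eq_esum => j _;
      apply: eq_esum => z _.
    by rewrite -(transM z) /site /= subrK.
  rewrite esum_swap; last by move=> *; exact: esum_ge0.
  apply: eq_esum => j _; rewrite -total.
  have [f [f1 f2]] := site_neg_bij d.
  by rewrite (esum_bij _ f1 f2) esum_pair.
have le h' : mu (\bigcup_p M p (column d h')) <= mu (occupied setT n (column d h')).
  apply: ae_measure_le => //; first exact: measurable_occupied.
  by apply: filterS (ae_regular hmu) => x hx [p _]; exact: settles_aggregate.
have mass : \esum_(h' in [set: int]) mu (occupied setT n (column d h')) <=
    \esum_(h' in [set: int]) mu (\bigcup_p M p (column d h')).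
  by rewrite colsum; exact: column_mass_le.
have E := esum_eq (fun h' => measure_ge0 mu _) le mass.
rewrite colsum (intensity_fin hmu) in E.
have {}E : mu (\bigcup_p M p (column d h)) = mu (occupied setT n (column d h)) by
  exact: E.
have mO := @measurable_occupied d R setT n (column d h).
set O := occupied setT n (column d h) in E mO *; set U :=
  \bigcup_p M p (column d h) in E *.
have mUh : measurable U by exact: mU.
have EI : mu (O `&` U) = mu O.
  rewrite -E; apply: ae_measure_eq => //; first exact: measurableI.
  apply: filterS (ae_regular hmu) => x hx; split=> [[]//|[p _ Mp]]; split;
    last by exists p.
  exact: settles_aggregate Mp.
have D0 : mu (O `\` U) = 0.
  have D : mu (O `\` U) = mu O - mu (O `&` U) by rewrite measureD// ltey_eq
    fin_num_measure// orbT.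
  by rewrite D EI subee// fin_num_measure.
have := probability0_ae (measurableD mO mUh) D0; apply: filterS => x nD ag.
apply: contrapT => ns; apply: nD; split=> // -[p _ Mp]; by apply: ns; exists p.
Qed.

Lemma ae_settles : {ae mu, forall x : X, forall y,
  aggregate x (released x setT n) y -> exists p, settles x setT n p y}.
Proof.
apply: ae_forall_countable => y; rewrite -(unsiteK y); case: (unsite y) => h u {y}.
pose Bad y : set X := [set x | aggregate x (released x setT n) y /\ forall p,
  ~ settles x setT n p y].
have mBad y : measurable (Bad y).
  apply: mset_and; first exact: mset_aggregate_released.
  by apply: mset_forall => p; apply: mset_not; exact: mset_settles.
have Bad0 : mu (Bad (column d h)) = 0.
  apply/eqP; rewrite eq_le measure_ge0 andbT -(measure0 mu).
  apply: ae_measure_le => //; apply: filterS (ae_settles_column h) => x hx [ag np].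
  by have [p sp] := hx ag; exact: np sp.
have : mu (Bad (site (h, u))) = 0.
  rewrite -Bad0 -(law_shift hmu u (mBad (site (h, u)))); congr (mu _).
  have EA x : aggregate (shift_input u x) (released (shift_input u x) setT n) (site
    (h, u)) <->
      aggregate (x : X) (released x setT n) (column d h).
    rewrite -[X in _ <-> aggregate _ _ X](addrK (val u)).
    by apply: aggregate_shift => p; exact: (released_shift u x setT n p).
  have ES x p : settles (shift_input u x) setT n (shift_particle u p) (site (h,
    u)) <-> settles (x : X) setT n p (column d h).
    by rewrite -[X in _ <-> settles _ _ _ _ X](addrK (val u)); exact: settles_shift.
  apply/seteqP; split=> x [ag np]; (split; [exact/EA|]) => p sp.
    by apply: (np (shift_particle u p)); apply/ES.
  by apply: (np (shift_particle (opp_source u) p)); apply/ES; rewrite shift_particleVK.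
move=> /(probability0_ae (mBad _)); apply: filterS => x nb ag.
by apply: contrapT => ns; apply: nb; split=> // p sp; apply: ns; exists p.
Qed.

End Escape.

Section Stable.
Variables (d : nat) (R : realType) (mu : probability (input d.+1 R) R).
Hypothesis hmu : idla_law mu.

Lemma ae_stable : {ae mu, forall x : input d.+1 R, stable x}.
Proof.
have h1 : {ae mu, forall x : input d.+1 R, forall n K,
  finite_set (aggregate x (released x setT n) `&` [set y | in_cylinder K y])}.
  by apply: ae_forall_countable => n; exact: ae_column_finite.
have h2 : {ae mu, forall x : input d.+1 R, forall n p, released x setT n p ->
    exists k, ~ aggregate x (earlier x setT p) (wk x p k)}.
  by apply: ae_forall_countable => n; exact: ae_escape.
have h3 : {ae mu, forall x : input d.+1 R, forall n y,
  aggregate x (released x setT n) y ->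
    exists p, settles x setT n p y}.
  by apply: ae_forall_countable => n; exact: ae_settles.
by apply: filterS3 (filterI (ae_regular hmu) (ae_locally_finite hmu)) h1 (filterI h2
  h3) => x [? ?] ? [? ?].
Qed.

End Stable.

(** * Mixing *)

Section Mixing.
Variables (d : nat) (R : realType).
Notation X := (input d.+1 R).
Variable mu : probability X R.
Hypothesis hmu : idla_law mu.

Local Notation m A := (fine (mu A)).

Lemma mfin (A : set X) : measurable A -> mu A = (m A)%:E.
Proof. by move=> mA; rewrite fineK// fin_num_measure. Qed.

Lemma fine_measure_setU (A B : set X) : measurable A -> measurable B ->
  A `&` B = set0 ->
  m (A `|` B) = m A + m B.
Proof.
move=> mA mB AB; rewrite measureU//; by rewrite fineD// fin_num_measure.
Qed.

Lemma fine_measure_le (A B : set X) : measurable A -> measurable B -> A `<=` B ->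
  m A <= m B.
Proof.
move=> mA mB AB; rewrite fine_le ?fin_num_measure//.
by apply: le_measure; rewrite ?inE.
Qed.

(* Domination by [mu] makes the tails of countable disjoint unions small
   uniformly in the translation, so that limits pass to such unions. *)
Definition dominated (nu : set X -> R) : Prop :=
  (forall A B, measurable A -> measurable B -> A `&` B = set0 ->
    nu (A `|` B) = nu A + nu B) /\
  (forall A, measurable A -> 0 <= nu A <= m A).

Definition converges (nu : source d.+1 -> set X -> R) (nu0 : set X ->
  R) (A : set X) : Prop :=
  forall e : R, 0 < e -> exists N : nat, forall k, (N <= sup_norm (val k))%N ->
    `|nu k A - nu0 A| <= e.

Lemma dominated_diff nu A B : dominated nu -> measurable A -> measurable B ->
  B `<=` A ->
  nu A = nu B + nu (A `\` B).
Proof.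
move=> [add _] mA mB BA; rewrite -add//; [by rewrite setDUK|exact: measurableD|].
by rewrite setDIK.
Qed.

(** Complements and finite disjoint unions follow from additivity. For a countable union, finitely
    many terms are treated as a finite union and the remainder is controlled by [mu], uniformly in
    [k]. *)
Lemma dynkin_converges nu nu0 : (forall k, dominated (nu k)) -> dominated nu0 ->
  converges nu nu0 setT -> dynkin [set A | measurable A /\ converges nu nu0 A].
Proof.
move=> dnu dnu0 cT; split=> //.
- move=> A [mA cA]; split; first exact: measurableC.
  move=> e e0; have e20 : 0 < e / 2 by rewrite divr_gt0.
  have [N1 h1] := cT _ e20; have [N2 h2] := cA _ e20.
  exists (maxn N1 N2) => k; rewrite geq_max => /andP[/h1 {}h1 /h2 {}h2].
  have E nu' : dominated nu' -> nu' (~` A) = nu' setT - nu' A.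
    by move=> dn; rewrite (dominated_diff dn measurableT mA)// setTD addrAC subrr add0r.
  rewrite !E//.
  by move: h1 h2; rewrite !ler_norml => /andP[? ?] /andP[? ?]; apply/andP; split; lra.
- move=> F tF hF; have mF i : measurable (F i) by case: (hF i).
  have mU : measurable (\bigcup_i F i) by exact: bigcupT_measurable.
  split=> //.
  pose G M := \bigcup_(i < M) F i.
  have mG M : measurable (G M) by apply: bigcup_measurable => i _.
  have GS M : G M.+1 = G M `|` F M.
    rewrite /G; apply/seteqP; split=> x.
      move=> [i /=]; rewrite ltnS leq_eqVlt => /predU1P[->|iM] Fx; [by right|by left;
        exists i].
    by move=> [[i /= iM Fx]|Fx]; [exists i => //=; exact: ltnW|exists M => //=].
  have GF M : G M `&` F M = set0.
    apply/seteqP; split=> // x [[i /= iM Fi] FM].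
    have e : i = M by apply: (tF i M Logic.I Logic.I); exists x.
    by rewrite e ltnn in iM.
  have cG M : converges nu nu0 (G M).
    elim: M => [|M IH].
      have G0 : G 0%N = set0 by apply/seteqP; split=> // x [].
      have Z nu' : dominated nu' -> nu' set0 = 0.
        by move=> [add _]; have :=
          add _ _ (@measurable0 _ X) (@measurable0 _ X) (setI0 _); rewrite setU0; lra.
      by move=> e e0; exists 0%N => k _; rewrite G0 !Z// subrr normr0 ltW.
    move=> e e0; have e20 : 0 < e / 2 by rewrite divr_gt0.
    have [_ cF] := hF M; have [N1 h1] := IH _ e20; have [N2 h2] := cF _ e20.
    exists (maxn N1 N2) => k; rewrite geq_max => /andP[/h1 {}h1 /h2 {}h2].
    rewrite GS (proj1 (dnu k))// (proj1 dnu0)//.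
    by move: h1 h2; rewrite !ler_norml => /andP[? ?] /andP[? ?]; apply/andP; split; lra.
  move=> e e0; have e40 : 0 < e / 4 by rewrite divr_gt0.
  have UG : \bigcup_i F i = \bigcup_M G M.
    apply/seteqP; split=> x; first by move=> [i _ Fx]; exists i.+1 => //; exists i =>
      /=.
    by move=> [M _ [i _ Fx]]; exists i.
  (* Continuity of [mu] from below supplies one [M] valid for all translations at once. *)
  have [M hM] : exists M, m ((\bigcup_i F i) `\` G M) <= e / 4.
    have cv : mu (G M) @[M --> \oo] --> mu (\bigcup_M G M).
      apply: (nondecreasing_cvg_mu (F := G)) => //; first by rewrite -UG.
      by move=> M M' MM'; apply/subsetPset => x [i /= iM Fx]; exists i => //=;
        exact: leq_trans MM'.
    have {}cv : m (G M) @[M --> \oo] --> m (\bigcup_i F i).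
      by rewrite UG; apply: fine_cvg; rewrite fineK ?fin_num_measure// -UG.
    move/cvgrPdist_le : cv => /(_ _ e40)[M _ /(_ M (leqnn _))] h; exists M.
    have GM : G M `<=` \bigcup_i F i by rewrite UG; exact: bigcup_sup.
    have /= := @fine_measure_setU (G M) ((\bigcup_i F i) `\` G M) (mG M) (measurableD
      mU (mG M)) (setDIK _ _).
    by rewrite setDUK// => E; move: h; rewrite E addrAC subrr add0r =>
      /(le_trans (ler_norm _)).
  have [N hN] := cG M _ e40.
  exists N => k /hN {}hN.
  have GM : G M `<=` \bigcup_i F i by rewrite UG; exact: bigcup_sup.
  have mD := measurableD mU (mG M).
  rewrite (dominated_diff (dnu k) mU (mG M) GM) (dominated_diff dnu0 mU (mG M) GM).
  have /andP[? ?] := (dnu k).2 _ mD; have /andP[? ?] := dnu0.2 _ mD.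
  by move: hN; rewrite !ler_norml => /andP[? ?]; apply/andP; split; lra.
Qed.

Definition index_source (i : clock_or_walk d.+1) : source d.+1 :=
  match i with inl z => z | inr p => p.1 end.
Definition box_index M : set (clock_or_walk d.+1) := [set i |
  index_source i \in box d M].
(** Local events, which depend on finitely many sources. They form a pi-system because boxes are
    nested, and translating one of them far enough makes it exactly independent of another. *)
Definition box_events : set_system X := [set A | exists M, sigma_input (box_index M) A].

Lemma box_index_subset M N : (M <= N)%N -> box_index M `<=` box_index N.
Proof. by move=> MN i; exact: box_subset. Qed.

Lemma box_eventsI : setI_closed box_events.
Proof.
move=> A B [M sA] [N sB]; exists (maxn M N).
have {}sA := sigma_input_subset (box_index_subset (leq_maxl M N)) sA.
have {}sB := sigma_input_subset (box_index_subset (leq_maxr M N)) sB.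
exact: (@measurableI _ (g_sigma_algebraType (input_coordinates (box_index (maxn M
  N))))).
Qed.

Lemma box_events_generate A : measurable A -> <<s box_events >> A.
Proof.
apply: smallest_sub; first exact: smallest_sigma_algebra.
move=> B [[z [j [C [_ mC ->]]]]|[z [j [k [y [_ ->]]]]]]; apply: sub_gen_smallest.
  have [M zM] := box_total z; exists M; apply: sub_gen_smallest.
  by left; exists z, j, C.
have [M zM] := box_total z; exists M; apply: sub_gen_smallest.
by right; exists z, j, k, y.
Qed.

Lemma box_events_measurable A : box_events A -> measurable A.
Proof. by move=> [M]; exact: sigma_input_measurable. Qed.

Lemma box_shift_disjoint M N (k : source d.+1) : (M + N < sup_norm (val k))%N ->
  box_index M `&` (shift_index (opp_source k) @` box_index N) = set0.
Proof.
move=> MN; apply/seteqP; split=> // i [iM [i' iN e]].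
suff : (sup_norm (val k) <= M + N)%N by rewrite leqNgt MN.
have ei : index_source i = add_source (opp_source k) (index_source i').
  by rewrite -e; case: i' {iN e}.
move: iM iN; rewrite /box_index /= ei !mem_box => /forallP hM /forallP hN.
apply/bigmax_leqP => a _; have [a0|a0] := eqVneq (val a) 0%N.
  by have /forallP/(_ a)/implyP := valP k; rewrite a0 => /(_ isT)/eqP->.
have := implyP (hM a) a0; have := implyP (hN a) a0; rewrite !mxE.
move: (val (index_source i') ord0 a) (val k ord0 a) => b c; lia.
Qed.

Lemma preimage_shift_measurable k (A : set X) : measurable A ->
  measurable (shift_input k @^-1` A).
Proof. by move=> mA; have := @measurable_shift d R k measurableT A mA; rewrite setTI.
  Qed.

Lemma fine_shift k (A : set X) : measurable A -> m (shift_input k @^-1` A) = m A.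
Proof. by move=> mA; rewrite (law_shift hmu). Qed.

Lemma dominated_meas (B : set X) : measurable B -> dominated (fun A => m (A `&` B)).
Proof.
move=> mB; split=> [A A' mA mA' AA'|A mA].
  rewrite setIUl fine_measure_setU//; try exact: measurableI.
  by rewrite setIACA AA' set0I.
by rewrite fine_ge0//= fine_measure_le//; first [exact: measurableI|exact: subIsetl].
Qed.

Lemma dominated_scale (c : R) : 0 <= c <= 1 -> dominated (fun A => m A * c).
Proof.
move=> /andP[c0 c1]; split=> [A A' mA mA' AA'|A mA].
  by rewrite fine_measure_setU// mulrDl.
by rewrite mulr_ge0 ?fine_ge0//= ler_piMr// fine_ge0.
Qed.

Lemma m01 (A : set X) : measurable A -> 0 <= m A <= 1.
Proof. by move=> mA; rewrite fine_ge0//= -lee_fin -mfin// probability_le1. Qed.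

(** Exact independence of distant local events is extended to one argument at a time by
    [dynkin_converges]. In the second extension, the domination by [mu] of the translated events
    comes from the invariance of the law. *)
Lemma input_mixing (A B : set X) : measurable A -> measurable B ->
  converges (fun k C => m (A `&` shift_input k @^-1` C)) (fun C => m C * m A) B.
Proof.
move=> mA mB.
have box_mix A' B' : box_events A' -> box_events B' ->
    converges (fun k C => m (C `&` shift_input k @^-1` B')) (fun C => m C * m B') A'.
  move=> [M sA] [N sB] e e0; exists (M + N).+1%N => k kMN.
  rewrite (law_indep hmu (box_shift_disjoint kMN) sA (@preimage_shift_sigma d R k _ _
    sB)).
  have mA' := sigma_input_measurable sA; have mB' := sigma_input_measurable sB.
  by rewrite (law_shift hmu)// fineM ?fin_num_measure// subrr normr0 ltW.
have half A' B' : measurable A' -> box_events B' ->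
    converges (fun k C => m (C `&` shift_input k @^-1` B')) (fun C => m C * m B') A'.
  move=> mA' bB; have mB' := box_events_measurable bB.
  have dyn : dynkin [set C : set X | measurable C /\
     converges (fun k C => m (C `&` shift_input k @^-1` B')) (fun C => m C * m B') C].
    apply: dynkin_converges => [k||].
    - by apply: dominated_meas; exact: preimage_shift_measurable.
    - by apply: dominated_scale; exact: m01.
    - move=> e e0; exists 0%N => k _.
      by rewrite setTI fine_shift// probability_setT mul1r subrr normr0 ltW.
  have [] := dynkin_class box_eventsI dyn _ (box_events_generate mA') => //.
  by move=> C bC; split; [exact: box_events_measurable|exact: box_mix].
have dyn : dynkin [set C : set X | measurable C /\
   converges (fun k C => m (A `&` shift_input k @^-1` C)) (fun C => m C * m A) C].
  apply: dynkin_converges => [k||].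
  - split=> [C C' mC mC' CC'|C mC].
      rewrite -fine_measure_setU; [by rewrite -setIUr -preimage_setU| | |].
      - by apply: measurableI => //; exact: preimage_shift_measurable.
      - by apply: measurableI => //; exact: preimage_shift_measurable.
      - by rewrite setIACA -preimage_setI CC' preimage_set0 setI0.
    rewrite fine_ge0//= -(fine_shift k mC) fine_measure_le//.
    + by apply: measurableI => //; exact: preimage_shift_measurable.
    + exact: preimage_shift_measurable.
  - by apply: dominated_scale; exact: m01.
  - move=> e e0; exists 0%N => k _.
    by rewrite preimage_setT setIT probability_setT mul1r subrr normr0 ltW.
have [] := dynkin_class box_eventsI dyn _ (box_events_generate mB) => //.
move=> C bC; split; first exact: box_events_measurable.
by move=> e e0; have [N h] := half A C mA bC e e0; exists N => k /h; rewrite mulrC.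
Qed.

End Mixing.

(** * Covering and conclusion *)

Section LatticePath.
Variable d : nat.

(** Induction on the l1 norm of [y]: the last step is a unit step along a nonzero coordinate, with
    its sign. *)
Lemma lattice_path (y : lattice d.+1) : exists c m, [/\ c 0%N = 0 :> lattice d.+1,
  c m = y &
  forall i, (i < m)%N -> is_step (c i.+1 - c i)].
Proof.
move: {2}(\sum_(i < d.+1) `|y ord0 i|)%N (erefl (\sum_(i < d.+1) `|y ord0 i|)%N) => s.
elim: s y => [|s IH] y ys.
  exists (fun=> 0), 0%N; split=> //; apply/matrixP => a i; rewrite mxE (_ : a = ord0);
    last by rewrite (ord1 a).
  have : (`|y ord0 i| <= \sum_(i < d.+1) `|y ord0 i|)%N by rewrite (bigD1 i)//=
    leq_addr.
  by rewrite ys leqn0 absz_eq0 => /eqP->.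
have [i yi] : exists i, y ord0 i != 0.
  apply: contrapT => /forallNP y0; move: ys; rewrite big1// => i _.
  by have /negP := y0 i; rewrite negbK => /eqP->.
pose e := unit_step (i, y ord0 i < 0).
have [|c [m [c0 cm cs]]] := IH (y - e).
  move: ys; rewrite (bigD1 i)//= [in X in _ -> X](bigD1 i)//= !mxE eqxx /=.
  rewrite [in X in _ -> X](eq_bigr (fun j => `|y ord0 j|%N)); last first.
    by move=> j /negbTE ji; rewrite !mxE ji subr0.
  by case: ltP => h; rewrite ?expr0 ?expr1; move: (y ord0 i) yi h (\sum_(i0 < d.+1 |
    i0 != i) _)%N => a a0 ha t; lia.
exists (fun k => if (k <= m)%N then c k else y), m.+1; split=> //.
  by rewrite ltnn.
move=> k; rewrite ltnS leq_eqVlt => /predU1P[->|km].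
  by rewrite ltnn eqxx /= cm opprB addrC subrK is_step_unit.
by rewrite km orbT cs.
Qed.

End LatticePath.

Section Cover.
Variables (d : nat) (R : realType).
Notation X := (input d.+1 R).
Variable mu : probability X R.
Hypothesis hmu : idla_law mu.

Lemma ae_cover : {ae mu, forall x : X,
  vertices (forest_infty x.1 x.2) = [set: lattice d.+1]}.
Proof.
suff : {ae mu, forall x : X, forall y, vertices (forest_infty x.1 x.2) y}.
  by apply: filterS => x h; apply/seteqP; split.
apply: ae_forall_countable => y; have [c [m [c0 <- cs]]] := lattice_path y.
apply: filterS3 (ae_stable hmu) (law_ge0 hmu) (@law_path _ _ _ hmu (source0 d.+1) c m
  c0 cs) => x st ge0 hp.
have [js [ujs sjs hjs]] : exists js : seq nat, [/\ uniq js, size js = m.+1 &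
    forall j, j \in js -> forall i, (i <= m)%N -> wk x (source0 d.+1, j) i = c i].
  (* Each new index is taken beyond the previous ones, so that the [m.+1] walks are distinct. *)
  elim: m.+1 => [|k [js [ujs sjs hjs]]]; first by exists [::].
  have [j jmax hj] := hp (\max_(i <- js) i).+1%N.
  exists (j :: js); split=> /=; rewrite ?sjs ?ujs ?andbT//.
    by apply/negP => jj; have := @leq_bigmax_seq _ js xpredT id j jj isT;
      rewrite leqNgt jmax.
  by move=> i; rewrite inE => /predU1P[->|]; [exact: hj|exact: hjs].
have hx := stable_regular st.
pose Q := [seq (source0 d.+1, j) | j <- js].
have [n nQ] : exists n : nat, (1 <= n)%N /\ forall q, q \in Q -> tm x q <= n%:R.
  elim: Q => [|q Q [n [n1 nQ]]]; first by exists 1%N.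
  exists (maxn n (Num.truncn (tm x q)).+1); split; first by rewrite leq_max n1.
  move=> p; rewrite inE => /predU1P[->|/nQ pn].
    by rewrite (le_trans (ltW (truncnS_gt _)))// ler_nat leq_maxr.
  by rewrite (le_trans pn)// ler_nat leq_maxl.
case: nQ => n1 nQ; exists n => //.
change (vertices (forest_of x n) (c m));
  rewrite (forest_limit n st) -[n == _]negbK -lt0n n1 /=.
exists Q; first by move=> q qQ; split=> //; rewrite ge0 nQ.
apply: (run_path hx (Q0 := Q)) => //.
- by rewrite map_inj_uniq// => i j [].
- by rewrite size_map sjs.
- by move=> _ i /mapP[j jj ->]; exact: hjs.
Qed.

End Cover.

(** * Invariance, mixing and ergodicity of equivariant functions of the input *)

Section Factor.
Variables (d : nat) (R : realType).
Context (disp : measure_display) (Omega : measurableType disp) (P : probability Omega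
  R).
Variables (tau : source d.+1 -> nat -> {RV P >-> R})
    (S : source d.+1 -> nat -> nat -> {RV P >-> lattice d.+1}).
Hypothesis hin : idla_input tau S.
Hypothesis d_gt0 : (0 < d)%N.
Local Notation mu := (law tau S).
Local Notation X := (input d.+1 R).
Let hmu := law_idla hin.

Context (dT : measure_display) (T : measurableType dT)
  (theta : source d.+1 -> T -> T) (Psi : X -> T).
Hypothesis mtheta : forall k, measurable_fun setT (theta k).
Hypothesis mPsi : measurable_fun setT Psi.
Hypothesis equiv : forall k, {ae mu, forall x, Psi (shift_input k x) = theta k (Psi x)}.

Let F w := Psi (input_map tau S w).

Let mPsiA A : measurable A -> measurable (Psi @^-1` A).
Proof. by move=> mA; have := mPsi measurableT mA; rewrite setTI. Qed.

Let mthetaA k A : measurable A -> measurable (theta k @^-1` A).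
Proof. by move=> mA; have := mtheta k measurableT mA; rewrite setTI. Qed.

(** The translate of a value is replaced by the value at the translated input, to which invariance
    and mixing of [mu] apply. Almost sure equivariance is enough for this. *)
Let joint k A B : measurable A -> measurable B ->
  P [set w | A (F w) /\ B (theta k (F w))] =
  mu ((Psi @^-1` A) `&` (shift_input k @^-1` (Psi @^-1` B))).
Proof.
move=> mA mB; change (mu ((Psi @^-1` A) `&` (Psi @^-1` (theta k @^-1` B))) =
  mu ((Psi @^-1` A) `&` (shift_input k @^-1` (Psi @^-1` B)))).
apply: ae_measure_eq.
- by apply: measurableI; apply: mPsiA => //; exact: mthetaA.
- by apply: measurableI; [exact: mPsiA|apply: preimage_shift_measurable; exact: mPsiA].
- by apply: filterS (equiv k) => x E; rewrite /setI /preimage /= E.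
Qed.

Lemma factor_measurable : measurable_fun setT F.
Proof. exact: (measurableT_comp mPsi (measurable_input_map tau S)). Qed.

Lemma factor_invariant : law_invariant P theta F.
Proof.
move=> k A mA; have := joint k measurableT mA.
rewrite preimage_setT setTI (law_shift hmu)//; last exact: mPsiA.
rewrite [X in P X = _](_ : _ = [set w | A (theta k (F w))]); first by move=> ->.
by apply/seteqP; split=> w /=; [case|].
Qed.

Lemma factor_mixing : law_mixing P theta F.
Proof.
move=> A B mA mB.
have mA' := mPsiA mA; have mB' := mPsiA mB.
have -> : (fun k => P [set w | A (F w) /\ B (theta k (F w))]) =
    (fun k => (fine (mu ((Psi @^-1` A) `&` (shift_input k @^-1` (Psi @^-1` B)))))%:E).
  apply/funext => k; rewrite joint// fineK// fin_num_measure//.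
  by apply: measurableI => //; exact: preimage_shift_measurable.
rewrite (_ : (P _ * P _)%E = (fine (mu (Psi @^-1` B)) * fine (mu (Psi @^-1` A)))%:E);
  last first.
  by rewrite mulrC EFinM !fineK ?fin_num_measure.
apply: cvg_EFin; first by apply: nearW.
apply/cvgrPdist_le => e e0; have [N hN] := input_mixing hmu mA' mB' e0.
by exists N => // k /= /hN; rewrite distrC.
Qed.

Lemma factor_ergodic : law_ergodic P theta F.
Proof.
move=> A mA inv; have mA' := mPsiA mA.
pose p := fine (mu (Psi @^-1` A)).
have Pp : P [set w | A (F w)] = p%:E.
  by rewrite /p fineK ?fin_num_measure.
have Pk k : P [set w | A (F w) /\ A (theta k (F w))] = p%:E.
  rewrite -Pp; congr (P _); apply/seteqP; split=> w /=; first by case.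
  by move=> h; split=> //; change ((theta k @^-1` A) (F w)); rewrite inv.
(* The existence of a second coordinate, [d_gt0], enters here: with the first coordinate alone, 0
   would be the only source and the limit in [k] would carry no information. *)
have far N : exists k : source d.+1, (N <= sup_norm (val k))%N.
  pose i1 : 'I_d.+1 := lift ord0 (Ordinal d_gt0).
  pose v : lattice d.+1 := \row_i (if i == i1 then N%:Z else 0).
  have vH : in_H v.
    apply/forallP => i; apply/implyP => /eqP i0; rewrite mxE; case: (i =P i1) => // e.
    by move: i0; rewrite e.
  exists (exist (@in_H d.+1) v vH) => /=.
  have := leq_bigmax (F := fun i => `|v ord0 i|%N) i1; by rewrite mxE eqxx absz_nat.
(* For an invariant event the joint probability equals [p] for every [k], while mixing makes it tend
   to [p * p]. *)
have pp : p = p * p.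
  apply/eqP; rewrite -subr_eq0 -normr_eq0 eq_le normr_ge0 andbT.
  apply/ler_addgt0Pr => e e0; rewrite add0r.
  have [N hN] := input_mixing hmu mA' mA' e0; have [k /hN] := far N.
  by rewrite -(joint k mA mA) Pk.
rewrite Pp; have /eqP : p * (p - 1) = 0 by rewrite mulrBr mulr1 -pp subrr.
by rewrite mulf_eq0 subr_eq0 => /orP[]/eqP->; [left|right].
Qed.

End Factor.

(** * Measurability and equivariance of the forests *)

Section Equivariance.
Variables (d : nat) (R : realType).
Local Notation X := (input d.+1 R).

Lemma measurable_translate k : measurable_fun setT (@translate_graph d.+1 k).
Proof.
apply/measurable_graphP; split=> [y|e].
  apply: (@mset_eq _ _ [set G : graph d.+1 | vertices G (y - val k)]).
    by apply: sub_gen_smallest; left; exists (y - val k).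
  by move=> G; exact: translate_vertices.
apply: (@mset_eq _ _ [set G : graph d.+1 | edges G (e.1 - val k, e.2 - val k)]).
  by apply: sub_gen_smallest; right; exists (e.1 - val k, e.2 - val k).
by move=> G; exact: translate_edges.
Qed.

Lemma measurable_graph_seq (disp : measure_display) (T : measurableType disp)
    (G : T -> graph_seq d.+1) :
  (forall n, measurable_fun setT (fun x => G x n)) -> measurable_fun setT G.
Proof.
move=> mG _ A mA; rewrite setTI; apply: (preimage_sigma _ _ mA);
  first exact: sigma_algebra_measurable.
by move=> _ [n [B [mB ->]]]; have := mG n measurableT B mB; rewrite setTI.
Qed.

Lemma measurable_coordinate n : measurable_fun setT (fun G : graph_seq d.+1 => G n).
Proof.
by move=> _ B mB; rewrite setTI; apply: sub_gen_smallest; exists n, B.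
Qed.

Lemma measurable_translate_seq k : measurable_fun setT (@translate_graph_seq d.+1 k).
Proof.
apply: measurable_graph_seq => n.
exact: (measurableT_comp (measurable_translate k) (measurable_coordinate n)).
Qed.

Lemma measurable_forest_seq : measurable_fun setT (@forest_of d R : X ->
  graph_seq d.+1).
Proof. by apply: measurable_graph_seq => n; apply/measurable_graphP;
  exact: measurable_forest. Qed.

Lemma measurable_forest_infty : measurable_fun setT (fun x : X => forest_infty x.1 x.2).
Proof.
apply/measurable_graphP; split=> [y|e].
  apply: (@mset_eq _ _ [set x : X | exists n,
    (1 <= n)%N /\ vertices (forest_of x n) y]).
    by apply: mset_exists => n; apply: mset_and; [exact: mset_cst|have [h _] :=
      measurable_forest d R n].
  by move=> x; split=> [[n n1 h]|[n [n1 h]]]; exists n.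
apply: (@mset_eq _ _ [set x : X | exists n, (1 <= n)%N /\ edges (forest_of x n) e]).
  by apply: mset_exists => n; apply: mset_and; [exact: mset_cst|have [_ h] :=
    measurable_forest d R n].
by move=> x; split=> [[n n1 h]|[n [n1 h]]]; exists n.
Qed.

(** The ranks chosen for [x] and for its translate are unrelated, and cylinders are not preserved by
    translations. Stability of both inputs identifies both forests with the limiting one, which is
    covariant. *)
Lemma forest_shift k (x : X) n : stable x -> stable (shift_input k x) ->
  forest_of (shift_input k x) n = translate_graph k (forest_of x n).
Proof.
move=> st st'; rewrite !forest_limit//; case: eqP => _; last exact: limit_forest_shift.
by apply/graph_eqP; split=> [y|e];
  rewrite ?(propext (translate_vertices _ _ _)) ?(propext (translate_edges _ _ _)).
Qed.

Lemma forest_infty_shift k (x : X) : stable x -> stable (shift_input k x) ->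
  forest_infty (shift_input k x).1 (shift_input k x).2 = translate_graph k
    (forest_infty x.1 x.2).
Proof.
move=> st st'; have E n := @forest_shift k x n st st'.
apply/graph_eqP; split=> [y|e].
  rewrite (propext (translate_vertices _ _ _)); split=> -[n n1 h]; exists n => //.
    by apply/translate_vertices; rewrite -E.
  by have /translate_vertices := h; rewrite -E.
rewrite (propext (translate_edges _ _ _)); split=> -[n n1 h]; exists n => //.
  by apply/translate_edges; rewrite -E.
by have /translate_edges := h; rewrite -E.
Qed.

Lemma ae_stable_shift (mu : probability X R) k : idla_law mu ->
  {ae mu, forall x : X, stable x /\ stable (shift_input k x)}.
Proof.
move=> hmu; have st := ae_stable hmu.
have st' : {ae mu, forall x : X, stable (shift_input k x)}.
  case: st => N [mN N0 hN]; exists (shift_input k @^-1` N); split.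
  - exact: preimage_shift_measurable.
  - by rewrite (law_shift hmu).
  - by move=> x /=; exact: hN.
by apply: filterS2 st st' => x.
Qed.

End Equivariance.

Local Close Scope ring_scope.
Unset Implicit Arguments.

Theorem theorem1p2 (d : nat) (R : realType) (disp : measure_display)
    (Omega : measurableType disp) (P : probability Omega R)
    (tau : source d -> nat -> {RV P >-> R})
    (S : source d -> nat -> nat -> {RV P >-> lattice d})
    (hd : (2 <= d)%N) (hinput : idla_input tau S) :
  let F : Omega -> graph_seq d := idla_forest tau S in
  let Finfty := idla_forest_infty tau S in
  (measurable_fun setT F /\ measurable_fun setT Finfty) /\
  {ae P, forall w, vertices (Finfty w) = [set: lattice d]} /\
  (law_invariant P (@translate_graph_seq d) F /\
   law_invariant P (@translate_graph d) Finfty) /\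
  ((forall n, law_mixing P (@translate_graph d) (fun w => F w n)) /\
   law_mixing P (@translate_graph d) Finfty) /\
  (law_ergodic P (@translate_graph_seq d) F /\
   law_ergodic P (@translate_graph d) Finfty).
Proof.
(* With the dimension written [d.+1], the hypothesis [hd] becomes the positivity of [d] required for
   ergodicity. *)
case: d tau S hd hinput => // d tau S hd hin F Finfty.
have hmu := law_idla hin.
have eseq k : {ae law tau S, forall x,
  (forest_of (shift_input k x) : graph_seq d.+1) = translate_graph_seq k (forest_of x)}.
  by apply: filterS (ae_stable_shift k hmu) => x [st st']; apply/funext => n;
    exact: forest_shift.
have en n k : {ae law tau S, forall x,
  forest_of (shift_input k x) n = translate_graph k (forest_of x n)}.
  by apply: filterS (ae_stable_shift k hmu) => x [st st']; exact: forest_shift.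
have einf k : {ae law tau S, forall x,
  forest_infty (shift_input k x).1 (shift_input k x).2 = translate_graph k
  (forest_infty x.1 x.2)}.
  by apply: filterS (ae_stable_shift k hmu) => x [st st']; exact: forest_infty_shift.
have mseq := @measurable_forest_seq d R.
have minf := @measurable_forest_infty d R.
have mn n : measurable_fun setT (fun x : input d.+1 R => forest_of x n).
  by apply/measurable_graphP; exact: measurable_forest.
have mts := @measurable_translate_seq d.
have mt := @measurable_translate d.
split; [split|split; [|split; [split|split; [split|split]]]].
- exact: (factor_measurable tau S mseq).
- exact: (factor_measurable tau S minf).
- have [N [mN N0 hN]] := ae_cover hmu.
  exists (input_map tau S @^-1` N); split=> //.
  + by have := measurable_input_map tau S measurableT mN; rewrite setTI.
  + by move=> w hw; apply: hN.
- exact: (factor_invariant hin mts mseq eseq).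
- exact: (factor_invariant hin mt minf einf).
- by move=> n; exact: (factor_mixing hin mt (mn n) (en n)).
- exact: (factor_mixing hin mt minf einf).
- exact: (factor_ergodic hin hd mts mseq eseq).
- exact: (factor_ergodic hin hd mt minf einf).
Qed.
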